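(* For any $\kappa>0$ and $0<\alpha<\alpha_c(\kappa)$, one has $F_{\kappa,\alpha}(x)<F_{\kappa,\alpha}\left(\frac12\right)$ for every $x\in[0,1]$ with $x\ne\frac12$.
   Context: For $0\le x\le1$, let $(N_1,N_2)$ be a (possibly degenerate) centered bivariate Gaussian with unit variances and correlation $2x-1$, and set $q_\kappa(x)=\mathbb{P}(|N_1|\le\kappa,|N_2|\le\kappa)$ and $F_{\kappa,\alpha}(x)=\alpha\log q_\kappa(x)-x\log x-(1-x)\log(1-x)$ (with $0\log0=0$). With $N$ a standard normal variable, $P_\kappa=\mathbb{P}(|N|\le\kappa)$ and $\alpha_c(\kappa)=-\frac{\log2}{\log P_\kappa}$. *)

(* Defs.v *)
From HB Require Import structures.
From mathcomp Require Import all_boot all_order all_algebra.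
From mathcomp Require Import all_classical all_reals all_analysis.
From mathcomp Require Import measurable_realfun.

Set Implicit Arguments.
Unset Strict Implicit.
Unset Printing Implicit Defensive.

Import Order.TTheory GRing.Theory Num.Theory.
Import numFieldNormedType.Exports.

Local Open Scope classical_set_scope.
Local Open Scope ring_scope.

Section gaussian_pair.
Variable R : realType.
Implicit Types kappa alpha rho x : R.

Local Notation Omega := (measurableTypeR R * measurableTypeR R)%type.

(* The joint law of two independent standard normal variables Z1, Z2, which are
   the coordinates of w : Omega. *)
Definition std_gaussian2 : probability Omega R :=
  (@normal_prob R 0 1 \x @normal_prob R 0 1)%E.

(* For -1 <= rho <= 1, (N1, N2 rho) = (Z1, rho Z1 + sqrt (1 - rho^2) Z2) is a
   linear image of (Z1, Z2), hence a centered Gaussian vector, with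
   Var N1 = 1, Var (N2 rho) = rho^2 + (1 - rho^2) = 1 and Cov (N1, N2 rho) = rho.
   It is degenerate (N2 rho = rho N1) exactly for rho = -1 and rho = 1. *)
Definition N1 (w : Omega) : R := w.1.
Definition N2 rho (w : Omega) : R :=
  rho * w.1 + Num.sqrt (1 - rho ^+ 2) * w.2.

Lemma measurable_N1 : measurable_fun setT (N1 : Omega -> R).
Proof. exact: measurable_fst. Qed.

Lemma measurable_N2 rho : measurable_fun setT (N2 rho : Omega -> R).
Proof.
by apply: measurable_funD;
  apply: measurable_funM.
Qed.

HB.instance Definition _ := @isMeasurableFun.Build _ _ _ _ N1 measurable_N1.
HB.instance Definition _ rho :=
  @isMeasurableFun.Build _ _ _ _ (N2 rho) (measurable_N2 rho).

Definition q kappa x : R :=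
  fine (std_gaussian2
    [set w | `|N1 w| <= kappa /\ `|N2 (2 * x - 1) w| <= kappa]).

(* The library sets [ln 0 = 0]; only [0 * ln 0 = 0] matters here. *)
Definition F kappa alpha x : R :=
  alpha * ln (q kappa x) - x * ln x - (1 - x) * ln (1 - x).

Definition Pkappa kappa : R :=
  fine (@normal_prob R 0 1 [set z | `|z| <= kappa]).

Definition alpha_c kappa : R := - (ln 2 / ln (Pkappa kappa)).

End gaussian_pair.

(* Main.v *)
Require Import Defs.
From mathcomp Require Import all_boot all_order all_algebra.
From mathcomp Require Import all_classical all_reals all_analysis.
From Stdlib Require Import ZArith.
From mathcomp Require Import measurable_realfun zify ssrZ ring lra.

Import Order.TTheory GRing.Theory Num.Theory.
Import numFieldNormedType.Exports.

Set Implicit Arguments.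
Unset Strict Implicit.
Unset Printing Implicit Defensive.

Local Open Scope classical_set_scope.
Local Open Scope ring_scope.

(* With rho = 2 x - 1 the entropy term is ln 2 - J(rho), where J' = artanh, and the
   hypothesis on alpha says alpha * lam < 1 for lam = - ln P / ln 2. It therefore
   suffices to prove q(rho) <= P^2 exp (lam J(rho)) for 0 <= rho <= 1, an inequality
   that is an equality at rho = 0 and at rho = 1.

   By Plackett's identity q'(rho) is explicit, so the ratio of the derivatives of the
   two sides is explicit too. If the ratio is at least 1 on ]0, r], the inequality
   holds there by integration from 0. If its logarithm decreases on ]r, 1[, the
   difference of the two sides is first increasing, then decreasing to its limit 0,
   so the inequality extends from r to 1.

   Put y = k^2. For very small and for large y both facts, with a suitable r, follow
   from elementary estimates. On the remaining compact range they are reduced to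
   finitely many numerical inequalities, checked by interval arithmetic: lam is convex
   in y and the Mills ratio is bounded below by a convex polynomial, so both are
   bounded below by tangents, and the logarithm of the ratio obtained from these
   tangents is concave in y; hence two values of y control a whole interval.
   Monotonicity in rho reduces each interval of rho to its endpoints. *)

(** * Derivatives *)

(** The bound on q is the claim at the critical alpha: there F has the same value at x = 1/2 and at
    x = 1, so neither end leaves any slack. Near rho = 1 the derivative of q grows like (1 -
    rho)^(-1/2), that of the bound only like - ln (1 - rho); their ratio tends to 0, and integration
    from 0 cannot reach 1. This is why the right part is anchored at the common limit P. As rho
    tends to 0 the ratio tends to [lam * mills ^ 2], which exceeds 1 by less than two percent for y
    near 1.8: this thin margin is the reason for the numerical certificate. No compact table reaches
    y = 0, where [lam] is unbounded, or infinite y, where [lam] tends to 0. For small y the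
    inequality to the left of r is obtained without the ratio, from q <= P^2 / sqrt (1 - rho^2). *)

Section derivative_rules.
Variable R : realType.
Implicit Types (f g : R -> R) (a b c x : R).

(* Unlike [is_derive], not a type class: the rules below are chained by [apply]
   and must not trigger instance resolution. *)
Definition has_derive f x a : Prop := is_derive x 1 f a.

Lemma has_derive_congr f x a b :
  has_derive f x a -> a = b -> has_derive f x b.
Proof. by move=> + <-. Qed.

Lemma has_derive_D f g x a b : has_derive f x a -> has_derive g x b ->
  has_derive (fun t => f t + g t) x (a + b).
Proof. by move=> fa gb; exact: is_deriveD. Qed.

Lemma has_derive_B f g x a b : has_derive f x a -> has_derive g x b ->
  has_derive (fun t => f t - g t) x (a - b).
Proof. by move=> fa gb; exact: is_deriveB. Qed.

Lemma has_derive_N f x a : has_derive f x a ->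
  has_derive (fun t => - f t) x (- a).
Proof. by move=> fa; exact: is_deriveN. Qed.

Lemma has_derive_M f g x a b : has_derive f x a -> has_derive g x b ->
  has_derive (fun t => f t * g t) x (a * g x + f x * b).
Proof.
move=> fa gb; have H := is_deriveM fa gb; apply: (has_derive_congr H).
by rewrite /GRing.scale /= addrC mulrC.
Qed.

Lemma has_derive_X f n x a : has_derive f x a ->
  has_derive (fun t => f t ^+ n.+1) x (n.+1%:R * f x ^+ n * a).
Proof.
move=> fa; elim: n => [|n IH].
  by apply: (has_derive_congr fa); rewrite expr0 mulr1 mul1r.
rewrite (_ : (fun t => _) = (fun t => f t * f t ^+ n.+1)); last first.
  by apply/funext => t; rewrite exprS.
apply: (has_derive_congr (has_derive_M fa IH)).
by rewrite -[in RHS](addn1 n.+1) natrD exprS; ring.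
Qed.

Lemma has_derive_V f x a : has_derive f x a -> f x != 0 ->
  has_derive (fun t => (f t)^-1) x (- a / f x ^+ 2).
Proof.
move=> fa f0; have H := is_deriveV f0 fa; apply: (has_derive_congr H).
by rewrite /GRing.scale /= !mulNr mulrC.
Qed.

Lemma has_derive_ln f x a : has_derive f x a -> 0 < f x ->
  has_derive (fun t => ln (f t)) x (a / f x).
Proof.
move=> fa f0; rewrite mulrC.
exact: (@is_derive1_comp _ (@ln R) f x _ _ (is_derive1_ln f0) fa).
Qed.

Lemma has_derive_exp f x a : has_derive f x a ->
  has_derive (fun t => expR (f t)) x (expR (f x) * a).
Proof.
by move=> fa; exact: (@is_derive1_comp _ (@expR R) f x _ _ (is_derive_expR _) fa).
Qed.

Lemma has_derive_cst a x : has_derive (fun _ : R => a) x 0.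
Proof. exact: is_derive_cst. Qed.

Lemma has_derive_id x : has_derive (fun t : R => t) x 1.
Proof. exact: is_derive_id. Qed.

Lemma has_derive_continuous f x a : has_derive f x a -> {for x, continuous f}.
Proof.
by move=> [fa _]; apply/differentiable_continuous/derivable1_diffP.
Qed.

Lemma derive_ge0_le f (f' : R -> R) a b : a <= b ->
  (forall x, a <= x <= b -> has_derive f x (f' x)) ->
  (forall x, a < x < b -> 0 <= f' x) -> f a <= f b.
Proof.
rewrite le_eqVlt => /predU1P[->//|ab] df f'0.
have dfi x : x \in `]a, b[ -> is_derive x 1 f (f' x).
  by rewrite in_itv/= => /andP[ax xb]; apply: df; rewrite !ltW.
have cf : {within `[a, b], continuous f}.
  apply: continuous_in_subspaceT => x /[!inE] /= /[!in_itv]/= xab.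
  exact: has_derive_continuous (df _ xab).
have [c /[!in_itv]/= cab] := MVT ab dfi cf.
by rewrite -subr_ge0 => ->; rewrite mulr_ge0 ?f'0// subr_ge0 ltW.
Qed.

Lemma derive_gt0_lt f (f' : R -> R) a b : a < b ->
  (forall x, a <= x <= b -> has_derive f x (f' x)) ->
  (forall x, a < x < b -> 0 < f' x) -> f a < f b.
Proof.
move=> ab df f'0.
have dfi x : x \in `]a, b[ -> is_derive x 1 f (f' x).
  by rewrite in_itv/= => /andP[ax xb]; apply: df; rewrite !ltW.
have cf : {within `[a, b], continuous f}.
  apply: continuous_in_subspaceT => x /[!inE] /= /[!in_itv]/= xab.
  exact: has_derive_continuous (df _ xab).
have [c /[!in_itv]/= cab] := MVT ab dfi cf.
by rewrite -subr_gt0 => ->; rewrite mulr_gt0 ?f'0// subr_gt0.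
Qed.

(** Concavity expressed by a decreasing first derivative. Its sign at [x] decides whether [f x] is
    compared with [f a] or with [f b]. *)
Lemma nonneg_of_derive2_le0 f (f' : R -> R) a b x : a <= x <= b ->
  (forall t, a <= t <= b -> has_derive f t (f' t)) ->
  (forall s t, a <= s -> s <= t -> t <= b -> f' t <= f' s) ->
  0 <= f a -> 0 <= f b -> 0 <= f x.
Proof.
move=> /andP[ax xb] df dec fa fb.
have [f'x|f'x] := leP 0 (f' x).
  apply: (le_trans fa); apply: (@derive_ge0_le f f') => //.
    by move=> t /andP[at_ tx]; apply: df; rewrite at_ (le_trans tx).
  move=> t /andP[at_ tx]; apply: (le_trans f'x).
  by apply: dec => //; exact: ltW.
apply: (le_trans fb); rewrite -lerN2.
apply: (@derive_ge0_le (fun t => - f t) (fun t => - f' t)) => //.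
  move=> t /andP[xt tb]; apply: has_derive_N.
  by apply: df; rewrite tb (le_trans ax).
move=> t /andP[xt tb]; rewrite oppr_ge0 (le_trans _ (ltW f'x))//.
by apply: dec => //; exact: ltW.
Qed.

End derivative_rules.

(* Syntactic matching: plain [apply] would unfold defined functions. *)
Ltac derive_rule := match goal with
  | |- has_derive (fun _ => ?c) _ _ => apply: has_derive_cst
  | |- has_derive (fun t => t) _ _ => apply: has_derive_id
  | |- has_derive ( *%R ?c) _ _ => rewrite -[ *%R c]/(fun t => c * t)
  | |- has_derive ( +%R ?c) _ _ => rewrite -[ +%R c]/(fun t => c + t)
  | |- has_derive -%R _ _ => rewrite -[ -%R]/(fun t => - t)
  | |- has_derive (@expR _) _ _ => exact: is_derive_expR
  | |- has_derive (fun t => _ - _) _ _ => apply: has_derive_B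
  | |- has_derive (fun t => _ + _) _ _ => apply: has_derive_D
  | |- has_derive (fun t => - _) _ _ => apply: has_derive_N
  | |- has_derive (fun t => _^-1) _ _ => apply: has_derive_V
  | |- has_derive (fun t => _ ^+ _) _ _ => apply: has_derive_X
  | |- has_derive (fun t => _ * _) _ _ => apply: has_derive_M
  | |- has_derive (fun t => ln _) _ _ => apply: has_derive_ln
  | |- has_derive (fun t => expR _) _ _ => apply: has_derive_exp
  end.

Ltac derive_fun := apply: has_derive_congr; [repeat derive_rule | rewrite /=].

(** * The law of the pair as a function of the correlation *)

Section gaussian_cdf.
Variable R : realType.
Implicit Types (x a b k : R).
Local Notation mu := (@lebesgue_measure R).
Local Notation phi := (@normal_pdf R 0 1).

Lemma phiE x : phi x = normal_peak 1 * expR (- x ^+ 2 / 2).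
Proof.
rewrite normal_pdfE ?oner_neq0// /normal_fun subr0.
by rewrite (_ : (1 : R) ^+ 2 *+ 2 = 2)// expr1n.
Qed.

Lemma peak_sqr : (@normal_peak R 1) ^+ 2 = (2 * pi)^-1.
Proof.
have pi2 : 0 <= 2 * pi :> R by rewrite mulr_ge0// pi_ge0.
rewrite /normal_peak exprVn (_ : _ *+ 2 = 2 * pi) ?sqr_sqrtr//.
by rewrite expr1n mul1r mulr_natl.
Qed.

Lemma peak_gt0 : 0 < @normal_peak R 1.
Proof. by rewrite normal_peak_gt0// oner_neq0. Qed.

Lemma phi_gt0 x : 0 < phi x.
Proof. by rewrite phiE mulr_gt0 ?expR_gt0 ?peak_gt0. Qed.

Lemma phiN x : phi (- x) = phi x.
Proof. by rewrite !phiE sqrrN. Qed.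

Definition gauss_cdf x : R := \int[mu]_(t in `]-oo, x]) phi t.

Lemma integrable_phi (A : set R) : measurable A -> mu.-integrable A (EFin \o phi).
Proof.
by move=> mA; apply: (integrableS measurableT) => //; exact: integrable_normal_pdf.
Qed.

Lemma has_derive_cdf x : has_derive gauss_cdf x (phi x).
Proof.
have xx : x < x + 1 by rewrite ltrDl.
have [] := @continuous_FTC1 R phi -oo%O x (x + 1) xx.
- exact: integrable_phi.
- by rewrite ltNyr.
- by apply: continuous_normal_pdf; rewrite oner_neq0.
move=> dF dE; apply: (DeriveDef dF); rewrite -derive1E; exact: dE.
Qed.

Lemma normal_prob_itv a b : a <= b ->
  normal_prob 0 1 `[a, b]%classic = (gauss_cdf b - gauss_cdf a)%:E.
Proof.
move=> ab.
have := @Rintegral_itvB R phi -oo%O (BRight b) a (integrable_phi (measurable_itv _)).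
rewrite /gauss_cdf => ->//.
rewrite Rintegral_itv_obnd_cbnd; last exact: integrable_phi.
rewrite /normal_prob /Rintegral fineK//.
by apply: integrable_fin_num => //; exact: integrable_phi.
Qed.

Lemma PkappaE k : 0 <= k -> Pkappa k = gauss_cdf k - gauss_cdf (- k).
Proof.
move=> k0; rewrite /Pkappa (_ : [set z | _] = `[- k, k]%classic).
  by rewrite normal_prob_itv//= ge0_cp.
by apply/seteqP; split=> z /=; rewrite in_itv/= ler_norml.
Qed.

Lemma has_derive_P k :
  has_derive (fun k => gauss_cdf k - gauss_cdf (- k)) k (2 * phi k).
Proof.
apply: has_derive_congr.
  apply: has_derive_B; first exact: has_derive_cdf.
  have dN : has_derive (fun t : R => - t) k (- 1).
    by apply: has_derive_N; exact: has_derive_id.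
  exact: (@is_derive1_comp _ gauss_cdf _ k _ _ (has_derive_cdf _) dN).
by rewrite phiN; ring.
Qed.

End gaussian_cdf.

(** * Slicing the square event, and its symmetry in the correlation *)

Section bivariate.
Variable R : realType.
Implicit Types (x a b k rho : R).
Local Notation mu := (@lebesgue_measure R).
Local Notation phi := (@normal_pdf R 0 1).
Local Notation sigma rho := (Num.sqrt (1 - rho ^+ 2)).

(** The Radon-Nikodym derivative of the normal law equals [phi] almost everywhere, since both have
    the same integral over every measurable set. *)
Lemma integral_normal_prob (U : set R) (f : R -> \bar R) : measurable U ->
  (@normal_prob R 0 1).-integrable U f ->
  (\int[normal_prob 0 1]_(x in U) f x = \int[mu]_(x in U) (f x * (phi x)%:E))%E.
Proof.
move=> mU fi.
rewrite -(Radon_Nikodym_change_of_variables (@normal_prob_dominates R 0 1))//.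
have mf := measurable_int _ fi.
apply: ae_eq_integral => //.
- apply: emeasurable_funM => //; apply: (measurable_int mu).
  apply: (integrableS _ _ (@subsetT _ _)) => //=.
  by apply: Radon_Nikodym_integrable; exact: normal_prob_dominates.
- apply: emeasurable_funM => //=; apply/measurableT_comp => //=.
  by apply/measurable_funTS; exact: measurable_normal_pdf.
- apply: ae_eqe_mul2l => /=.
  rewrite Radon_NikodymE//=; first exact: normal_prob_dominates.
  move=> dom; case: cid => /= h [h1 h2 h3].
  apply: integral_ae_eq => //=.
  + exact: integrableS h2.
  + by apply/measurable_funTS/measurableT_comp => //; exact: measurable_normal_pdf.
  + by move=> E EU mE; rewrite -h3.
Qed.

(** The conditional probability of [|N2 rho| <= k] given that the first coordinate is [x]. *)
Definition gauss_slice k rho x : R :=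
  gauss_cdf ((k - rho * x) / sigma rho) - gauss_cdf ((- k - rho * x) / sigma rho).

Lemma sigma_gt0 rho : -1 < rho < 1 -> 0 < sigma rho.
Proof.
move=> /andP[r0 r1]; rewrite sqrtr_gt0.
by rewrite (_ : 1 - rho ^+ 2 = (1 - rho) * (1 + rho)); [apply: mulr_gt0; lra|ring].
Qed.

Definition square_event k rho : set (measurableTypeR R * measurableTypeR R) :=
  [set w | `|N1 w| <= k /\ `|N2 rho w| <= k].

Lemma measurable_square_event k rho : measurable (square_event k rho).
Proof.
rewrite (_ : square_event k rho =
    (@N1 R @^-1` `[- k, k]) `&` (N2 rho @^-1` `[- k, k])).
  apply: measurableI.
  - by rewrite -[X in measurable X]setTI; apply: measurable_N1.
  - by rewrite -[X in measurable X]setTI; apply: measurable_N2.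
by apply/seteqP; split=> w /=; rewrite /square_event /= !in_itv /= !ler_norml.
Qed.

Lemma normal_prob_xsection k rho x : 0 <= k -> -1 < rho < 1 ->
  normal_prob 0 1 (xsection (square_event k rho) x) =
  (if `|x| <= k then gauss_slice k rho x else 0)%:E.
Proof.
move=> k0 r1; have s0 := sigma_gt0 r1.
case: ifPn => xk.
  rewrite (_ : xsection _ _ =
      `[(- k - rho * x) / sigma rho, (k - rho * x) / sigma rho]%classic).
    by rewrite normal_prob_itv// ler_pM2r ?invr_gt0//; lra.
  apply/seteqP; split=> z; rewrite /xsection/= inE /= in_itv /=.
    rewrite /square_event /= /N1 /N2 /= ler_pdivrMr// ler_pdivlMr// => -[_].
    by rewrite ler_norml => /andP[? ?]; apply/andP; split; lra.
  rewrite /square_event /= /N1 /N2 /= ler_pdivrMr// ler_pdivlMr// => /andP[? ?].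
  by split; rewrite // ler_norml; apply/andP; split; lra.
rewrite (_ : xsection _ _ = set0); first by rewrite measure0.
apply/seteqP; split=> // z; rewrite /xsection/= inE /square_event /= /N1 /= => -[+ _].
by rewrite (negbTE xk).
Qed.

Lemma has_derive_slice_x k rho x : has_derive (gauss_slice k rho) x
  (- rho / sigma rho * (phi ((k - rho * x) / sigma rho)
                        - phi ((- k - rho * x) / sigma rho))).
Proof.
have d c : has_derive (fun t => (c - rho * t) / sigma rho) x (- rho / sigma rho).
  by derive_fun; ring.
apply: has_derive_congr.
  apply: has_derive_B.
    exact: (@is_derive1_comp _ (@gauss_cdf R) _ x _ _ (has_derive_cdf _) (d k)).
  exact: (@is_derive1_comp _ (@gauss_cdf R) _ x _ _ (has_derive_cdf _) (d (- k))).
by rewrite /=; ring.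
Qed.

Lemma has_derive_phi x : has_derive phi x (- x * phi x).
Proof.
rewrite (_ : phi = fun t => normal_peak 1 * expR (- t ^+ 2 / 2)).
  by derive_fun; field.
by apply/funext => t; rewrite phiE.
Qed.

Lemma continuous_slice_phi k rho :
  continuous (fun x => gauss_slice k rho x * phi x : R).
Proof.
move=> x; apply: has_derive_continuous; apply: has_derive_M.
  exact: has_derive_slice_x.
exact: has_derive_phi.
Qed.

Lemma integrable_slice_phi k rho :
  mu.-integrable `[- k, k] (EFin \o (fun x => gauss_slice k rho x * phi x)).
Proof.
apply: continuous_compact_integrable; first exact: segment_compact.
apply: continuous_subspaceT; exact: continuous_slice_phi.
Qed.

(** The product measure is by definition the integral of the measures of the sections, so only the
    sections and the density have to be inserted. *)
Lemma std_gaussian2_square k rho : 0 <= k -> -1 < rho < 1 ->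
  fine (@std_gaussian2 R (square_event k rho)) =
  \int[mu]_(x in `[- k, k]) (gauss_slice k rho x * phi x).
Proof.
move=> k0 r1; rewrite /Rintegral; congr fine.
rewrite /std_gaussian2 /= /product_measure1 /=.
have mA := measurable_square_event k rho.
rewrite integral_normal_prob//; last first.
  apply: (@le_integrable _ _ _ _ _ measurableT _ (cst 1%E)) => //.
  - exact: measurable_fun_xsection.
  - move=> x _; rewrite /= gee0_abs// normr1 -[1%:E]/1%E.
    by apply: probability_le1; exact: measurable_xsection.
  - exact: finite_measure_integrable_cst.
rewrite [RHS]integral_mkcond; apply: eq_integral => x _.
rewrite /= normal_prob_xsection// patchE mem_setE in_itv/= -ler_norml.
by case: ifPn => _; rewrite ?mul0e// EFinM.
Qed.

Lemma itv_norm k : [set z : R | `|z| <= k] = `[- k, k]%classic.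
Proof. by apply/seteqP; split=> z /=; rewrite in_itv/= ler_norml. Qed.

Lemma std_gaussian2_square_le k rho :
  fine (@std_gaussian2 R (square_event k rho)) <= Pkappa k.
Proof.
rewrite /Pkappa; set A := [set z | _].
have mA : measurable (A : set (measurableTypeR R)) by rewrite /A itv_norm.
apply: fine_le.
- by apply: fin_num_measure; exact: measurable_square_event.
- exact: fin_num_measure.
have E : @std_gaussian2 R (A `*` setT) = (normal_prob 0 1 A * normal_prob 0 1 setT)%E.
  exact: (product_measure1E _ _ mA measurableT).
rewrite probability_setT mule1 in E; rewrite -E.
apply: le_measure; rewrite ?inE.
- exact: measurable_square_event.
- exact: measurableX.
- by move=> w [].
Qed.

Lemma square_event0 k : 0 <= k ->
  fine (@std_gaussian2 R (square_event k 0)) = Pkappa k ^+ 2.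
Proof.
move=> k0; rewrite std_gaussian2_square//; last by lra.
have -> : (fun x => gauss_slice k 0 x * phi x) = (fun x => Pkappa k * phi x).
  apply/funext => x; rewrite /gauss_slice PkappaE//.
  by rewrite expr0n subr0 sqrtr1 !divr1 mul0r !subr0.
rewrite RintegralZl//; last exact: integrable_phi.
rewrite expr2; congr (_ * _).
by rewrite /Pkappa itv_norm.
Qed.

(** The left side has derivative 0. The value 1/2 of [gauss_cdf 0] is not computed, because this
    constant cancels in [gauss_sliceN]. *)
Lemma gauss_cdfN x : gauss_cdf x + gauss_cdf (- x) = gauss_cdf 0 *+ 2.
Proof.
have dc t : has_derive (fun t => gauss_cdf t + gauss_cdf (- t) : R) t 0.
  apply: has_derive_congr.
    apply: has_derive_D; first exact: has_derive_cdf.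
    have dN : has_derive (fun t : R => - t) t (- 1).
      by apply: has_derive_N; exact: has_derive_id.
    exact: (@is_derive1_comp _ (@gauss_cdf R) _ t _ _ (has_derive_cdf _) dN).
  by rewrite phiN; ring.
have /= -> := @is_derive_0_is_cst R _ x 0 dc.
by rewrite oppr0 mulr2n.
Qed.

Lemma gauss_sliceN k rho x : gauss_slice k (- rho) x = gauss_slice k rho x.
Proof.
rewrite /gauss_slice sqrrN; set s := sigma rho.
have e c : gauss_cdf ((c - - rho * x) / s) =
    gauss_cdf 0 *+ 2 - gauss_cdf ((- c - rho * x) / s).
  rewrite -(gauss_cdfN ((c - - rho * x) / s)).
  by rewrite (_ : - ((c - - rho * x) / s) = (- c - rho * x) / s) ?addrK//; ring.
by rewrite !e opprK; ring.
Qed.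

Lemma std_gaussian2_squareN k rho : 0 <= k -> -1 <= rho <= 1 ->
  fine (@std_gaussian2 R (square_event k (- rho))) =
  fine (@std_gaussian2 R (square_event k rho)).
Proof.
move=> k0 r1; have [r|r] := boolP (-1 < rho < 1).
  have rN : -1 < - rho < 1 by lra.
  apply: (etrans (std_gaussian2_square k0 rN)).
  apply: (etrans _ (esym (std_gaussian2_square k0 r))).
  by apply: eq_Rintegral => x _; rewrite gauss_sliceN.
(* Here [rho] is 1 or -1, where the slice formula would divide by 0. The second coordinate drops out
   of [N2], and the two events coincide. *)
congr (fine (@std_gaussian2 R _)).
have s0 : 1 - rho ^+ 2 = 0.
  suff /orP[/eqP->|/eqP->] : (rho == 1) || (rho == -1) by ring.
  move: r1 r => /andP[a b]; rewrite !lt_neqAle a b !andbT negb_and !negbK.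
  by rewrite orbC eq_sym [_ == -1]eq_sym eq_sym.
apply/seteqP; split=> w; rewrite /square_event /= /N2 sqrrN s0 sqrtr0 !mul0r !addr0.
  by rewrite !normrM normrN.
by rewrite !normrM normrN.
Qed.

End bivariate.

(** * Plackett's identity *)

Section bivariate_derivative.
Variable R : realType.
Implicit Types (x a b k rho r : R).
Local Notation mu := (@lebesgue_measure R).
Local Notation phi := (@normal_pdf R 0 1).
Local Notation sigma rho := (Num.sqrt (1 - rho ^+ 2)).

Lemma has_derive_sqrt (f : R -> R) x a : has_derive f x a -> 0 < f x ->
  has_derive (fun t => Num.sqrt (f t)) x (a / (2 * Num.sqrt (f x))).
Proof.
move=> fa f0; rewrite mulrC.
exact: (@is_derive1_comp _ (@Num.sqrt R) f x _ _ (is_derive1_sqrt f0) fa).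
Qed.

Lemma sigma_sqr rho : -1 < rho < 1 -> sigma rho ^+ 2 = 1 - rho ^+ 2.
Proof. by move=> /sigma_gt0; rewrite sqrtr_gt0 => /ltW /sqr_sqrtr. Qed.

(* [slice_drho] is the derivative in [rho] of the integrand; completing the square
   turns the product of densities into a Gaussian in [x], which makes
   [slice_drho] the derivative in [x] of [slice_prim]. *)
Definition slice_drho k rho x : R :=
  normal_peak 1 ^+ 2 * expR (- k ^+ 2 / 2) / sigma rho ^+ 3 *
  (expR (- (x - rho * k) ^+ 2 / (2 * sigma rho ^+ 2)) * (rho * k - x) +
   expR (- (x + rho * k) ^+ 2 / (2 * sigma rho ^+ 2)) * (x + rho * k)).

Definition slice_prim k rho x : R :=
  normal_peak 1 ^+ 2 * expR (- k ^+ 2 / 2) / sigma rho *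
  (expR (- (x - rho * k) ^+ 2 / (2 * sigma rho ^+ 2)) -
   expR (- (x + rho * k) ^+ 2 / (2 * sigma rho ^+ 2))).

Lemma has_derive_slice_prim k rho x : -1 < rho < 1 ->
  has_derive (slice_prim k rho) x (slice_drho k rho x).
Proof.
move=> /sigma_gt0 s0; rewrite /slice_prim /slice_drho; derive_fun.
by field; rewrite gt_eqF.
Qed.

Lemma phi_slice k rho x : -1 < rho < 1 ->
  phi ((k - rho * x) / sigma rho) * phi x =
  normal_peak 1 ^+ 2 * expR (- k ^+ 2 / 2) *
  expR (- (x - rho * k) ^+ 2 / (2 * sigma rho ^+ 2)).
Proof.
move=> r1; have s0 := sigma_gt0 r1; rewrite !phiE.
rewrite mulrACA -expr2 -mulrA -!expRD; congr (_ * expR _).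
have e : 1 = sigma rho ^+ 2 + rho ^+ 2 by rewrite sigma_sqr//; ring.
rewrite expr_div_n; have sn : sigma rho != 0 by rewrite gt_eqF.
apply: (mulIf (x := 2 * sigma rho ^+ 2)).
  by rewrite mulf_neq0// sqrf_eq0.
have -> : (- ((k - rho * x) ^+ 2 / sigma rho ^+ 2) / 2 + - x ^+ 2 / 2) *
    (2 * sigma rho ^+ 2) = - (k - rho * x) ^+ 2 - x ^+ 2 * sigma rho ^+ 2.
  by field.
have -> : (- k ^+ 2 / 2 + - (x - rho * k) ^+ 2 / (2 * sigma rho ^+ 2)) *
    (2 * sigma rho ^+ 2) = - k ^+ 2 * sigma rho ^+ 2 - (x - rho * k) ^+ 2.
  by field.
by rewrite sigma_sqr//; ring.
Qed.

Lemma has_derive_slice_rho k rho x : -1 < rho < 1 ->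
  has_derive (fun r => gauss_slice k r x * phi x) rho (slice_drho k rho x).
Proof.
move=> r1; have s0 := sigma_gt0 r1.
have sn : sigma rho != 0 by rewrite gt_eqF.
have dsig : has_derive (fun r => sigma r) rho (- rho / sigma rho).
  apply: has_derive_congr.
    by apply: has_derive_sqrt; [repeat derive_rule|rewrite -sqrtr_gt0].
  by rewrite /=; field.
have d c : has_derive (fun t => (c - t * x) / sigma t) rho
    ((rho * c - x) / sigma rho ^+ 3).
  apply: has_derive_congr.
    apply: has_derive_M; last by apply: has_derive_V => //; exact: dsig.
    by repeat derive_rule.
  rewrite /=.
  transitivity ((rho * c - x * (sigma rho ^+ 2 + rho ^+ 2)) / sigma rho ^+ 3).
    by field.
  by rewrite sigma_sqr//; congr (_ / _); ring.
apply: has_derive_congr.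
  apply: has_derive_M; last exact: has_derive_cst.
  apply: has_derive_B.
    exact: (@is_derive1_comp _ (@gauss_cdf R) _ rho _ _ (has_derive_cdf _) (d k)).
  exact: (@is_derive1_comp _ (@gauss_cdf R) _ rho _ _ (has_derive_cdf _) (d (- k))).
rewrite /= mulr0 addr0.
transitivity (phi ((k - rho * x) / sigma rho) * phi x *
    ((rho * k - x) / sigma rho ^+ 3) -
  phi ((- k - rho * x) / sigma rho) * phi x * ((rho * - k - x) / sigma rho ^+ 3)).
  by ring.
rewrite !phi_slice// sqrrN mulrN opprK /slice_drho.
by field.
Qed.

(** A bound uniform in [rho], needed as the dominating function for differentiation under the
    integral. As [sigma rho <= 1], its cube is bounded below by its fourth power, which is free of
    square roots. *)
Lemma abs_slice_drho_le k rho r x : 0 <= k -> 0 < r < 1 -> - r < rho < r ->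
  - k <= x <= k ->
  `|slice_drho k rho x| <= normal_peak 1 ^+ 2 * (4 * k) / (1 - r ^+ 2) ^+ 2.
Proof.
move=> k0 /andP[r0 r1'] /andP[rl ru] /andP[xl xu].
have r1 : -1 < rho < 1 by apply/andP; split; lra.
have s0 := sigma_gt0 r1.
have c0 := sqr_ge0 (@normal_peak R 1).
have e1 (u : R) : expR (- u ^+ 2 / (2 * sigma rho ^+ 2)) <= 1.
  rewrite -expR0 ler_expR mulNr oppr_le0.
  by apply: divr_ge0; [exact: sqr_ge0|apply: mulr_ge0; rewrite ?sqr_ge0].
have rr2 : rho ^+ 2 <= r ^+ 2 by rewrite -subr_ge0 subr_sqr; apply: mulr_ge0; lra.
have r2 : 0 < 1 - r ^+ 2 by rewrite (_ : 1 - _ = (1 - r) * (1 + r)); [apply: mulr_gt0; lra|ring].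
have s3 : (1 - r ^+ 2) ^+ 2 <= sigma rho ^+ 3.
  have s1 : sigma rho <= 1.
    by rewrite -[leRHS]sqrtr1 ler_wsqrtr// gerBl sqr_ge0.
  apply: (@le_trans _ _ ((sigma rho ^+ 2) ^+ 2)).
    apply: lerXn2r; rewrite ?nnegrE ?sqr_ge0 ?(ltW r2)// sigma_sqr//.
    by rewrite lerD2l lerN2.
  by rewrite -exprM exprS ler_piMl// exprn_ge0// ltW.
rewrite normrM [leRHS]mulrAC ler_pM//.
  rewrite ger0_norm.
    apply: ler_pM.
    - by apply: mulr_ge0; [exact: c0|exact: expR_ge0].
    - by rewrite invr_ge0 exprn_ge0// ltW.
    - rewrite ler_piMr// -expR0 ler_expR mulNr oppr_le0.
      by apply: divr_ge0; [exact: sqr_ge0|].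
    - by rewrite lef_pV2 ?posrE ?exprn_gt0.
  apply: divr_ge0; last by rewrite exprn_ge0// ltW.
  by apply: mulr_ge0; [exact: c0|exact: expR_ge0].
have rk : - k <= rho * k <= k.
  rewrite -ler_norml normrM (ger0_norm k0) ler_piMl// ler_norml.
  by apply/andP; split; lra.
case/andP: rk => rk1 rk2.
apply: (le_trans (ler_normD _ _)).
rewrite !normrM !(ger0_norm (expR_ge0 _)).
have n1 : `|rho * k - x| <= 2 * k by rewrite ler_norml; apply/andP; split; lra.
have n2 : `|x + rho * k| <= 2 * k by rewrite ler_norml; apply/andP; split; lra.
have := ler_pM (expR_ge0 _) (normr_ge0 _) (e1 (x - rho * k)) n1.
have := ler_pM (expR_ge0 _) (normr_ge0 _) (e1 (x + rho * k)) n2.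
lra.
Qed.

Lemma slice_prim_diff k rho : -1 < rho < 1 ->
  slice_prim k rho k - slice_prim k rho (- k) =
  (expR (- k ^+ 2 / (1 + rho)) - expR (- k ^+ 2 / (1 - rho))) /
  (pi * sigma rho).
Proof.
move=> r1; have s0 := sigma_gt0 r1.
have r1p : 1 + rho != 0 by rewrite gt_eqF//; lra.
have r1m : 1 - rho != 0 by rewrite gt_eqF//; lra.
have sn : sigma rho != 0 by rewrite gt_eqF.
rewrite /slice_prim peak_sqr sigma_sqr//.
have r2 : 1 - rho ^+ 2 = (1 - rho) * (1 + rho) by ring.
rewrite (_ : (- k - rho * k) ^+ 2 = (k + rho * k) ^+ 2); last by ring.
rewrite (_ : (- k + rho * k) ^+ 2 = (k - rho * k) ^+ 2); last by ring.
rewrite (_ : - k ^+ 2 / (1 + rho) =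
    - k ^+ 2 / 2 + - (k - rho * k) ^+ 2 / (2 * (1 - rho ^+ 2))); last first.
  by rewrite r2; field; rewrite ?r1p ?r1m.
rewrite (_ : - k ^+ 2 / (1 - rho) =
    - k ^+ 2 / 2 + - (k + rho * k) ^+ 2 / (2 * (1 - rho ^+ 2))); last first.
  by rewrite r2; field; rewrite ?r1p ?r1m.
rewrite !expRD; have := pi_gt0 R; move: (pi : R) => p p0.
by field; rewrite sn gt_eqF.
Qed.

(** Differentiation under the integral, followed by the fundamental theorem of calculus: the
    derivative in [rho] of the integrand is the derivative in [x] of [slice_prim]. *)
Lemma has_derive_square k rho : 0 < k -> -1 < rho < 1 ->
  has_derive (fun r => fine (@std_gaussian2 R (square_event k r))) rho
    ((expR (- k ^+ 2 / (1 + rho)) - expR (- k ^+ 2 / (1 - rho))) /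
     (pi * sigma rho)).
Proof.
move=> k0 r1; have s0 := sigma_gt0 r1.
(* The midpoint between [|rho|] and 1: []- r, r[] is a neighbourhood of [rho] on which [sigma] stays
   away from 0. *)
pose r := (1 + `|rho|) / 2.
have nr : `|rho| < 1 by rewrite ltr_norml.
have nr0 := normr_ge0 rho.
have r01 : 0 < r < 1 by rewrite /r; apply/andP; split; lra.
have rhor : - r < rho < r by rewrite -ltr_norml /r; lra.
have sub z : - r < z < r -> -1 < z < 1.
  by case/andP: r01 => ? ? /andP[? ?]; apply/andP; split; lra.
pose G := normal_peak 1 ^+ 2 * (4 * k) / (1 - r ^+ 2) ^+ 2.
have inI (z : R) : `]- r, r[%classic z -> - r < z < r by rewrite /= in_itv.
have inB (z : R) : `[- k, k]%classic z -> - k <= z <= k by rewrite /= in_itv.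
have Irho : `]- r, r[%classic rho by rewrite /= in_itv.
have mB : measurable (`[- k, k]%classic : set (measurableTypeR R)) by [].
pose f z x := gauss_slice k z x * phi x.
have d1 z x : `]- r, r[%classic z -> partial1of2 f z x = slice_drho k z x.
  by move=> /inI/sub zr; rewrite partial1of2E; case: (has_derive_slice_rho k x zr).
have df z x : `]- r, r[%classic z -> `[- k, k]%classic x -> derivable (f^~ x) z 1.
  by move=> /inI/sub zr _; case: (has_derive_slice_rho k x zr).
have intf z : `]- r, r[%classic z -> mu.-integrable `[- k, k] (EFin \o f z).
  by move=> _; exact: integrable_slice_phi.
have G0 (x : R) : 0 <= G.
  rewrite /G; apply: divr_ge0; last exact: sqr_ge0.
  by apply: mulr_ge0; [exact: sqr_ge0|rewrite mulr_ge0// ltW].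
have intG : mu.-integrable `[- k, k] (EFin \o (fun _ : R => G)).
  apply: continuous_compact_integrable; first exact: segment_compact.
  by apply: continuous_subspaceT; exact: cst_continuous.
have Gub z x : `]- r, r[%classic z -> `[- k, k]%classic x -> `|partial1of2 f z x| <= G.
  move=> zr xk; rewrite d1//; exact: (abs_slice_drho_le (ltW k0) r01 (inI _ zr) (inB _ xk)).
have D := derivable_under_integral mB Irho intf df G0 intG Gub.
have E := differentiation_under_integral mB Irho intf df G0 intG Gub.
apply: (@near_eq_is_derive _ _ _ (fun z => \int[mu]_(x in `[- k, k]) f z x)).
  near=> z; rewrite std_gaussian2_square//; first exact: ltW.
  apply: sub; near: z.
  by apply: near_in_itvoo; rewrite in_itv.
apply: (DeriveDef D); rewrite -derive1E E.
under eq_Rintegral do rewrite d1//.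
have kk : - k < k by rewrite gtrN.
rewrite /Rintegral (@continuous_FTC2 _ _ (slice_prim k rho) _ _ kk).
- exact: slice_prim_diff.
- apply: continuous_subspaceT => x; apply: has_derive_continuous.
  by rewrite /slice_drho; repeat derive_rule.
- have c x := has_derive_continuous (has_derive_slice_prim k x r1).
  split.
  + by move=> x _; case: (has_derive_slice_prim k x r1).
  + exact/cvg_at_right_filter/c.
  + exact/cvg_at_left_filter/c.
- move=> x _; rewrite derive1E.
  by case: (has_derive_slice_prim k x r1).
Unshelve. all: by end_near. Qed.

End bivariate_derivative.

(** * Comparison with an exponential bound *)

Section entropy.
Variable R : realType.
Implicit Types (rho x : R).

Definition artanh rho : R := (ln (1 + rho) - ln (1 - rho)) / 2.

(** The function J of the overview: the relative entropy of the law ((1 + rho) / 2, (1 - rho) / 2)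
    with respect to the uniform law on two points. *)
Definition ent rho : R :=
  ((1 + rho) * ln (1 + rho) + (1 - rho) * ln (1 - rho)) / 2.

Lemma has_derive_artanh rho : -1 < rho < 1 ->
  has_derive artanh rho (1 - rho ^+ 2)^-1.
Proof.
move=> /andP[r0 r1]; rewrite /artanh; apply: has_derive_congr.
  by repeat derive_rule; lra.
have p : 1 + rho != 0 by rewrite gt_eqF//; lra.
have m : 1 - rho != 0 by rewrite gt_eqF//; lra.
rewrite (_ : 1 - rho ^+ 2 = (1 + rho) * (1 - rho)); last by ring.
by rewrite /=; field; rewrite p m.
Qed.

Lemma has_derive_ent rho : -1 < rho < 1 -> has_derive ent rho (artanh rho).
Proof.
move=> /andP[r0 r1]; rewrite /ent /artanh; apply: has_derive_congr.
  by repeat derive_rule; lra.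
have p : 1 + rho != 0 by rewrite gt_eqF//; lra.
have m : 1 - rho != 0 by rewrite gt_eqF//; lra.
by rewrite /=; field; rewrite p m.
Qed.

Lemma artanh0 : artanh 0 = 0.
Proof. by rewrite /artanh addr0 subr0 ln1 subrr mul0r. Qed.

Lemma ent0 : ent 0 = 0.
Proof. by rewrite /ent addr0 subr0 ln1 !mulr0 addr0 mul0r. Qed.

Lemma entN rho : ent (- rho) = ent rho.
Proof. by rewrite /ent opprK addrC. Qed.

Lemma ent1 : ent 1 = ln 2.
Proof. by rewrite /ent subrr mul0r addr0 -[1 + 1]/2 mulrAC mulfV ?mul1r. Qed.

Lemma artanh_ge rho : 0 <= rho < 1 -> rho <= artanh rho.
Proof.
move=> /andP[r0 r1]; rewrite -subr_ge0 -[leLHS](subrr 0) -{1}artanh0.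
apply: (@derive_ge0_le _ (fun t => artanh t - t) (fun t => (1 - t ^+ 2)^-1 - 1)) => //.
  move=> t /andP[t0 tr]; apply: has_derive_B; last exact: has_derive_id.
  by apply: has_derive_artanh; lra.
move=> t /andP[t0 tr]; rewrite subr_ge0 invf_ge1.
  by rewrite gerBl sqr_ge0.
by rewrite subr_gt0 -[ltRHS](expr1n _ 2) ltrXn2r ?nnegrE//; lra.
Qed.

Lemma ent_gt0 rho : 0 < rho < 1 -> 0 < ent rho.
Proof.
move=> /andP[r0 r1]; rewrite -ent0; apply: (derive_gt0_lt r0).
  by move=> x /andP[x0 xr]; apply: has_derive_ent; lra.
move=> x /andP[x0 xr]; apply: (lt_le_trans x0); apply: artanh_ge; lra.
Qed.

(** A quantitative form of the limit ln 2 at 1. The singular logarithm is estimated through ln (1 -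
    rho) = 2 ln (sqrt (1 - rho)) and ln u >= 1 - 1/u; what remains is (1 - rho) (1 - ln 2) / 2,
    which is nonnegative. *)
Lemma ent_ge rho : 0 <= rho < 1 -> ln 2 - Num.sqrt (1 - rho) <= ent rho.
Proof.
move=> /andP[r0 r1]; have w0 : 0 < 1 - rho by lra.
have s0 : 0 < Num.sqrt (1 - rho) by rewrite sqrtr_gt0.
have ss : Num.sqrt (1 - rho) ^+ 2 = 1 - rho by rewrite sqr_sqrtr// ltW.
have l1 : 1 - (Num.sqrt (1 - rho))^-1 <= ln (1 - rho) / 2.
  have -> : ln (1 - rho) / 2 = ln (Num.sqrt (1 - rho)).
    by rewrite -[in LHS]ss lnXn//; field.
  have : ln (Num.sqrt (1 - rho))^-1 <= (Num.sqrt (1 - rho))^-1 - 1.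
    rewrite -[X in ln X](subrKC 1) le_ln1Dx// ltrBrDl subrr invr_gt0//.
  by rewrite lnV ?posrE//; lra.
have l2 : ln 2 - (1 - rho) / (1 + rho) <= ln (1 + rho).
  have : ln (2 / (1 + rho)) <= (1 - rho) / (1 + rho).
    rewrite (_ : 2 / (1 + rho) = 1 + (1 - rho) / (1 + rho)); last first.
      by field; lra.
    by rewrite le_ln1Dx// (@lt_le_trans _ _ 0)// divr_ge0; lra.
  by rewrite ln_div ?posrE; lra.
have ln21 : ln 2 <= 1 :> R.
  by have := @le_ln1Dx R 1; rewrite -[1 + 1]/2 => -> //; lra.
have m1 : (1 - rho) * (1 - (Num.sqrt (1 - rho))^-1) <=
    (1 - rho) * (ln (1 - rho) / 2) by rewrite ler_pM2l.
have m2 : (1 + rho) / 2 * (ln 2 - (1 - rho) / (1 + rho)) <=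
    (1 + rho) / 2 * ln (1 + rho) by rewrite ler_pM2l//; lra.
have e1 : (1 - rho) * (1 - (Num.sqrt (1 - rho))^-1) = 1 - rho - Num.sqrt (1 - rho).
  rewrite mulrBr mulr1; congr (_ - _).
  by rewrite -{1}ss expr2 mulfK// gt_eqF.
have e2 : (1 + rho) / 2 * (ln 2 - (1 - rho) / (1 + rho)) =
    (1 + rho) / 2 * ln 2 - (1 - rho) / 2 by field; lra.
have : 0 <= (1 - rho) * (1 - ln 2) by rewrite mulr_ge0; lra.
rewrite /ent; lra.
Qed.

Lemma entropyE x : 0 <= x <= 1 ->
  - x * ln x - (1 - x) * ln (1 - x) = ln 2 - ent (2 * x - 1).
Proof.
move=> /andP[x0 x1].
have h z : 0 <= z -> z * ln (2 * z) = z * ln 2 + z * ln z.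
  rewrite le_eqVlt => /predU1P[<-|z0]; first by rewrite !mul0r addr0.
  by rewrite lnM ?posrE// mulrDr.
rewrite /ent (_ : 1 + (2 * x - 1) = 2 * x); last by ring.
rewrite (_ : 1 - (2 * x - 1) = 2 * (1 - x)); last by ring.
rewrite -!(mulrA 2) !h//; last by lra.
by field.
Qed.

End entropy.

(* While [h >= 0] the difference [f - g] increases, afterwards it decreases to its
   nonnegative limit. *)
Lemma single_crossing (R : realType) (f g f' g' h : R -> R) (a c : R) :
  (forall x, a <= x < 1 -> has_derive f x (f' x)) ->
  (forall x, a <= x < 1 -> has_derive g x (g' x)) ->
  (forall x, a < x < 1 -> (0 <= h x) = (g' x <= f' x)) ->
  (forall x z, a < x -> x <= z -> z < 1 -> h z <= h x) ->
  g a <= f a ->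
  (forall x, g x <= c) ->
  (forall b e, b < 1 -> 0 < e -> exists2 x, b <= x < 1 & c - e <= f x) ->
  forall x, a < x < 1 -> g x <= f x.
Proof.
move=> df dg hE hdec ga gc fc x /andP[ax x1].
have dD t : a <= t < 1 -> has_derive (fun t => f t - g t) t (f' t - g' t).
  by move=> t1; apply: has_derive_B; [exact: df|exact: dg].
rewrite -subr_ge0; have [kp|kn] := leP 0 (h x).
  apply: (@le_trans _ _ (f a - g a)); first by rewrite subr_ge0.
  apply: (@derive_ge0_le _ (fun t => f t - g t) (fun x => f' x - g' x) _ _ (ltW ax)).
    by move=> t /andP[? ?]; apply: dD; lra.
  move=> t /andP[? ?]; rewrite subr_ge0 -hE; last by lra.
  by apply: (le_trans kp); apply: hdec; lra.
rewrite leNgt; apply/negP => D0.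
(* To the right of [x] the gap [g - f] can only grow, but at [b] it is at most half of its value at
   [x], because [g b <= c]. *)
have [b /andP[xb b1] fb] := fc x ((g x - f x) / 2) x1 ltac:(lra).
have : - (f x - g x) <= - (f b - g b).
  apply: (@derive_ge0_le _ (fun t => - (f t - g t)) (fun x => - (f' x - g' x)) _ _ xb).
    by move=> t /andP[? ?]; apply: has_derive_N; apply: dD; lra.
  move=> t /andP[? ?]; rewrite oppr_ge0 subr_le0; apply: ltW.
  rewrite ltNge -hE; last by lra.
  by rewrite -ltNge; apply: (le_lt_trans _ kn); apply: hdec; lra.
by have := gc b; lra.
Qed.

(** * The derivative ratio and the comparison on both sides of r *)

Section comparison.
Variable R : realType.
Variable k : R.
Hypothesis k_gt0 : 0 < k.
Implicit Types (rho x : R).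

Local Notation y := (k ^+ 2).
Local Notation P := (Pkappa k).
Local Notation sigma rho := (Num.sqrt (1 - rho ^+ 2)).

Definition qcorr rho : R := fine (@std_gaussian2 R (square_event k rho)).

(** The reciprocal of [alpha_c]. With this value [rbound] takes the value P at 1. *)
Definition lam : R := - (ln P / ln 2).

Definition rbound rho : R := P ^+ 2 * expR (lam * ent rho).

Definition ediff rho : R := expR (- y / (1 + rho)) - expR (- y / (1 - rho)).

(* [lam * artanh * (1 - rho^2) - 1/artanh + rho - drift] is [1 - rho^2] times the
   logarithmic derivative of [rbound' / qcorr']. *)
Definition drift rho : R :=
  y * (expR (- y / (1 + rho)) * ((1 - rho) / (1 + rho)) +
       expR (- y / (1 - rho)) * ((1 + rho) / (1 - rho))) / ediff rho.

Lemma P_gt0 : 0 < P.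
Proof.
rewrite PkappaE ?ltW// subr_gt0; apply: (derive_gt0_lt (f' := @normal_pdf R 0 1)).
- by rewrite gtrN.
- by move=> x _; exact: has_derive_cdf.
- by move=> x _; exact: phi_gt0.
Qed.

Lemma P_lt1 : P < 1.
Proof.
have k1 : 0 <= k + 1 by rewrite addr_ge0// ltW.
have : P < Pkappa (k + 1).
  rewrite !PkappaE// ?ltW//.
  apply: (@derive_gt0_lt _ (fun t => gauss_cdf t - gauss_cdf (- t))
    (fun t => 2 * normal_pdf 0 1 t)).
  - by rewrite ltrDl.
  - by move=> x _; exact: has_derive_P.
  - by move=> x _; rewrite mulr_gt0// phi_gt0.
move=> /lt_le_trans; apply; rewrite /Pkappa -[leRHS]/(fine 1%:E) fine_le//.
- by apply: fin_num_measure; rewrite itv_norm.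
- by apply: probability_le1; rewrite itv_norm.
Qed.

Lemma ln2_gt0 : 0 < ln 2 :> R. Proof. by rewrite ln_gt0// ltr1n. Qed.

Lemma lam_gt0 : 0 < lam.
Proof.
rewrite /lam -mulNr divr_gt0 ?ln2_gt0// oppr_gt0 ln_lt0// P_gt0.
exact: P_lt1.
Qed.

Lemma P_expR : P = expR (- (lam * ln 2)).
Proof.
by rewrite /lam mulNr opprK divfK ?gt_eqF ?ln2_gt0// lnK// posrE P_gt0.
Qed.

Lemma ediff_gt0 rho : 0 < rho < 1 -> 0 < ediff rho.
Proof.
move=> /andP[r0 r1]; rewrite subr_gt0 ltr_expR !mulNr ltrN2.
by rewrite ltr_pM2l ?exprn_gt0// ltf_pV2 ?posrE; lra.
Qed.

Lemma has_derive_ediff rho : 0 <= rho < 1 -> has_derive ediff rho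
  (y * (expR (- y / (1 + rho)) / (1 + rho) ^+ 2 +
        expR (- y / (1 - rho)) / (1 - rho) ^+ 2)).
Proof.
move=> /andP[r0 r1]; have p : 1 + rho != 0 by rewrite gt_eqF//; lra.
have m : 1 - rho != 0 by rewrite gt_eqF//; lra.
rewrite /ediff; apply: has_derive_congr.
  by repeat derive_rule.
by rewrite /=; field; rewrite p m.
Qed.

Lemma has_derive_qcorr rho : 0 <= rho < 1 ->
  has_derive qcorr rho (ediff rho / (pi * sigma rho)).
Proof. by move=> r01; apply: has_derive_square => //; lra. Qed.

Lemma has_derive_rbound rho : 0 <= rho < 1 ->
  has_derive rbound rho (rbound rho * (lam * artanh rho)).
Proof.
move=> r01; rewrite /rbound; apply: has_derive_congr.
  by repeat derive_rule; apply: has_derive_ent; lra.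
by rewrite /=; ring.
Qed.

Lemma rbound_gt0 rho : 0 < rbound rho.
Proof. by rewrite mulr_gt0 ?expR_gt0// exprn_gt0// P_gt0. Qed.

Lemma artanh_gt0 rho : 0 < rho < 1 -> 0 < artanh rho.
Proof. by move=> r; apply: (@lt_le_trans _ _ rho); [lra|apply: artanh_ge; lra]. Qed.

(** The logarithm of the ratio of the derivatives of [rbound] and [qcorr], written as a sum so that
    its derivative is a sum of explicit terms. *)
Definition lnratio rho : R :=
  ln (lam * P ^+ 2 * pi) + lam * ent rho + ln (artanh rho) + ln (sigma rho)
  - ln (ediff rho).

Lemma lnratioE rho : 0 < rho < 1 ->
  (0 <= lnratio rho) =
  (ediff rho / (pi * sigma rho) <= rbound rho * (lam * artanh rho)).
Proof.
move=> r01; have s0 : 0 < sigma rho by apply: sigma_gt0; lra.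
have p0 := pi_gt0 R; have e0 := ediff_gt0 r01; have a0 := artanh_gt0 r01.
have l0 := lam_gt0; have P0 := P_gt0.
rewrite /lnratio /rbound; move: (artanh rho) a0 (ediff rho) e0 => a a0 e e0.
rewrite subr_ge0 -[lam * ent rho]expRK.
have pl : 0 < lam * P ^+ 2 * pi by rewrite !mulr_gt0// exprn_gt0.
rewrite -!lnM ?posrE ?mulr_gt0 ?expR_gt0 ?exprn_gt0//.
rewrite ler_ln ?posrE ?mulr_gt0 ?expR_gt0 ?exprn_gt0//.
by rewrite ler_pdivrMr ?mulr_gt0// expRK; congr (_ <= _); ring.
Qed.

Lemma has_derive_lnratio rho : 0 < rho < 1 ->
  has_derive lnratio rho
    (- (drift rho + rho - (artanh rho)^-1 - lam * artanh rho * (1 - rho ^+ 2)) /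
      (1 - rho ^+ 2)).
Proof.
move=> r01; have s0 : 0 < sigma rho by apply: sigma_gt0; lra.
have e0 := ediff_gt0 r01; have a0 := artanh_gt0 r01.
have [r0 r1] := andP r01.
have t0 : 0 < 1 - rho ^+ 2 by rewrite -sqrtr_gt0.
rewrite /lnratio; apply: has_derive_congr.
  apply: has_derive_B; last first.
    apply: has_derive_ln; last exact: e0.
    by apply: has_derive_ediff; lra.
  apply: has_derive_D; last first.
    apply: has_derive_ln; last exact: s0.
    by apply: has_derive_sqrt; [repeat derive_rule|exact: t0].
  apply: has_derive_D; last first.
    apply: has_derive_ln; last exact: a0.
    by apply: has_derive_artanh; lra.
  by repeat derive_rule; apply: has_derive_ent; lra.
rewrite /= /drift.
have ss : sigma rho * sigma rho = 1 - rho ^+ 2 by rewrite -expr2 sqr_sqrtr// ltW.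
rewrite (_ : _ / (2 * sigma rho) / sigma rho = - rho / (1 - rho ^+ 2)); last first.
  by rewrite -[in RHS]ss; field; rewrite gt_eqF.
move: (ediff rho) e0 (artanh rho) a0 => e e0 a a0.
have p : 1 + rho != 0 by rewrite gt_eqF//; lra.
have m : 1 - rho != 0 by rewrite gt_eqF//; lra.
rewrite (_ : 1 - rho ^+ 2 = (1 + rho) * (1 - rho)); last by ring.
by field; rewrite p m !gt_eqF.
Qed.

Lemma rbound_near1 b e : b < 1 -> 0 < e ->
  exists2 x, b <= x < 1 & P - e <= rbound x.
Proof.
move=> b1 e0; have P0 := P_gt0; have l0 := lam_gt0.
pose b' := Num.max b 0.
have b'1 : b' < 1 by rewrite gt_max b1 ltr01.
have b'0 : 0 <= b' by rewrite le_max lexx orbT.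
have bb' : b <= b' by rewrite le_max lexx.
(* The witness is 1 - w^2, at which the error term of [ent_ge] is exactly w. The first bound on w
   keeps the witness above [b'], the second keeps the loss P * lam * w below [e]. *)
pose w := Num.min (Num.sqrt (1 - b')) (e / (P * lam)).
have r0 : 0 < Num.sqrt (1 - b') by rewrite sqrtr_gt0 subr_gt0.
have w0 : 0 < w by rewrite lt_min r0 divr_gt0// mulr_gt0.
have w1 : w ^+ 2 <= 1 - b'.
  rewrite -[leRHS]sqr_sqrtr; last by rewrite subr_ge0 ltW.
  apply: lerXn2r; rewrite ?nnegrE; [exact: ltW|exact: ltW|].
  by rewrite ge_min lexx.
have w2 : P * lam * w <= e.
  have : w <= e / (P * lam) by rewrite ge_min lexx orbT.
  by rewrite ler_pdivlMr ?mulr_gt0// mulrC.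
have ws : 0 < w ^+ 2 by rewrite exprn_gt0.
exists (1 - w ^+ 2).
  by rewrite gtrBl ws andbT lerBrDl -lerBrDr (le_trans w1)// lerB.
have b01 : 0 <= 1 - w ^+ 2 < 1.
  by rewrite gtrBl ws andbT subr_ge0 (le_trans w1)// gerBl.
have eb := ent_ge b01.
rewrite (_ : 1 - (1 - w ^+ 2) = w ^+ 2) in eb; last by ring.
rewrite sqrtr_sqr gtr0_norm// in eb.
apply: (@le_trans _ _ (P * (1 - lam * w))).
  by rewrite mulrBr mulr1 mulrA lerB.
apply: (@le_trans _ _ (P * expR (- (lam * w)))).
  by rewrite ler_pM2l//; exact: expR_ge1Dx.
rewrite /rbound expr2 -mulrA ler_pM2l// {1}P_expR -expRD ler_expR -subr_ge0.
rewrite (_ : _ - _ = lam * (ent (1 - w ^+ 2) - (ln 2 - w))); last by ring.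
by rewrite mulr_ge0 ?(ltW l0)// subr_ge0.
Qed.

Lemma comparison_right r1 : 0 <= r1 < 1 -> qcorr r1 <= rbound r1 ->
  (forall rho, r1 < rho < 1 -> 0 < drift rho + rho - (artanh rho)^-1
     - lam * artanh rho * (1 - rho ^+ 2)) ->
  forall rho, r1 < rho < 1 -> qcorr rho <= rbound rho.
Proof.
move=> /andP[r10 r11] qr1 T.
have in01 x : r1 <= x < 1 -> 0 <= x < 1.
  by move=> /andP[rx ->]; rewrite (le_trans r10).
have in01' x : r1 < x < 1 -> 0 < x < 1.
  by move=> /andP[rx ->]; rewrite (le_lt_trans r10).
apply: (@single_crossing _ rbound qcorr
  (fun x => rbound x * (lam * artanh x)) (fun x => ediff x / (pi * sigma x))
  lnratio r1 P).
- by move=> x /in01; exact: has_derive_rbound.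
- by move=> x /in01; exact: has_derive_qcorr.
- by move=> x /in01'; exact: lnratioE.
- move=> a b r1a ab b1; rewrite -lerN2.
  apply: (@derive_ge0_le _ (fun t => - lnratio t) (fun t =>
   (drift t + t - (artanh t)^-1 - lam * artanh t * (1 - t ^+ 2)) / (1 - t ^+ 2))
   _ _ ab).
    move=> t /andP[at_ tb]; apply: has_derive_congr.
      apply: has_derive_N; apply: has_derive_lnratio; apply: in01'.
      by rewrite (lt_le_trans r1a)//= (le_lt_trans tb).
    by rewrite mulNr opprK.
  move=> t /andP[at_ tb].
  have rt : r1 < t < 1 by rewrite (lt_trans r1a)//= (lt_trans tb).
  have t0 : 0 <= t by have /andP[/ltW] := in01' _ rt.
  rewrite divr_ge0//; first by apply/ltW/T.
  by rewrite subr_ge0 exprn_ile1//; case/andP: rt => _ /ltW.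
- exact: qr1.
- by move=> x; exact: std_gaussian2_square_le.
- exact: rbound_near1.
Qed.

Lemma comparison_left r1 : r1 < 1 ->
  (forall rho, 0 < rho <= r1 -> 0 <= lnratio rho) ->
  forall rho, 0 <= rho <= r1 -> qcorr rho <= rbound rho.
Proof.
move=> r11 kge rho /andP[r0 r1rho].
rewrite -subr_ge0; apply: (@le_trans _ _ (rbound 0 - qcorr 0)).
  by rewrite /rbound ent0 mulr0 expR0 mulr1 /qcorr square_event0 ?subrr// ltW.
apply: (@derive_ge0_le _ (fun t => rbound t - qcorr t) (fun x =>
     rbound x * (lam * artanh x) - ediff x / (pi * sigma x)) _ _ r0).
  move=> t /andP[? ?]; apply: has_derive_B.
    by apply: has_derive_rbound; lra.
  by apply: has_derive_qcorr; lra.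
move=> t /andP[? ?]; rewrite subr_ge0 -lnratioE; last by lra.
by apply: kge; lra.
Qed.

(** Gives the positivity of q required to take its logarithm at the end. *)
Lemma qcorr_ge rho : 0 <= rho < 1 -> P ^+ 2 <= qcorr rho.
Proof.
move=> /andP[r0 r1].
rewrite (_ : P ^+ 2 = qcorr 0); last by rewrite /qcorr square_event0// ltW.
apply: (@derive_ge0_le _ qcorr (fun x => ediff x / (pi * sigma x)) _ _ r0).
  by move=> t /andP[? ?]; apply: has_derive_qcorr; lra.
move=> t /andP[? ?]; rewrite divr_ge0//; first by apply/ltW/ediff_gt0; lra.
by rewrite mulr_ge0 ?pi_ge0 ?sqrtr_ge0.
Qed.

End comparison.

(** * The Mills ratio and the bound on [lam] *)

Section mills_ratio.
Variable R : realType.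
Implicit Types (x y k t : R).
Local Notation phi := (@normal_pdf R 0 1).

(* (2 n - 1)!! *)
Fixpoint dfact (n : nat) : nat :=
  match n with O => 1 | n'.+1 => n'.*2.+1 * dfact n' end.

Lemma dfact_gt0 n : (0 < dfact n)%nat.
Proof. by elim: n => // n IH; rewrite /= muln_gt0. Qed.

(** Partial sums of the power series of [mills] in y = k^2, whose coefficients are the reciprocals
    of (2 i + 1)!!. *)
Definition mills_sum n y : R := \sum_(i < n) y ^+ i / (dfact i.+1)%:R.

Lemma mills_sumS n y : mills_sum n.+1 y = mills_sum n y + y ^+ n / (dfact n.+1)%:R.
Proof. by rewrite /mills_sum big_ord_recr. Qed.

Lemma dfactR n : (dfact n)%:R != 0 :> R.
Proof. by rewrite pnatr_eq0 -lt0n dfact_gt0. Qed.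

Lemma dfactR_gt0 n : 0 < (dfact n)%:R :> R.
Proof. by rewrite ltr0n dfact_gt0. Qed.

Lemma dfactSR n : (dfact n.+1)%:R = (2 * n%:R + 1) * (dfact n)%:R :> R.
Proof. by rewrite /= natrM -addn1 natrD -mul2n natrM. Qed.

Lemma has_derive_phi_odd n t :
  has_derive (fun t => phi t * t ^+ n.*2.+1) t
    (phi t * ((2 * n%:R + 1) * t ^+ n.*2 - t ^+ n.+1.*2)).
Proof.
apply: has_derive_congr.
  apply: has_derive_M; first exact: has_derive_phi.
  by repeat derive_rule.
rewrite mulr1 -[in n.*2.+1%:R]addn1 natrD -[in n.*2%:R]mul2n natrM.
by rewrite doubleS !exprS; ring.
Qed.

(** Telescoping: the summand phi * t^(2 n + 1) / (2 n + 1)!! has derivative phi * (t^(2 n) / (2 n -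
    1)!! - t^(2 n + 2) / (2 n + 1)!!). *)
Lemma has_derive_mills_sum n t :
  has_derive (fun t => phi t * (t * mills_sum n (t ^+ 2))) t
    (phi t * (1 - t ^+ n.*2 / (dfact n)%:R)).
Proof.
elim: n => [|n IH].
  rewrite (_ : (fun _ => _) = fun=> 0).
    by rewrite expr0 divr1 subrr mulr0; exact: has_derive_cst.
  by apply/funext => s; rewrite /mills_sum big_ord0 !mulr0.
rewrite (_ : (fun _ => _) = fun t => phi t * (t * mills_sum n (t ^+ 2)) +
    (dfact n.+1)%:R^-1 * (phi t * t ^+ n.*2.+1)); last first.
  by apply/funext => s; rewrite mills_sumS -exprM mul2n (exprS s n.*2); ring.
apply: has_derive_congr.
  apply: has_derive_D; first exact: IH.
  apply: has_derive_M; first exact: has_derive_cst.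
  exact: has_derive_phi_odd.
have d0 := dfactR n; have n1 : 2 * n%:R + 1 != 0 :> R.
  by rewrite gt_eqF// ltr_wpDl ?mulr_ge0.
by rewrite dfactSR; field; rewrite d0.
Qed.

Definition gauss_square k : R := gauss_cdf k - gauss_cdf (- k).

Lemma gauss_square0 : gauss_square 0 = 0.
Proof. by rewrite /gauss_square oppr0 subrr. Qed.

Lemma gauss_square_ge n k : 0 <= k ->
  2 * (phi k * (k * mills_sum n (k ^+ 2))) <= gauss_square k.
Proof.
move=> k0; rewrite -subr_ge0.
rewrite [leLHS](_ : 0 = gauss_square 0 - 2 * (phi 0 * (0 * mills_sum n (0 ^+ 2)))); last first.
  by rewrite gauss_square0 mul0r !mulr0 subrr.
apply: (@derive_ge0_le R
  (fun t => gauss_square t - 2 * (phi t * (t * mills_sum n (t ^+ 2))))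
  (fun t => 2 * phi t - (0 * (phi t * (t * mills_sum n (t ^+ 2))) +
    2 * (phi t * (1 - t ^+ n.*2 / (dfact n)%:R)))) _ _ k0).
  move=> t _; apply: has_derive_B; first exact: has_derive_P.
  apply: has_derive_M; first exact: has_derive_cst.
  exact: has_derive_mills_sum.
move=> t /andP[t0 _].
rewrite (_ : _ - _ = 2 * phi t * (t ^+ n.*2 / (dfact n)%:R)); last by ring.
apply: mulr_ge0; first by rewrite mulr_ge0// ltW// phi_gt0.
apply: divr_ge0 => //; exact/exprn_ge0/ltW.
Qed.

(** The missing derivative phi * t^(2 n) / (2 n - 1)!! is dominated by that of a multiple e of phi *
    t^(2 n + 1), namely e * phi * t^(2 n) * (2 n + 1 - t^2). The condition t^2 <= c determines e. *)
Lemma gauss_square_le n c k : 0 <= k -> k ^+ 2 <= c -> c < 2 * n%:R + 1 ->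
  gauss_square k <= 2 * (phi k * (k * (mills_sum n (k ^+ 2) +
     (k ^+ 2) ^+ n / ((dfact n)%:R * (2 * n%:R + 1 - c))))).
Proof.
move=> k0 kc cn; have d0 := dfactR n.
have c0 : 0 < 2 * n%:R + 1 - c by rewrite subr_gt0.
pose e := ((dfact n)%:R * (2 * n%:R + 1 - c))^-1.
have e0 : 0 < e by rewrite invr_gt0 mulr_gt0// dfactR_gt0.
have E s : 2 * (phi s * (s * (mills_sum n (s ^+ 2) +
      (s ^+ 2) ^+ n / ((dfact n)%:R * (2 * n%:R + 1 - c))))) =
    2 * (phi s * (s * mills_sum n (s ^+ 2)) + e * (phi s * s ^+ n.*2.+1)).
  by rewrite -/e -exprM mul2n (exprS s n.*2); ring.
rewrite E -subr_ge0.
rewrite [leLHS](_ : 0 = 2 * (phi 0 * (0 * mills_sum n (0 ^+ 2)) + e * (phi 0 * 0 ^+ n.*2.+1))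
   - gauss_square 0); last first.
  by rewrite gauss_square0 (exprS 0 n.*2) !mul0r !mulr0 addr0 mulr0 subrr.
apply: (@derive_ge0_le _
  (fun s => 2 * (phi s * (s * mills_sum n (s ^+ 2)) + e * (phi s * s ^+ n.*2.+1))
   - gauss_square s)
  (fun t => (0 * (phi t * (t * mills_sum n (t ^+ 2)) + e * (phi t * t ^+ n.*2.+1)) +
    2 * (phi t * (1 - t ^+ n.*2 / (dfact n)%:R) + (0 * (phi t * t ^+ n.*2.+1) +
     e * (phi t * ((2 * n%:R + 1) * t ^+ n.*2 - t ^+ n.+1.*2))))) - 2 * phi t) _ _ k0).
  move=> t _; apply: has_derive_B; last exact: has_derive_P.
  apply: has_derive_M; first exact: has_derive_cst.
  apply: has_derive_D; first exact: has_derive_mills_sum.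
  apply: has_derive_M; first exact: has_derive_cst.
  exact: has_derive_phi_odd.
move=> t /andP[t0 tk].
rewrite (_ : _ - _ = 2 * phi t * (t ^+ n.*2 * (e * (c - t ^+ 2)))).
  apply: mulr_ge0; first by rewrite mulr_ge0// ltW// phi_gt0.
  apply: mulr_ge0; first exact/exprn_ge0/ltW.
  apply: mulr_ge0; first exact: ltW.
  rewrite subr_ge0 (le_trans _ kc)//.
  by apply: lerXn2r; rewrite ?nnegrE// ltW.
have -> : (dfact n)%:R^-1 = e * (2 * n%:R + 1 - c) :> R.
  by rewrite /e invfM -mulrA mulVf ?mulr1// gt_eqF.
by rewrite doubleS !exprS; ring.
Qed.

(** The analogue for the central mass of the Mills ratio of the tail. It is a power series in k^2
    with positive coefficients, hence increasing and convex in y. *)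
Definition mills k : R := Pkappa k / (2 * (k * phi k)).

Lemma mills_ge n k : 0 < k -> mills_sum n (k ^+ 2) <= mills k.
Proof.
move=> k0; have p0 := phi_gt0 k; rewrite /mills (PkappaE (ltW k0)).
rewrite ler_pdivlMr ?mulr_gt0//; apply: le_trans (gauss_square_ge n (ltW k0)).
by rewrite le_eqVlt; apply/orP; left; apply/eqP; ring.
Qed.

Lemma mills_le n k : 0 < k -> k ^+ 2 < 2 * n%:R + 1 ->
  mills k <= mills_sum n (k ^+ 2) +
    (k ^+ 2) ^+ n / ((dfact n)%:R * (2 * n%:R + 1 - k ^+ 2)).
Proof.
move=> k0 kn; have p0 := phi_gt0 k; rewrite /mills (PkappaE (ltW k0)).
rewrite ler_pdivrMr ?mulr_gt0//.
apply: (le_trans (gauss_square_le (ltW k0) (lexx _) kn)).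
by rewrite le_eqVlt; apply/orP; left; apply/eqP; ring.
Qed.

Lemma mills_gt0 k : 0 < k -> 0 < mills k.
Proof.
move=> k0; apply: (lt_le_trans _ (mills_ge 1 k0)).
by rewrite /mills_sum big_ord_recl big_ord0 addr0 expr0 mul1r invr_gt0 dfactR_gt0.
Qed.

Lemma PkappaM k : 0 < k -> Pkappa k = 2 * k * phi k * mills k.
Proof.
by move=> k0; have p0 := phi_gt0 k; rewrite /mills; field; rewrite !gt_eqF.
Qed.

(** The square of P removes the square root of pi; the factor pi then cancels against the one in
    Plackett's identity. *)
Lemma Pkappa_sqr k : 0 < k ->
  Pkappa k ^+ 2 * pi = 2 * k ^+ 2 * mills k ^+ 2 * expR (- k ^+ 2).
Proof.
move=> k0; rewrite PkappaM//; move: (mills k) => m.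
rewrite !exprMn phiE exprMn peak_sqr.
have -> : expR (- k ^+ 2 / 2) ^+ 2 = expR (- k ^+ 2).
  by rewrite -expRM_natl; congr expR; field.
move: (expR _) => e; have := pi_gt0 R; move: (pi : R) => p p0.
by field; rewrite gt_eqF.
Qed.

(** The sum lies above its tangent because each monomial does. The slope is read off from 2 y S' + S
    = 1 + y T, where S and T are the sums of lengths n + 1 and n, so it is computed from values of
    the sums alone. *)
Lemma mills_sum_tangent n y0 y : 0 < y0 -> 0 <= y ->
  mills_sum n.+1 y0 +
    (1 + y0 * mills_sum n y0 - mills_sum n.+1 y0) / (2 * y0) * (y - y0)
  <= mills_sum n.+1 y.
Proof.
move=> y00 yge0; have y0n : y0 != 0 by rewrite gt_eqF.
have tan i : y0 ^+ i + i%:R * y0 ^+ i.-1 * (y - y0) <= y ^+ i.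
  elim: i => [|i IH]; first by rewrite !mul0r addr0 !expr0.
  rewrite exprS [leRHS]exprS; apply: le_trans (ler_wpM2l yge0 IH).
  rewrite -subr_ge0.
  case: i {IH} => [|i].
    by rewrite /= !expr0 (_ : _ - _ = 0)//; ring.
  rewrite (_ : _ - _ = i.+1%:R * y0 ^+ i * (y - y0) ^+ 2).
    by rewrite mulr_ge0 ?sqr_ge0// mulr_ge0// exprn_ge0// ltW.
  by rewrite /= -[in i.+2%:R](addn1 i.+1) natrD !exprS; ring.
have -> : (1 + y0 * mills_sum n y0 - mills_sum n.+1 y0) / (2 * y0) =
    \sum_(i < n.+1) i%:R * y0 ^+ i.-1 / (dfact i.+1)%:R.
  elim: n => [|n IH].
    rewrite /mills_sum big_ord0 !big_ord_recl !big_ord0 /= mulr0 !addr0 expr0.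
    by rewrite divr1 subrr !mul0r.
  rewrite big_ord_recr -IH /= (mills_sumS n.+1) mills_sumS.
  have d0 := dfactR n; have n1 : 2 * n%:R + 1 != 0 :> R.
    by rewrite gt_eqF// ltr_wpDl ?mulr_ge0.
  have n2 : 2 * n.+1%:R + 1 != 0 :> R.
    by rewrite gt_eqF// ltr_wpDl ?mulr_ge0.
  have nS : n.+1%:R = n%:R + 1 :> R by rewrite -addn1 natrD.
  rewrite (dfactSR n.+1) dfactSR (exprS y0 n) nS in n2 *.
  have := ler0n R n; move: (n%:R : R) (dfact n)%:R d0 {n1 n2 nS} => z d d0 z0.
  by field; rewrite d0 y0n !gt_eqF//; lra.
rewrite /mills_sum big_distrl /= -big_split /=; apply: ler_sum => i _.
rewrite [i%:R * _ / _ * _]mulrAC -mulrDl ler_pM2r; first exact: tan.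
by rewrite invr_gt0; exact: (dfactR_gt0 i.+1).
Qed.

End mills_ratio.

(** * Rational bounds on pi *)

Section pi_bounds.
Variable R : realType.
Implicit Types x : R.

Lemma derive_le_le (f g f' g' : R -> R) : f 0 = g 0 ->
  (forall x, 0 <= x -> has_derive f x (f' x)) ->
  (forall x, 0 <= x -> has_derive g x (g' x)) ->
  (forall x, 0 <= x -> f' x <= g' x) -> forall x, 0 <= x -> f x <= g x.
Proof.
move=> fg0 df dg fg' x x0; rewrite -subr_ge0.
rewrite [leLHS](_ : 0 = g 0 - f 0); last by rewrite fg0 subrr.
apply: (@derive_ge0_le _ (fun t => g t - f t) (fun t => g' t - f' t) _ _ x0).
  by move=> t /andP[t0 _]; apply: has_derive_B; [exact: dg|exact: df].
by move=> t /andP[/ltW t0 _]; rewrite subr_ge0 fg'.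
Qed.

(** The triple angle formula gives 3 s - 4 s^3 = 1, that is (s + 1) (2 s - 1)^2 = 0, and s is
    positive. *)
Lemma sin_pi6 : sin (pi / 6) = 2^-1 :> R.
Proof.
pose s : R := sin (pi / 6).
have p0 := pi_gt0 R.
have s0 : 0 < s by rewrite sin_gt0_pi//; lra.
have s3 : 3 * s - 4 * s ^+ 3 = 1.
  rewrite -[RHS](sin_pihalf R) (_ : pi / 2 = pi / 6 + (pi / 6 + pi / 6)); last by field.
  rewrite (sinD (pi / 6) (pi / 6 + pi / 6)) sinD cosD -/s.
  have := cos2Dsin2 (pi / 6 : R); rewrite -/s; move: (cos _) => c /eqP.
  rewrite -subr_eq0 => /eqP c2.
  transitivity (3 * s - 4 * s ^+ 3 + 3 * s * (c ^+ 2 + s ^+ 2 - 1)); last by ring.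
  by rewrite c2 mulr0 addr0.
have : (s + 1) * (2 * s - 1) ^+ 2 = 0.
  by rewrite (_ : _ * _ = 1 - (3 * s - 4 * s ^+ 3)); [rewrite s3 subrr|ring].
move/eqP; rewrite mulf_eq0 sqrf_eq0 (gt_eqF (_ : 0 < s + 1)); last by lra.
by move=> /= /eqP; rewrite -/s; lra.
Qed.

Lemma sin_bounds x : 0 <= x ->
  x - x ^+ 3 / 6 + x ^+ 5 / 120 - x ^+ 7 / 5040 <= sin x <=
  x - x ^+ 3 / 6 + x ^+ 5 / 120.
Proof.
have ds t : 0 <= t -> has_derive (@sin R) t (cos t) by move=> _; exact: is_derive_sin.
have dc t : 0 <= t -> has_derive (fun t : R => - cos t) t (sin t).
  move=> _; apply: has_derive_congr; last exact: opprK.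
  by apply: has_derive_N; exact: is_derive_cos.
have s1 : forall t : R, 0 <= t -> sin t <= t.
  apply: (@derive_le_le _ id _ (fun=> 1) _ ds).
  - by rewrite sin0.
  - by move=> t _; exact: has_derive_id.
  - by move=> t _; exact: cos_le1.
have c2 : forall t : R, 0 <= t -> - cos t <= - (1 - t ^+ 2 / 2).
  apply: (@derive_le_le _ (fun t => - (1 - t ^+ 2 / 2)) _ (fun t => t) _ dc _ s1).
  - by rewrite cos0 !expr0n /= !mul0r subr0.
  - by move=> t _; derive_fun; field.
have s3 : forall t : R, 0 <= t -> t - t ^+ 3 / 6 <= sin t.
  apply: (@derive_le_le (fun t => t - t ^+ 3 / 6) _ (fun t => 1 - t ^+ 2 / 2) _ _ _ ds).
  - by rewrite sin0 !expr0n /= !mul0r subr0.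
  - by move=> t _; derive_fun; field.
  - by move=> t t0; have := c2 t t0; lra.
have c4 : forall t : R, 0 <= t -> - (1 - t ^+ 2 / 2 + t ^+ 4 / 24) <= - cos t.
  apply: (@derive_le_le (fun t => - (1 - t ^+ 2 / 2 + t ^+ 4 / 24)) _
    (fun t => t - t ^+ 3 / 6) _ _ _ dc s3).
  - by rewrite cos0 !expr0n /= !mul0r subr0 addr0.
  - by move=> t _; derive_fun; field.
have s5 : forall t : R, 0 <= t -> sin t <= t - t ^+ 3 / 6 + t ^+ 5 / 120.
  apply: (@derive_le_le _ (fun t => t - t ^+ 3 / 6 + t ^+ 5 / 120) _
    (fun t => 1 - t ^+ 2 / 2 + t ^+ 4 / 24) _ ds).
  - by rewrite sin0 !expr0n /= !mul0r subr0 addr0.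
  - by move=> t _; derive_fun; field.
  - by move=> t t0; have := c4 t t0; lra.
have c6 : forall t : R, 0 <= t ->
    - cos t <= - (1 - t ^+ 2 / 2 + t ^+ 4 / 24 - t ^+ 6 / 720).
  apply: (@derive_le_le _ (fun t => - (1 - t ^+ 2 / 2 + t ^+ 4 / 24 - t ^+ 6 / 720)) _
    (fun t => t - t ^+ 3 / 6 + t ^+ 5 / 120) _ dc _ s5).
  - by rewrite cos0 !expr0n /= !mul0r !subr0 addr0.
  - by move=> t _; derive_fun; field.
move=> x0; rewrite s5// andbT; move: x x0.
apply: (@derive_le_le (fun x => x - x ^+ 3 / 6 + x ^+ 5 / 120 - x ^+ 7 / 5040) _
  (fun t => 1 - t ^+ 2 / 2 + t ^+ 4 / 24 - t ^+ 6 / 720) _ _ _ ds).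
- by rewrite sin0 !expr0n /= !mul0r !subr0 addr0.
- by move=> t _; derive_fun; field.
- by move=> t t0; have := c6 t t0; lra.
Qed.

(** Both fractions are convergents of pi. A sixth of each is compared with pi / 6 through the
    monotonicity of [sin] and its Taylor bounds. *)
Lemma pi_bounds : 333 / 106 < (pi : R) < 355 / 113.
Proof.
have [p2 p4] : 2 <= (pi : R) /\ (pi : R) < 4.
  by have := pi_ge2 R; have := pihalf_lt2 R; lra.
have inI x : 0 <= x -> x <= 1 -> x \in `[(- (pi / 2)), pi / 2].
  by move=> *; rewrite in_itv/=; lra.
have a1 : 111 / 212 < pi / 6 :> R.
  rewrite -ltr_sin; [|apply: inI; lra..].
  have /andP[_ b1] := @sin_bounds (111 / 212) ltac:(lra).
  by rewrite sin_pi6; apply: (le_lt_trans b1); lra.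
have a2 : pi / 6 < 355 / 678 :> R.
  rewrite -ltr_sin; [|apply: inI; lra..].
  have /andP[b2 _] := @sin_bounds (355 / 678) ltac:(lra).
  by rewrite sin_pi6; apply: (lt_le_trans _ b2); lra.
move: a1 a2; generalize (pi : R) => p; lra.
Qed.

End pi_bounds.

(** * Tangents and numerical tests for the logarithm of P *)

Section lam_bounds.
Variable R : realType.
Implicit Types (k s t r m : R).
Local Notation phi := (@normal_pdf R 0 1).

Lemma lam_ln2 k : lam k * ln 2 = - ln (Pkappa k).
Proof. by rewrite /lam mulNr divfK// gt_eqF// ln2_gt0. Qed.

(** This is the convexity of - ln P in y = k^2, whose derivative in y is - 1 / (2 y mills). *)
Lemma sqr_mills_le s t : 0 < s -> s <= t -> s ^+ 2 * mills s <= t ^+ 2 * mills t.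
Proof.
move=> s0 st; have t0 := lt_le_trans s0 st.
have E u : 0 < u -> u ^+ 2 * mills u = u / 2 * (gauss_square u * (phi u)^-1).
  move=> u0; have p0 := phi_gt0 u.
  rewrite /mills (PkappaE (ltW u0)) -/(gauss_square u).
  by move: (gauss_square u) => g; field; rewrite !gt_eqF.
have gs0 (u : R) : 0 < u -> 0 < gauss_square u.
  by move=> u0; rewrite /gauss_square -(PkappaE (ltW u0)) P_gt0.
rewrite !E//; apply: ler_pM.
- by rewrite divr_ge0// ltW.
- by apply/ltW; rewrite divr_gt0 ?gs0 ?invr_gt0 ?phi_gt0.
- by rewrite ler_pM2r.
apply: (@derive_ge0_le _ (fun u => gauss_square u * (phi u)^-1)
  (fun u => 2 * phi u * (phi u)^-1 +
     gauss_square u * (- (- u * phi u) / phi u ^+ 2)) _ _ st).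
  move=> u _; apply: has_derive_M; first exact: has_derive_P.
  by apply: has_derive_V; [exact: has_derive_phi|rewrite gt_eqF// phi_gt0].
move=> u /andP[su _]; have u0 := lt_trans s0 su; have p0 := phi_gt0 u.
have g0 := gs0 u u0.
rewrite !mulNr opprK; apply: addr_ge0; first by rewrite -mulrA mulfV ?mulr1 ?gt_eqF.
apply: mulr_ge0; first exact: ltW.
by rewrite divr_ge0 ?exprn_ge0 ?mulr_ge0 ?ltW.
Qed.

Lemma lnP_tangent k0 k : 0 < k0 -> 0 < k ->
  - ln (Pkappa k0) + (k0 ^+ 2 - k ^+ 2) / (2 * k0 ^+ 2 * mills k0) <= - ln (Pkappa k).
Proof.
move=> k00 k_gt0; set c := (_ * mills k0).
have c0 : 0 < c.
  by apply: mulr_gt0; [apply: mulr_gt0; rewrite ?exprn_gt0|exact: mills_gt0].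
have c2 : c / 2 = k0 ^+ 2 * mills k0.
  by rewrite /c; move: (mills k0) => m; field.
pose h t := - ln (gauss_square t) + t ^+ 2 / c.
pose h' t := t * (2 / c - (t ^+ 2 * mills t)^-1).
have dh t : 0 < t -> has_derive h t (h' t).
  move=> t0; have g0 := P_gt0 t0; have p0 := phi_gt0 t; have m0 := mills_gt0 t0.
  have gE : gauss_square t = 2 * t * phi t * mills t.
    by rewrite -PkappaM// (PkappaE (ltW t0)).
  apply: has_derive_congr.
    apply: has_derive_D; last by repeat derive_rule.
    apply: has_derive_N; apply: has_derive_ln; first exact: has_derive_P.
    by rewrite -/(gauss_square t) /gauss_square -(PkappaE (ltW t0)).
  rewrite -/(gauss_square t) gE /h'.
  by field; rewrite !gt_eqF.
suff : h k0 <= h k.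
  rewrite /h /gauss_square -!PkappaE ?(ltW k00) ?(ltW k_gt0)// => H.
  rewrite -subr_ge0 in H; rewrite -subr_ge0; apply: (le_trans H).
  by rewrite le_eqVlt; apply/orP; left; apply/eqP; ring.
have [le|/ltW le] := leP k0 k.
  apply: (derive_ge0_le le (f' := h')).
    by move=> t /andP[kt _]; apply: dh; exact: lt_le_trans kt.
  move=> t /andP[/ltW kt _]; have t0 := lt_le_trans k00 kt.
  apply: mulr_ge0; first exact: ltW.
  rewrite subr_ge0 -[2 / c]invf_div lef_pV2 ?posrE ?divr_gt0//; last first.
    by apply: mulr_gt0; [rewrite exprn_gt0|exact: mills_gt0].
  rewrite c2; exact: sqr_mills_le.
rewrite -lerN2; apply: (@derive_ge0_le _ (fun t => - h t) (fun t => - h' t) _ _ le).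
  by move=> t /andP[kt _]; apply: has_derive_N; apply: dh; exact: lt_le_trans kt.
move=> t /andP[/ltW kt /ltW tk]; have t0 := lt_le_trans k_gt0 kt.
rewrite -mulrN opprB; apply: mulr_ge0; first exact: ltW.
rewrite subr_ge0 -[2 / c]invf_div lef_pV2 ?posrE ?divr_gt0//; last first.
  by apply: mulr_gt0; [rewrite exprn_gt0|exact: mills_gt0].
rewrite c2; exact: sqr_mills_le.
Qed.

(** The conclusion says exp (2 r) P^2 <= 1. By [Pkappa_sqr] it becomes a condition on y, pi and
    [mills] only, suited to interval arithmetic. *)
Lemma lnP_ge k r m : 0 < k -> mills k <= m ->
  expR (2 * r) * (2 * k ^+ 2 * m ^+ 2) <= pi * expR (k ^+ 2) ->
  r <= - ln (Pkappa k).
Proof.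
move=> k0 km H; have P0 := P_gt0 k0; have m0 := mills_gt0 k0.
rewrite lerNr -ler_expR lnK ?posrE// -(@ler_pXn2r _ 2)// ?nnegrE ?expR_ge0 ?(ltW P0)//.
rewrite -expRM_natl mulrN expRN.
rewrite -[leRHS]mul1r ler_pdivlMr ?expR_gt0//.
rewrite -(ler_pM2r (pi_gt0 R)) mul1r mulrAC Pkappa_sqr// expRN.
rewrite mulrAC ler_pdivrMr ?expR_gt0//; apply: le_trans H.
rewrite mulrC ler_pM2l ?expR_gt0// ler_pM2l ?mulr_gt0 ?exprn_gt0//.
by apply: lerXn2r; rewrite ?nnegrE// ltW// (lt_le_trans m0).
Qed.

Lemma lnP_le k r m : 0 < k -> 0 <= m -> m <= mills k ->
  pi * expR (k ^+ 2) <= expR (2 * r) * (2 * k ^+ 2 * m ^+ 2) ->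
  - ln (Pkappa k) <= r.
Proof.
move=> k0 m0 km H; have P0 := P_gt0 k0.
rewrite lerNl -ler_expR lnK ?posrE// -(@ler_pXn2r _ 2)// ?nnegrE ?expR_ge0 ?(ltW P0)//.
rewrite -expRM_natl mulrN expRN.
rewrite -[leLHS]mul1r ler_pdivrMr ?expR_gt0//.
rewrite -(ler_pM2r (pi_gt0 R)) mul1r mulrAC Pkappa_sqr// expRN.
rewrite mulrAC ler_pdivlMr ?expR_gt0//; apply: (le_trans H).
rewrite mulrC ler_pM2r ?expR_gt0// ler_pM2l ?mulr_gt0 ?exprn_gt0//.
by apply: lerXn2r; rewrite ?nnegrE// (le_trans m0).
Qed.

End lam_bounds.

(** * Shape of the derivative ratio *)

Section hyperbolic.
Variable R : realType.
Implicit Types (rho w x y z : R).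

(** [g0] to [g3] vanish at 0, each has the next function as its derivative, and [g4] is visibly
    nonnegative. *)
Lemma sinh_cosh_ge0 w : 0 <= w ->
  4 * (expR w + expR (- w) - 2) <= 2 * w ^+ 2 + w * (expR w - expR (- w)).
Proof.
pose g0 w := 2 * w ^+ 2 + w * (expR w - expR (- w)) - 4 * (expR w + expR (- w) - 2).
pose g1 w := 4 * w + w * (expR w + expR (- w)) - 3 * (expR w - expR (- w)).
pose g2 w := 4 + w * (expR w - expR (- w)) - 2 * (expR w + expR (- w)).
pose g3 w := w * (expR w + expR (- w)) - (expR w - expR (- w)).
pose g4 w := w * (expR w - expR (- w)).
have up (f f' : R -> R) : f 0 = 0 -> (forall x, 0 <= x -> has_derive f x (f' x)) ->
    (forall x, 0 <= x -> 0 <= f' x) -> forall x, 0 <= x -> 0 <= f x.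
  move=> f0 df; apply: (@derive_le_le _ (fun=> 0) _ (fun=> 0)) => //.
  by move=> x _; exact: has_derive_cst.
move=> w0; rewrite -subr_ge0 -/(g0 w).
apply: (up g0 g1) => // {w w0}.
- by rewrite /g0 oppr0 expR0; ring.
- by move=> x _; rewrite /g0 /g1; derive_fun; ring.
apply: (up g1 g2).
- by rewrite /g1 oppr0 expR0; ring.
- by move=> x _; rewrite /g1 /g2; derive_fun; ring.
apply: (up g2 g3).
- by rewrite /g2 oppr0 expR0; ring.
- by move=> x _; rewrite /g2 /g3; derive_fun; ring.
apply: (up g3 g4).
- by rewrite /g3 oppr0 expR0; ring.
- by move=> x _; rewrite /g3 /g4; derive_fun; ring.
move=> x x0; rewrite /g4 mulr_ge0// subr_ge0 ler_expR.
by apply: (le_trans _ x0); rewrite oppr_le0.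
Qed.

Definition zcoth z : R := z * (expR (2 * z) + 1) / (expR (2 * z) - 1).

Lemma zcoth_ge0 z : 0 < z -> 0 <= zcoth z.
Proof.
move=> z0; apply: divr_ge0.
  by rewrite mulr_ge0 ?addr_ge0 ?expR_ge0 ?(ltW z0).
by rewrite subr_ge0 -[leLHS]expR0 ler_expR mulr_ge0// ltW.
Qed.

(** Multiplied by sinh^2 z this is z^2 + z sinh z cosh z - 2 sinh^2 z >= 0, an instance of
    [sinh_cosh_ge0] at w = 2 z. *)
Lemma zcoth_quad z : 0 < z -> 0 <= zcoth z ^+ 2 + zcoth z - 2 - z ^+ 2.
Proof.
move=> z0; have w0 : 0 <= 2 * z by rewrite mulr_ge0// ltW.
have := sinh_cosh_ge0 w0; rewrite /zcoth expRN.
have e1 : 1 < expR (2 * z) by rewrite -[ltLHS]expR0 ltr_expR mulr_gt0.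
move: (expR (2 * z)) e1 => e e1; have e0 : 0 < e := lt_trans ltr01 e1.
have em : 0 < e - 1 by rewrite subr_gt0.
rewrite -subr_ge0 => H.
have -> : (z * (e + 1) / (e - 1)) ^+ 2 + z * (e + 1) / (e - 1) - 2 - z ^+ 2 =
  (2 * (2 * z) ^+ 2 + 2 * z * (e - e^-1) - 4 * (e + e^-1 - 2)) * e / (2 * (e - 1) ^+ 2).
  by field; rewrite !gt_eqF.
by rewrite divr_ge0// mulr_ge0 ?exprn_ge0// ltW.
Qed.

End hyperbolic.

Section kernel.
Variable R : realType.
Implicit Types (rho y z : R).
Local Notation sigma rho := (Num.sqrt (1 - rho ^+ 2)).

(** [ediff] without the factors shown in [ediff_kernel]. It tends to 1 as rho tends to 0, so the
    comparison does not degenerate at the left end. *)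
Definition kernel y rho : R :=
  (expR (y * (rho / (1 + rho))) - expR (- (y * (rho / (1 - rho))))) /
  (2 * y * rho * sigma rho).

Variable k : R.
Hypothesis k_gt0 : 0 < k.
Local Notation y := (k ^+ 2).

Lemma ediff_kernel rho : 0 < rho < 1 ->
  ediff k rho = expR (- y) * (2 * y * rho * sigma rho * kernel y rho).
Proof.
move=> r01; have [r0 r1] := andP r01.
have s0 : 0 < sigma rho by apply: sigma_gt0; lra.
have y0 : 0 < y by rewrite exprn_gt0.
have c0 : 2 * y * rho * sigma rho != 0.
  by rewrite gt_eqF// !mulr_gt0.
rewrite /kernel [2 * y * rho * _ * _]mulrC divfK// mulrBr -!expRD /ediff.
by congr (expR _ - expR _); field; lra.
Qed.

Lemma kernel_gt0 rho : 0 < rho < 1 -> 0 < kernel y rho.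
Proof.
move=> r01; have := ediff_gt0 k_gt0 r01; rewrite ediff_kernel// pmulr_rgt0 ?expR_gt0//.
have [r0 r1] := andP r01; have s0 : 0 < sigma rho by apply: sigma_gt0; lra.
rewrite pmulr_rgt0// mulr_gt0// mulr_gt0// mulr_gt0// exprn_gt0//.
Qed.

Lemma lnratio_kernel rho : 0 < rho < 1 ->
  kernel y rho <= lam k * mills k ^+ 2 * expR (lam k * ent rho) * (artanh rho / rho) ->
  0 <= lnratio k rho.
Proof.
move=> r01 H; have [r0 r1] := andP r01.
have s0 : 0 < sigma rho by apply: sigma_gt0; lra.
have y0 : 0 < y by rewrite exprn_gt0.
rewrite lnratioE// ediff_kernel// ler_pdivrMr; last by rewrite mulr_gt0 ?pi_gt0.
rewrite /rbound.
rewrite (_ : _ * (pi * _) = (Pkappa k ^+ 2 * pi) * (expR (lam k * ent rho) *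
   (lam k * artanh rho) * sigma rho)); last by ring.
rewrite Pkappa_sqr//.
move: (expR (lam k * _)) (expR (- y)) (expR_gt0 (- y)) H => e e' e'0 H.
move: (kernel y rho) (mills k) (lam k) (artanh rho) H => K m l a H.
rewrite [leRHS](_ : _ = e' * (2 * y * rho * sigma rho * (l * m ^+ 2 * e * (a / rho)))).
  rewrite ler_pM2l// ler_pM2l//.
  by rewrite mulr_gt0// mulr_gt0// mulr_gt0.
by field; rewrite gt_eqF.
Qed.

(** Factoring out exp (- y / (1 - rho)) leaves one exponential. The second term is nonnegative, and
    discarding it gives the rational bound [drift_ge]. *)
Lemma drift_split rho : 0 < rho < 1 ->
  drift k rho = y * ((1 - rho) / (1 + rho)) +
    2 * y * (1 + rho ^+ 2) / (1 - rho ^+ 2) /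
      (expR (2 * y * rho / (1 - rho ^+ 2)) - 1).
Proof.
move=> r01; have [r0 r1] := andP r01.
have p : 1 + rho != 0 by rewrite gt_eqF//; lra.
have m : 1 - rho != 0 by rewrite gt_eqF//; lra.
have t0 : 1 - rho ^+ 2 = (1 + rho) * (1 - rho) by ring.
have x0 : 0 < 2 * y * rho / (1 - rho ^+ 2).
  rewrite t0 divr_gt0//; last by rewrite mulr_gt0; lra.
  by rewrite mulr_gt0// mulr_gt0// exprn_gt0.
rewrite /drift /ediff.
have -> : - y / (1 + rho) = - y / (1 - rho) + 2 * y * rho / (1 - rho ^+ 2).
  by rewrite t0; field; rewrite p m.
rewrite expRD; have : 1 < expR (2 * y * rho / (1 - rho ^+ 2)).
  by rewrite -[ltLHS]expR0 ltr_expR.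
move: (expR (_ / (1 - rho ^+ 2))) (expR (_ / (1 - rho))) (expR_gt0 (- y / (1 - rho))).
move=> e e' e'0 e1; rewrite t0.
field; rewrite m p /=; have -> : e' * e - e' = e' * (e - 1) by ring.
by rewrite !gt_eqF ?mulr_gt0// subr_gt0.
Qed.

Lemma drift_ge rho : 0 < rho < 1 -> y * ((1 - rho) / (1 + rho)) <= drift k rho.
Proof.
move=> r01; have [r0 r1] := andP r01; rewrite drift_split// lerDl.
have t0 : 0 < 1 - rho ^+ 2.
  by rewrite (_ : _ - _ = (1 + rho) * (1 - rho)); [rewrite mulr_gt0; lra|ring].
have y0 : 0 < y by rewrite exprn_gt0.
apply: divr_ge0; last first.
  rewrite subr_ge0 -[leLHS]expR0 ler_expR; apply: divr_ge0; last exact: ltW.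
  by rewrite mulr_ge0// ?(ltW r0)// mulr_ge0// ltW.
apply: divr_ge0; last exact: ltW.
by rewrite mulr_ge0 ?addr_ge0 ?sqr_ge0// mulr_ge0// ltW.
Qed.

Lemma drift_zcoth rho : 0 < rho < 1 ->
  rho * drift k rho = (1 + rho ^+ 2) * zcoth (y * rho / (1 - rho ^+ 2))
    - 2 * rho * (y * rho / (1 - rho ^+ 2)).
Proof.
move=> r01; have [r0 r1] := andP r01; rewrite drift_split// /zcoth.
have y0 : 0 < y by rewrite exprn_gt0.
have t0 : 0 < (1 + rho) * (1 - rho) by rewrite mulr_gt0; lra.
have tE : 1 - rho ^+ 2 = (1 + rho) * (1 - rho) by ring.
have -> : 2 * (y * rho / (1 - rho ^+ 2)) = 2 * y * rho / (1 - rho ^+ 2) by ring.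
have : 1 < expR (2 * y * rho / (1 - rho ^+ 2)).
  rewrite -[ltLHS]expR0 ltr_expR tE divr_gt0//.
  by rewrite mulr_gt0// mulr_gt0.
move: (expR _) => e e1; rewrite tE.
have p : 1 + rho != 0 by rewrite gt_eqF//; lra.
have m : 1 - rho != 0 by rewrite gt_eqF//; lra.
by field; rewrite m p gt_eqF// subr_gt0.
Qed.

(** The logarithmic derivative has the sign of t * drift + 2 t^2 - 1, which [drift_zcoth] turns into
    a quadratic polynomial in t with coefficients in z and c = z coth z. *)
Lemma kernel_le r s : 0 < r -> r <= s -> s < 1 -> kernel y r <= kernel y s.
Proof.
move=> r0 rs s1; have y0 : 0 < y by rewrite exprn_gt0.
have in01 t : r <= t -> t <= s -> 0 < t < 1.
  by move=> rt ts; rewrite (lt_le_trans r0 rt) (le_lt_trans ts s1).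
rewrite -ler_ln ?posrE ?kernel_gt0 ?in01//.
pose h t : R := ln (ediff k t) - ln t - ln (sigma t).
have lnE t : 0 < t < 1 -> ln (kernel y t) = h t + (y - ln (2 * y)).
  move=> t01; have [t0 t1] := andP t01.
  have s0 : 0 < sigma t by apply: sigma_gt0; lra.
  have K0 := kernel_gt0 t01.
  have a0 : 0 < 2 * y by rewrite mulr_gt0.
  rewrite /h ediff_kernel// [ln (_ * _)]lnM ?posrE ?expR_gt0//; last first.
    by do 3! (apply: mulr_gt0 => //).
  rewrite expRK; move: (kernel y t) K0 (2 * y) a0 => K K0 a a0.
  rewrite lnM ?posrE ?mulr_gt0// lnM ?posrE ?mulr_gt0// lnM ?posrE//.
  by ring.
rewrite !lnE ?in01// lerD2r.
apply: (derive_ge0_le rs (f' := fun t => (drift k t + 2 * t - t^-1) / (1 - t ^+ 2))).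
  move=> t /andP[rt ts]; have t01 := in01 _ rt ts; have [t0 t1] := andP t01.
  have e0 := ediff_gt0 k_gt0 t01.
  have s0 : 0 < sigma t by apply: sigma_gt0; lra.
  have tE : 1 - t ^+ 2 = (1 + t) * (1 - t) by ring.
  have tt0 : 0 < 1 - t ^+ 2 by rewrite -sqrtr_gt0.
  apply: has_derive_congr.
    apply: has_derive_B; last first.
      apply: has_derive_ln; last exact: s0.
      by apply: has_derive_sqrt; [repeat derive_rule|exact: tt0].
    apply: has_derive_B; last exact: (has_derive_ln (has_derive_id t) t0).
    by apply: has_derive_ln; [apply: has_derive_ediff; lra|exact: e0].
  have ss : sigma t * sigma t = 1 - t ^+ 2 by rewrite -expr2 sqr_sqrtr// ltW.
  rewrite (_ : _ / (2 * sigma t) / sigma t = - t / (1 - t ^+ 2)); last first.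
    by rewrite -[in RHS]ss; field; rewrite gt_eqF.
  rewrite /drift; move: (ediff k t) e0 => e e0.
  have p : 1 + t != 0 by rewrite gt_eqF//; lra.
  have m : 1 - t != 0 by rewrite gt_eqF//; lra.
  by rewrite tE; field; rewrite p m !gt_eqF.
move=> t /andP[/ltW rt /ltW ts]; have t01 := in01 _ rt ts; have [t0 t1] := andP t01.
have tE : 1 - t ^+ 2 = (1 + t) * (1 - t) by ring.
have tt0 : 0 < 1 - t ^+ 2 by rewrite tE mulr_gt0; lra.
apply: divr_ge0; last exact: ltW.
rewrite -(pmulr_rge0 _ t0).
rewrite (_ : t * _ = t * drift k t + 2 * t ^+ 2 - 1); last by field; rewrite gt_eqF.
rewrite drift_zcoth//; set z := _ / _.
have z0 : 0 < z by rewrite divr_gt0// mulr_gt0.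
have := zcoth_quad z0; have := zcoth_ge0 z0; move: (zcoth z) => c c0 q.
(* Completing the square in t after multiplying by the leading coefficient c + 2. The remainder is
   the expression in [zcoth_quad]. *)
rewrite -(pmulr_rge0 _ (_ : 0 < c + 2)); last by lra.
rewrite (_ : (c + 2) * _ = ((c + 2) * t - z) ^+ 2 + (c ^+ 2 + c - 2 - z ^+ 2)).
  by rewrite addr_ge0// sqr_ge0.
by ring.
Qed.

End kernel.

(** * Power series minorants of artanh and of the entropy *)

Section power_series.
Variable R : realType.
Implicit Types (r s t x : R).

Definition artanh_sum n t : R := \sum_(i < n) t ^+ i / i.*2.+1%:R.

Definition ent_sum n t : R := \sum_(i < n) t ^+ i / (i.*2.+1 * i.*2.+2)%:R.

Lemma sum_even_odd n r :
  r * artanh_sum n (r ^+ 2) = \sum_(i < n) r ^+ i.*2.+1 / i.*2.+1%:R.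
Proof.
rewrite /artanh_sum mulr_sumr; apply: eq_bigr => i _.
by rewrite -exprM mul2n exprS mulrA.
Qed.

Lemma has_derive_artanh_sum n r :
  has_derive (fun r => r * artanh_sum n (r ^+ 2)) r (\sum_(i < n) (r ^+ 2) ^+ i).
Proof.
elim: n => [|n IH].
  rewrite big_ord0 (_ : (fun _ => _) = fun=> 0); first exact: has_derive_cst.
  by apply/funext => u; rewrite /artanh_sum big_ord0 mulr0.
rewrite (_ : (fun _ => _) = fun r => r * artanh_sum n (r ^+ 2) +
   n.*2.+1%:R^-1 * r ^+ n.*2.+1); last first.
  by apply/funext => u; rewrite !sum_even_odd big_ord_recr /= [_^-1 * _]mulrC.
apply: has_derive_congr; first by apply: has_derive_D; [exact: IH|repeat derive_rule].
by rewrite big_ord_recr /= mul0r add0r mulr1 mulKf ?pnatr_eq0// -exprM mul2n.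
Qed.

Lemma has_derive_ent_sum n r :
  has_derive (fun r => r ^+ 2 * ent_sum n (r ^+ 2)) r (r * artanh_sum n (r ^+ 2)).
Proof.
elim: n => [|n IH].
  rewrite /artanh_sum big_ord0 mulr0 (_ : (fun _ => _) = fun=> 0); first exact: has_derive_cst.
  by apply/funext => u; rewrite /ent_sum big_ord0 mulr0.
rewrite (_ : (fun _ => _) = fun r => r ^+ 2 * ent_sum n (r ^+ 2) +
   (n.*2.+1 * n.*2.+2)%:R^-1 * r ^+ n.*2.+2); last first.
  apply/funext => u; rewrite /ent_sum big_ord_recr /= mulrDr; congr (_ + _).
  by rewrite mulrA -exprM mul2n -exprD add2n mulrC.
apply: has_derive_congr; first by apply: has_derive_D; [exact: IH|repeat derive_rule].
rewrite !sum_even_odd big_ord_recr /= mul0r add0r mulr1 natrM invfM; congr (_ + _).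
by rewrite -mulrA mulKf ?pnatr_eq0// mulrC.
Qed.

Lemma artanh_sum_le n r : 0 <= r < 1 -> r * artanh_sum n (r ^+ 2) <= artanh r.
Proof.
move=> /andP[r0 r1]; rewrite -subr_ge0.
rewrite [leLHS](_ : 0 = artanh 0 - 0 * artanh_sum n (0 ^+ 2)); last first.
  by rewrite artanh0 mul0r subrr.
apply: (@derive_ge0_le _ (fun r => artanh r - r * artanh_sum n (r ^+ 2))
  (fun r => (1 - r ^+ 2)^-1 - \sum_(i < n) (r ^+ 2) ^+ i) _ _ r0).
  move=> t /andP[t0 tr]; apply: has_derive_B; last exact: has_derive_artanh_sum.
  by apply: has_derive_artanh; lra.
move=> t /andP[t0 tr]; have t1 : t ^+ 2 < 1 by rewrite expr_lt1//; lra.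
rewrite subr_ge0 -[leRHS]mul1r ler_pdivlMr ?subr_gt0//.
by rewrite -[1 - _]opprB mulrN mulrC -subrX1 opprB lerBlDr lerDl exprn_ge0// sqr_ge0.
Qed.

Lemma ent_sum_le n r : 0 <= r < 1 -> r ^+ 2 * ent_sum n (r ^+ 2) <= ent r.
Proof.
move=> /andP[r0 r1]; rewrite -subr_ge0.
rewrite [leLHS](_ : 0 = ent 0 - 0 ^+ 2 * ent_sum n (0 ^+ 2)); last first.
  by rewrite ent0 expr0n mul0r subrr.
apply: (@derive_ge0_le _ (fun r => ent r - r ^+ 2 * ent_sum n (r ^+ 2))
  (fun r => artanh r - r * artanh_sum n (r ^+ 2)) _ _ r0).
  move=> t /andP[t0 tr]; apply: has_derive_B; last exact: has_derive_ent_sum.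
  by apply: has_derive_ent; lra.
by move=> t /andP[t0 tr]; rewrite subr_ge0 artanh_sum_le//; lra.
Qed.

Lemma artanh_sum_homo n s t : 0 <= s -> s <= t -> artanh_sum n s <= artanh_sum n t.
Proof.
move=> s0 st; apply: ler_sum => i _; rewrite ler_pM2r ?invr_gt0 ?ltr0n//.
by apply: lerXn2r; rewrite ?nnegrE// (le_trans s0).
Qed.

Lemma ent_sum_homo n s t : 0 <= s -> s <= t -> ent_sum n s <= ent_sum n t.
Proof.
move=> s0 st; apply: ler_sum => i _; rewrite ler_pM2r ?invr_gt0 ?ltr0n//.
by apply: lerXn2r; rewrite ?nnegrE// (le_trans s0).
Qed.

Lemma ent_sum_ge0 n t : 0 <= t -> 0 <= ent_sum n t.
Proof. by move=> t0; apply: sumr_ge0 => i _; rewrite divr_ge0 ?exprn_ge0. Qed.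

End power_series.

(** * Concavity in y and reduction to two values of y *)

Section endpoint_reduction.
Variable R : realType.
Implicit Types (s t u w x y : R).

Lemma cosh_ge u : 0 <= u -> u ^+ 2 <= expR u + expR (- u) - 2.
Proof.
move=> u0; have c2 x : 0 <= expR x + expR (- x) - 2 :> R.
  rewrite expRN (_ : _ - _ = (expR x - 1) ^+ 2 / expR x).
    by rewrite divr_ge0 ?sqr_ge0// expR_ge0.
  by field; rewrite gt_eqF// expR_gt0.
have c1 : forall x, 0 <= x -> 2 * x <= expR x - expR (- x) :> R.
  apply: (@derive_le_le _ _ _ (fun=> 2) (fun x => expR x + expR (- x))).
  - by rewrite mulr0 oppr0 subrr.
  - by move=> x _; derive_fun; ring.
  - by move=> x _; derive_fun; ring.
  - by move=> x _; have := c2 x; lra.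
move: u u0; apply: (@derive_le_le _ _ _ (fun x => 2 * x) (fun x => expR x - expR (- x))).
- by rewrite oppr0 expR0 expr0n /=; ring.
- by move=> x _; derive_fun; ring.
- by move=> x _; derive_fun; ring.
- exact: c1.
Qed.

(** With u = w t, the derivative is nonpositive exactly when u^2 exp u <= (exp u - 1)^2, which is
    [cosh_ge]. *)
Lemma planck_homo w s t : 0 < w -> 0 < s -> s <= t ->
  t^-1 - w / (expR (w * t) - 1) <= s^-1 - w / (expR (w * s) - 1).
Proof.
move=> w0 s0 st.
rewrite -lerN2; apply: (@derive_ge0_le _ (fun t => - (t^-1 - w / (expR (w * t) - 1)))
  (fun t => - (- 1 / t ^+ 2 - w * (- (expR (w * t) * w) / (expR (w * t) - 1) ^+ 2))) _ _ st).
  move=> t' /andP[st' _]; have t0 := lt_le_trans s0 st'.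
  have e1 : expR (w * t') - 1 != 0.
    by rewrite gt_eqF// subr_gt0 -[ltLHS]expR0 ltr_expR mulr_gt0.
  apply: has_derive_congr.
    apply: has_derive_N; apply: has_derive_B; last by repeat derive_rule.
    by apply: (has_derive_V (has_derive_id t')); rewrite gt_eqF.
  by rewrite /=; field; rewrite e1 gt_eqF.
move=> t' /andP[/ltW st' _]; have t0 := lt_le_trans s0 st'.
have u0 : 0 <= w * t' by rewrite mulr_ge0// ltW.
have := cosh_ge u0; rewrite expRN.
have : 1 < expR (w * t') by rewrite -[ltLHS]expR0 ltr_expR mulr_gt0.
move: (expR _) => e e1; have e0 := lt_trans ltr01 e1; rewrite -subr_ge0 => H.
have em : 0 < e - 1 by rewrite subr_gt0.
rewrite [leRHS](_ : _ = (e + e^-1 - 2 - (w * t') ^+ 2) * e / (t' * (e - 1)) ^+ 2); last first.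
  by field; rewrite !gt_eqF.
by rewrite divr_ge0 ?sqr_ge0// mulr_ge0// ltW.
Qed.

Lemma linear_logderiv_homo (l0 l1 : R) s t : s <= t -> 0 < l0 + l1 * s -> 0 < l0 + l1 * t ->
  l1 / (l0 + l1 * t) <= l1 / (l0 + l1 * s).
Proof.
move=> st ps pt; rewrite ler_pdivrMr// mulrAC ler_pdivlMr// -subr_ge0.
rewrite (_ : _ - _ = l1 ^+ 2 * (t - s)); last by ring.
by rewrite mulr_ge0 ?sqr_ge0// subr_ge0.
Qed.

(* The logarithm of right side over left side is concave in [x]. *)
Lemma endpoints_suffice (l0 l1 m0 m1 J A C p q a b x : R) :
  0 < a -> a <= x <= b -> 0 < A -> 0 < C -> 0 < p + q ->
  0 < l0 + l1 * a -> 0 < l0 + l1 * b -> 0 < m0 + m1 * a -> 0 < m0 + m1 * b ->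
  let lhs x := expR (p * x) - expR (- (q * x)) in
  let rhs x := (l0 + l1 * x) * (m0 + m1 * x) ^+ 2 * expR ((l0 + l1 * x) * J) * A *
    (C * x) in
  lhs a <= rhs a -> lhs b <= rhs b -> lhs x <= rhs x.
Proof.
move=> a0 /andP[ax xb] A0 C0 w0 la lb ma mb lhs rhs ra rb.
have ab := le_trans ax xb.
have lin (c0 c1 t : R) : 0 < c0 + c1 * a -> 0 < c0 + c1 * b -> a <= t -> t <= b ->
    0 < c0 + c1 * t.
  move=> ca cb at_ tb; have [c1p|c1n] := leP 0 c1.
    by apply: (lt_le_trans ca); rewrite lerD2l ler_wpM2l.
  by apply: (lt_le_trans cb); rewrite lerD2l ler_wnM2l// ltW.
have lhs0 t : 0 < t -> 0 < lhs t.
  by move=> t0; rewrite subr_gt0 ltr_expR -subr_gt0 opprK -mulrDl mulr_gt0.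
have rhs0 t : a <= t -> t <= b -> 0 < rhs t.
  move=> at_ tb; have t0 := lt_le_trans a0 at_.
  rewrite mulr_gt0 ?(mulr_gt0 C0)// mulr_gt0// mulr_gt0 ?expR_gt0// mulr_gt0 ?exprn_gt0//.
    exact: lin.
  exact: lin.
have x0 := lt_le_trans a0 ax; have b0 := lt_le_trans a0 ab.
pose f t := ln (l0 + l1 * t) + 2 * ln (m0 + m1 * t) + (l0 + l1 * t) * J + ln t
  - ln (lhs t) + (ln A + ln C).
have fE t : a <= t -> t <= b -> (lhs t <= rhs t) = (0 <= f t).
  move=> at_ tb; have t0 := lt_le_trans a0 at_.
  have lt0 := lin l0 l1 t la lb at_ tb; have mt0 := lin m0 m1 t ma mb at_ tb.
  rewrite -ler_ln ?posrE ?lhs0 ?rhs0// /f -subr_ge0 /rhs.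
  move: (l0 + l1 * t) (m0 + m1 * t) (lhs t) lt0 mt0 => l m h lt0 mt0.
  rewrite lnM ?posrE ?mulr_gt0 ?expR_gt0 ?exprn_gt0//.
  rewrite lnM ?posrE ?mulr_gt0 ?expR_gt0 ?exprn_gt0//.
  rewrite lnM ?posrE ?mulr_gt0 ?expR_gt0 ?exprn_gt0//.
  rewrite lnM ?posrE ?mulr_gt0 ?expR_gt0 ?exprn_gt0//.
  rewrite lnM ?posrE ?mulr_gt0 ?expR_gt0 ?exprn_gt0//.
  by rewrite expRK lnXn// -[ln m *+ 2]mulr_natl; congr (_ <= _); ring.
(* Writing lhs t = exp (p t) (1 - exp (- (p + q) t)), the logarithmic derivative of [lhs] is p + (p
   + q) / (exp ((p + q) t) - 1). Paired with 1 / t from ln t it forms the decreasing function of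
   [planck_homo]. *)
rewrite fE//; apply: (@nonneg_of_derive2_le0 _ f (fun t => l1 / (l0 + l1 * t) +
  2 * (m1 / (m0 + m1 * t)) + l1 * J - p +
  (t^-1 - (p + q) / (expR ((p + q) * t) - 1))) a b); first by rewrite ax.
- move=> t /andP[at_ tb]; have t0 := lt_le_trans a0 at_.
  have lt0 := lin l0 l1 t la lb at_ tb; have mt0 := lin m0 m1 t ma mb at_ tb.
  have h0 := lhs0 t t0.
  have dh : has_derive lhs t (p * expR (p * t) + q * expR (- (q * t))).
    by rewrite /lhs; derive_fun; ring.
  rewrite /f; apply: has_derive_congr.
    apply: has_derive_D; last exact: has_derive_cst.
    apply: has_derive_B; last exact: has_derive_ln dh h0.
    apply: has_derive_D; last exact: (has_derive_ln (has_derive_id t) t0).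
    apply: has_derive_D; last by repeat derive_rule.
    apply: has_derive_D; first by repeat derive_rule; exact: lt0.
    by repeat derive_rule; exact: mt0.
  rewrite /= /lhs in h0 *.
  have qE : expR (- (q * t)) = expR (p * t) / expR ((p + q) * t).
    by rewrite -expRN -expRD; congr expR; ring.
  rewrite qE in h0 *.
  have e1 : 1 < expR ((p + q) * t) by rewrite -[ltLHS]expR0 ltr_expR mulr_gt0.
  move: (expR (p * t)) (expR_gt0 (p * t)) (expR ((p + q) * t)) e1 h0 => u u0 v v1 h0.
  have v0 := lt_trans ltr01 v1.
  have v10 : 0 < v - 1 by rewrite subr_gt0.
  field; rewrite (_ : u * v - u = u * (v - 1)); last by ring.
  by rewrite !gt_eqF ?mulr_gt0.
- move=> s t as_ st tb; have s0 := lt_le_trans a0 as_.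
  have sb := le_trans st tb; have at_ := le_trans as_ st.
  apply: lerD; last exact: planck_homo.
  apply: lerB; last exact: lexx.
  apply: lerD; last exact: lexx.
  apply: lerD; last rewrite ler_pM2l//; apply: linear_logderiv_homo => //.
  - exact: lin.
  - exact: lin.
  - exact: lin.
  - exact: lin.
- by rewrite -fE.
- by rewrite -fE.
Qed.

End endpoint_reduction.

(** * Interval arithmetic *)

Section fixed_point.
Variable R : realType.
Implicit Types (x y : R) (a b c d n : Z).

(* Binary recursion, so that no conversion ever expands a numeral in unary. *)
Fixpoint posr (p : positive) : R :=
  match p with
  | xH => 1
  | xO p => 2 * posr p
  | xI p => 2 * posr p + 1
  end.

Definition zr a : R :=
  match a with Z0 => 0 | Zpos p => posr p | Zneg p => - posr p end.

Lemma posr_nat p : posr p = (Pos.to_nat p)%:R.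
Proof.
elim: p => [p IH|p IH|//] /=.
  have -> : Pos.to_nat p~1 = (2 * Pos.to_nat p + 1)%nat by lia.
  by rewrite IH natrD natrM.
have -> : Pos.to_nat p~0 = (2 * Pos.to_nat p)%nat by lia.
by rewrite IH natrM.
Qed.

Lemma zrE a : zr a = (int_of_Z a)%:~R.
Proof.
case: a => [//|p|p] /=; first by rewrite posr_nat.
rewrite posr_nat NegzE prednK//; last by have := Pos2Nat.is_pos p; lia.
by rewrite rmorphN.
Qed.

Lemma zrD a b : zr (a + b)%Z = zr a + zr b.
Proof. by rewrite !zrE (rmorphD int_of_Z) intrD. Qed.

Lemma zrN a : zr (- a)%Z = - zr a.
Proof. by rewrite !zrE (rmorphN int_of_Z) rmorphN. Qed.

Lemma zrB a b : zr (a - b)%Z = zr a - zr b.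
Proof. by rewrite -Z.add_opp_r zrD zrN. Qed.

Lemma zrM a b : zr (a * b)%Z = zr a * zr b.
Proof. by rewrite !zrE (rmorphM int_of_Z) intrM. Qed.

Lemma zr_ge0 a : (0 <= a)%Z -> 0 <= zr a.
Proof. by case: a => [//|p _|p]; [rewrite zrE ler0z|lia]. Qed.

Lemma zr_le a b : (a <= b)%Z -> zr a <= zr b.
Proof. by move=> ab; rewrite -subr_ge0 -zrB zr_ge0//; lia. Qed.

Lemma zr_gt0 a : (0 < a)%Z -> 0 < zr a.
Proof.
move=> a0; apply: (@lt_le_trans _ _ (zr 1)); first by rewrite /= ltr01.
by apply: zr_le; lia.
Qed.

Lemma zr_lt a b : (a < b)%Z -> zr a < zr b.
Proof. by move=> ab; rewrite -subr_gt0 -zrB zr_gt0//; lia. Qed.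

Definition one : Z := (2 ^ 40)%Z.

Lemma one_gt0 : 0 < zr one. Proof. exact: zr_gt0. Qed.

(* [a : Z] stands for the dyadic number [a / 2 ^ 40]. *)
Definition fx a : R := zr a / zr one.

Lemma fx_le a b : (a <= b)%Z -> fx a <= fx b.
Proof. by move=> ab; rewrite /fx ler_pM2r ?zr_le// invr_gt0 one_gt0. Qed.

Lemma fx_lt a b : (a < b)%Z -> fx a < fx b.
Proof. by move=> ab; rewrite /fx ltr_pM2r ?zr_lt// invr_gt0 one_gt0. Qed.

Lemma fx0 : fx 0 = 0. Proof. by rewrite /fx mul0r. Qed.

Lemma fx_one : fx one = 1. Proof. by rewrite /fx divff// gt_eqF// one_gt0. Qed.

Lemma fxD a b : fx (a + b) = fx a + fx b.
Proof. by rewrite /fx zrD mulrDl. Qed.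

Lemma fxN a : fx (- a) = - fx a.
Proof. by rewrite /fx zrN mulNr. Qed.

Lemma fxZ n : fx (n * one) = zr n.
Proof. by rewrite /fx zrM mulfK// gt_eqF// one_gt0. Qed.

(** [Z.shiftr] rounds towards minus infinity, also for negative numbers, so this is safe for lower
    ends. Conjugation by the sign gives [shru] for upper ends. *)
Definition shr a : Z := Z.shiftr a 40.

Lemma fx_shr a : fx (shr a) <= zr a / zr one ^+ 2.
Proof.
rewrite expr2 invfM mulrA /fx ler_pM2r ?invr_gt0 ?one_gt0//.
rewrite ler_pdivlMr ?one_gt0// -zrM; apply: zr_le.
by rewrite /shr Z.shiftr_div_pow2// Z.mul_comm; apply: Z.mul_div_le.
Qed.

Definition shru a : Z := (- shr (- a))%Z.

Lemma fx_shru a : zr a / zr one ^+ 2 <= fx (shru a).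
Proof.
by rewrite /shru fxN lerNr -mulNr -zrN; exact: fx_shr.
Qed.

Lemma fxM a b : fx a * fx b = zr (a * b) / zr one ^+ 2.
Proof. by rewrite /fx mulf_div -zrM -expr2. Qed.

End fixed_point.

(* Intervals with dyadic endpoints; [None] is the whole line. *)
Definition ivl : Type := option (Z * Z).

Definition icst (n : Z) : ivl := Some (n * one, n * one)%Z.

Definition iadd (I J : ivl) : ivl :=
  match I, J with
  | Some (a, b), Some (c, d) => Some (a + c, b + d)%Z
  | _, _ => None
  end.

Definition iopp (I : ivl) : ivl :=
  match I with Some (a, b) => Some (- b, - a)%Z | None => None end.

(** Restricted to nonnegative lower ends, which avoids a case analysis on signs. Other inputs give
    [None], on which [ilt] is false. *)
Definition imul (I J : ivl) : ivl :=
  match I, J with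
  | Some (a, b), Some (c, d) =>
    if ((0 <=? a) && (0 <=? c))%Z then Some (shr (a * c), shru (b * d)) else None
  | _, _ => None
  end.

(** Integer division rounds down; the added 1 makes the upper end safe. *)
Definition iinv (I : ivl) : ivl :=
  match I with
  | Some (a, b) =>
    if (0 <? a)%Z then Some (one * one / b, one * one / a + 1)%Z else None
  | None => None
  end.

Definition idivz (I : ivl) (c : Z) : ivl :=
  match I with
  | Some (a, b) => if (0 <? c)%Z then Some (a / c, - (- b / c))%Z else None
  | None => None
  end.

Definition isqrt (I : ivl) : ivl :=
  match I with
  | Some (a, b) =>
    if (0 <=? a)%Z then Some (Z.sqrt (a * one), Z.sqrt (b * one) + 1)%Z else None
  | None => None
  end.

(** The first component encloses the sum of x^i / c i over i < n, the second encloses x^n and serves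
    the remainder terms. *)
Fixpoint iseries (c : nat -> Z) (n : nat) (I : ivl) : ivl * ivl :=
  match n with
  | O => (icst 0, icst 1)
  | n'.+1 => let: (u, w) := iseries c n' I in (iadd u (idivz w (c n')), imul w I)
  end.

Definition ilt (I J : ivl) : bool :=
  match I, J with Some (_, b), Some (c, _) => (b <? c)%Z | _, _ => false end.

Definition ile1 (I : ivl) : bool :=
  match I with Some (a, b) => ((0 <=? a) && (b <=? one))%Z | None => false end.

Fixpoint zfact (n : nat) : Z :=
  match n with O => 1%Z | n'.+1 => (Z.of_nat n * zfact n')%Z end.

(** For a number known to lie above some element of [I] and below some element of [J]. *)
Definition ihull (I J : ivl) : ivl :=
  match I, J with Some (a, _), Some (_, b) => Some (a, b) | _, _ => None end.

(* On [0, 1] the Taylor remainder of [exp] of order [m] is below [4 x ^ m / m!]. *)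
Definition iexp01 (m : nat) (I : ivl) : ivl :=
  if ile1 I then
    let p := iseries zfact m I in
    ihull p.1 (iadd p.1 (idivz (imul (icst 4) p.2) (zfact m)))
  else None.

Definition isqr (I : ivl) : ivl := imul I I.

(** Argument reduction exp x = (exp (x / 64))^64 by six squarings; the result is informative only
    for arguments in [0, 64]. *)
Definition iexp (I : ivl) : ivl :=
  isqr (isqr (isqr (isqr (isqr (isqr (iexp01 13 (idivz I 64))))))).

Section interval_arithmetic.
Variable R : realType.
Implicit Types (x y : R) (I J : ivl) (a b c d n : Z).

Definition encl I x : Prop :=
  match I with Some (a, b) => fx R a <= x /\ x <= fx R b | None => True end.

Lemma encl_cst n : encl (icst n) (zr R n).
Proof. by split; rewrite fxZ. Qed.

Lemma encl_add I J x y : encl I x -> encl J y -> encl (iadd I J) (x + y).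
Proof.
case: I J => [[a b]|] [[c d]|] //= [ax xb] [cy yd].
by split; rewrite fxD lerD.
Qed.

Lemma encl_opp I x : encl I x -> encl (iopp I) (- x).
Proof. by case: I => [[a b]|] //= [ax xb]; split; rewrite fxN lerN2. Qed.

Lemma fx_ge0 a : (0 <=? a)%Z -> 0 <= fx R a.
Proof. by move=> a0; rewrite -(fx0 R); apply: fx_le; apply/Z.leb_le. Qed.

Lemma fx_gt0 a : (0 <? a)%Z -> 0 < fx R a.
Proof. by move=> a0; rewrite -(fx0 R); apply: fx_lt; apply/Z.ltb_lt. Qed.

Lemma encl_mul I J x y : encl I x -> encl J y -> encl (imul I J) (x * y).
Proof.
case: I J => [[a b]|] [[c d]|] //= [ax xb] [cy yd]; case: ifP => // /andP[a0 c0].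
have {}a0 := fx_ge0 a0; have {}c0 := fx_ge0 c0.
split.
  by apply: (le_trans (fx_shr _ _)); rewrite -fxM ler_pM.
apply: le_trans (fx_shru _ _); rewrite -fxM ler_pM//.
  exact: le_trans ax.
exact: le_trans cy.
Qed.

Lemma encl_inv I x : encl I x -> encl (iinv I) x^-1.
Proof.
case: I => [[a b]|] //= [ax xb]; case: ifP => // a0.
have fa := fx_gt0 a0; have x0 := lt_le_trans fa ax; have fb := lt_le_trans x0 xb.
have b0 : (0 < b)%Z.
  apply/Z.nle_gt => b0; have := fx_le R b0; rewrite fx0; move: fb.
  by rewrite ltNge => /negP.
have fxV c : 0 < zr R c -> (fx R c)^-1 = zr R (one * one) / zr R c / zr R one.
  move=> c0; have o0 := one_gt0 R; rewrite /fx zrM invf_div.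
  by field; rewrite !gt_eqF.
have zb : 0 < zr R b by apply: zr_gt0.
have za : 0 < zr R a by apply: zr_gt0; apply/Z.ltb_lt.
split.
  apply: (@le_trans _ _ (fx R b)^-1); last by rewrite lef_pV2 ?posrE.
  rewrite fxV// /fx ler_pM2r ?invr_gt0 ?one_gt0// ler_pdivlMr// -zrM.
  by apply: zr_le; rewrite Z.mul_comm; apply: Z.mul_div_le.
apply: (@le_trans _ _ (fx R a)^-1); first by rewrite lef_pV2 ?posrE.
rewrite fxV// /fx ler_pM2r ?invr_gt0 ?one_gt0// ler_pdivrMr// -zrM.
apply: zr_le; apply: Z.lt_le_incl; rewrite Z.mul_comm.
by apply: Z.mul_succ_div_gt; apply/Z.ltb_lt.
Qed.

Lemma encl_divz I x c : encl I x -> encl (idivz I c) (x / zr R c).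
Proof.
have h a : (0 < c)%Z -> fx R (a / c) <= fx R a / zr R c.
  move=> c0; have zc : 0 < zr R c := zr_gt0 R c0.
  rewrite ler_pdivlMr// /fx mulrAC ler_pM2r ?invr_gt0 ?one_gt0// -zrM.
  by apply: zr_le; rewrite Z.mul_comm; apply: Z.mul_div_le.
case: I => [[a b]|] //= [ax xb]; case: ifP => // /Z.ltb_lt c0.
have zc : 0 < zr R c := zr_gt0 R c0.
split; first by apply: (le_trans (h _ c0)); rewrite ler_pM2r ?invr_gt0.
rewrite fxN lerNr; apply: (le_trans (h _ c0)).
by rewrite fxN mulNr lerN2 ler_pM2r ?invr_gt0.
Qed.

Lemma encl_sqrt I x : encl I x -> encl (isqrt I) (Num.sqrt x).
Proof.
case: I => [[a b]|] //= [ax xb]; case: ifP => // a0.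
have fa := fx_ge0 a0; have x0 := le_trans fa ax.
have o0 := one_gt0 R.
have sq c : fx R c = zr R (c * one) / zr R one ^+ 2.
  by rewrite zrM expr2 invfM mulrA mulfK// gt_eqF.
have sz c : 0 <= zr R c -> Num.sqrt (zr R (c * c) / zr R one ^+ 2) = fx R c.
  move=> c0; rewrite zrM -expr2 -expr_div_n sqrtr_sqr ger0_norm//.
  by rewrite divr_ge0// ltW.
have b0 : (0 <= b)%Z.
  apply/Z.nlt_ge => b0; have := fx_lt R b0; rewrite fx0 => /lt_geF.
  by rewrite (le_trans x0 xb).
split.
  rewrite -sz; last by apply: zr_ge0; exact: Z.sqrt_nonneg.
  apply: ler_wsqrtr; apply: le_trans ax; rewrite sq.
  rewrite ler_pM2r ?invr_gt0 ?exprn_gt0//; apply: zr_le.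
  by apply: (proj1 (Z.sqrt_spec _ _)); apply: Z.mul_nonneg_nonneg => //; apply/Z.leb_le.
rewrite -sz; last first.
  by apply: zr_ge0; have := Z.sqrt_nonneg (b * one); lia.
apply: ler_wsqrtr; apply: (le_trans xb); rewrite sq.
rewrite ler_pM2r ?invr_gt0 ?exprn_gt0//; apply: zr_le.
have := proj2 (Z.sqrt_spec (b * one) _); rewrite -Z.add_1_r => H.
by apply: Z.lt_le_incl; apply: H; apply: Z.mul_nonneg_nonneg.
Qed.

Lemma encl_series (c : nat -> Z) m I x : encl I x ->
  encl (iseries c m I).1 (\sum_(i < m) x ^+ i / zr R (c i)) /\
  encl (iseries c m I).2 (x ^+ m).
Proof.
move=> xI; elim: m => [|m [IH1 IH2]] /=.
  rewrite big_ord0 expr0; split; last exact: (encl_cst 1).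
  exact: (encl_cst 0).
move: IH1 IH2; case: (iseries c m I) => u w /= IH1 IH2; split.
  by rewrite big_ord_recr /=; apply: encl_add => //; exact: encl_divz.
by rewrite exprSr; exact: encl_mul.
Qed.

Lemma ilt_sound I J x y : encl I x -> encl J y -> ilt I J -> x < y.
Proof.
case: I J => [[a b]|] [[c d]|] //= [_ xb] [cy _] /Z.ltb_lt bc.
by apply: (le_lt_trans xb); apply: lt_le_trans cy; exact: fx_lt.
Qed.

Lemma zfactE m : zr R (zfact m) = m`!%:R.
Proof.
elim: m => [//|m IH].
have -> : zfact m.+1 = Z.mul (Z.of_nat m.+1) (zfact m) by [].
rewrite zrM IH factS natrM; congr (_ * _).
by rewrite zrE -[Z.of_nat _]/(Z_of_int (Posz m.+1)) Z_of_intK.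
Qed.

Definition taylor_exp m (r x : R) : R :=
  \sum_(i < m) x ^+ i / i`!%:R + r * x ^+ m / m`!%:R.

Lemma has_derive_taylor_exp m r x :
  has_derive (taylor_exp m.+1 r) x (taylor_exp m r x).
Proof.
have f0 i : i.+1`!%:R != 0 :> R by rewrite pnatr_eq0 -lt0n fact_gt0.
have dterm i : has_derive (fun t => t ^+ i.+1 / i.+1`!%:R) x (x ^+ i / i`!%:R).
  apply: has_derive_congr; first by repeat derive_rule.
  rewrite /= mulr0 addr0 mulr1 factS natrM.
  by rewrite -mulf_div divff ?mul1r// pnatr_eq0.
have dsum : has_derive (fun t => \sum_(i < m.+1) t ^+ i / i`!%:R) x
    (\sum_(i < m) x ^+ i / i`!%:R).
  elim: (m) => [|j IH].
    rewrite big_ord0 (_ : (fun _ => _) = fun=> 1); first exact: has_derive_cst.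
    by apply/funext => t; rewrite big_ord_recl big_ord0 expr0 divr1 addr0.
  rewrite (_ : (fun _ => _) =
      fun t => \sum_(i < j.+1) t ^+ i / i`!%:R + t ^+ j.+1 / j.+1`!%:R); last first.
    by apply/funext => t; rewrite big_ord_recr.
  by rewrite big_ord_recr /=; apply: has_derive_D.
rewrite /taylor_exp; apply: has_derive_D => //.
rewrite (_ : (fun _ => _) = fun t => r * (t ^+ m.+1 / m.+1`!%:R)); last first.
  by apply/funext => t; rewrite mulrA.
apply: has_derive_congr; first by apply: has_derive_M; [exact: has_derive_cst|exact: dterm].
by rewrite mul0r add0r mulrA.
Qed.

Lemma taylor_exp0 m r : taylor_exp m.+1 r 0 = 1.
Proof.
rewrite /taylor_exp big_ord_recl expr0 divr1 big1 ?addr0; last first.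
  by move=> i _; rewrite expr0n mul0r.
by rewrite expr0n mulr0 mul0r addr0.
Qed.

(** Induction by integration from 0, since differentiating [taylor_exp] lowers the order by one. The
    base case is 1 <= exp x <= 4, from exp (1/2) <= 2. *)
Lemma expR_bounds m x : 0 <= x <= 1 ->
  taylor_exp m 1 x <= expR x <= taylor_exp m 4 x.
Proof.
elim: m x => [|m IH] x /andP[x0 x1].
  rewrite /taylor_exp !big_ord0 !add0r !expr0 !divr1 !mulr1.
  apply/andP; split; first by rewrite -expR0 ler_expR.
  apply: (@le_trans _ _ (expR 1)); first by rewrite ler_expR.
  have e2 : expR (2^-1) <= 2 :> R.
    rewrite -[leLHS]invrK -expRN -[leRHS]invrK.
    rewrite lef_pV2 ?posrE ?invr_gt0 ?expR_gt0//.
    by have := expR_ge1Dx (- 2^-1 : R); lra.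
  have -> : expR 1 = expR (2^-1) * expR (2^-1) :> R.
    by rewrite -expRD; congr expR; field.
  have -> : 4 = 2 * 2 :> R by rewrite -natrM.
  by rewrite ler_pM ?expR_ge0.
have dE t : has_derive (@expR R) t (expR t) := is_derive_expR t.
apply/andP; split; rewrite -subr_ge0.
  rewrite (_ : 0 = expR 0 - taylor_exp m.+1 1 0); last first.
    by rewrite taylor_exp0 expR0 subrr.
  apply: (derive_ge0_le (f := fun t => expR t - taylor_exp m.+1 1 t)
    (f' := fun t => expR t - taylor_exp m 1 t) x0).
    by move=> t _; apply: has_derive_B => //; exact: has_derive_taylor_exp.
  move=> t /andP[t0 tx]; rewrite subr_ge0.
  have t01 : 0 <= t <= 1 by lra.
  by have /andP[] := IH t t01.
rewrite (_ : 0 = taylor_exp m.+1 4 0 - expR 0); last first.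
  by rewrite taylor_exp0 expR0 subrr.
apply: (derive_ge0_le (f := fun t => taylor_exp m.+1 4 t - expR t)
  (f' := fun t => taylor_exp m 4 t - expR t) x0).
  by move=> t _; apply: has_derive_B => //; exact: has_derive_taylor_exp.
move=> t /andP[t0 tx]; rewrite subr_ge0.
have t01 : 0 <= t <= 1 by lra.
by have /andP[] := IH t t01.
Qed.

Lemma encl_hull I J x y z : encl I x -> x <= y -> encl J z -> y <= z ->
  encl (ihull I J) y.
Proof.
case: I J => [[a b]|] [[c d]|] //= [ax _] xy [_ zd] yz.
by split; [exact: le_trans xy|exact: le_trans zd].
Qed.

Lemma encl_exp01 m I x : encl I x -> encl (iexp01 m I) (expR x).
Proof.
move=> xI; rewrite /iexp01; case: ifP => // h.
have x01 : 0 <= x <= 1.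
  case: I xI h => [[a b]|] //= [ax xb] /andP[a0 /Z.leb_le b1].
  rewrite (le_trans (fx_ge0 a0) ax) (le_trans xb)//.
  by rewrite -[leRHS](fx_one R) fx_le.
have [hS hT] := encl_series zfact m xI.
have hU := encl_add hS (encl_divz (zfact m) (encl_mul (encl_cst 4) hT)).
have sE : \sum_(i < m) x ^+ i / zr R (zfact i) = \sum_(i < m) x ^+ i / i`!%:R.
  by apply: eq_bigr => i _; rewrite zfactE.
have z4 : zr R 4 = 4 by rewrite /= mulr1 -natrM.
rewrite sE z4 zfactE in hU; rewrite sE in hS.
have /andP[lo hi] := expR_bounds m x01.
apply: (encl_hull hS _ hU hi); apply: le_trans lo.
rewrite lerDl mul1r divr_ge0// exprn_ge0//.
by case/andP: x01.
Qed.

Lemma encl_exp I x : encl I x -> encl (iexp I) (expR x).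
Proof.
move=> xI; rewrite (_ : expR x = expR (x / zr R 64) ^+ 64).
  rewrite (_ : 64 = 2 * 2 * 2 * 2 * 2 * 2)%nat// !exprM !expr2 /iexp.
  by do 6! apply: encl_mul; exact/encl_exp01/encl_divz.
have -> : zr R 64 = 64%:R by rewrite zrE.
by rewrite -expRM_natl mulrC divfK.
Qed.

End interval_arithmetic.

(** * Certificate for moderate [k] *)

Definition idec (a : Z) : ivl := idivz (icst a) 100000.

Fixpoint zdfact (n : nat) : Z :=
  match n with O => 1%Z | n'.+1 => ((2 * Z.of_nat n' + 1) * zdfact n')%Z end.

Definition zodd (n : nat) : Z := (2 * Z.of_nat n + 1)%Z.

Definition zodd2 (n : nat) : Z := ((2 * Z.of_nat n + 1) * (2 * Z.of_nat n + 2))%Z.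

Definition isub (I J : ivl) : ivl := iadd I (iopp J).

Definition ione : ivl := icst 1.

Definition itwo : ivl := icst 2.

(* [ln 2 * 2 ^ 40], rounded outwards *)
Definition iln2 : ivl := Some (762123376640, 762123392000)%Z.

(* Enclosures of [mills_sum n], [mills_sum n.+1] and [mills]. *)
Definition imills (n : nat) (Y : ivl) : ivl * ivl * ivl :=
  let p := iseries (fun i => zdfact i.+1) n Y in
  (p.1, iadd p.1 (idivz p.2 (zdfact n.+1)),
   ihull p.1 (iadd p.1 (imul (idivz p.2 (zdfact n))
     (iinv (isub (icst (2 * Z.of_nat n + 1)) Y))))).

(** The inequality of [endpoints_suffice] at one end. The negative exponential is an inverse because
    [iexp] needs nonnegative arguments. *)
Definition cell_end (Y l m J A p q C : ivl) : bool :=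
  ilt (isub (iexp (imul p Y)) (iinv (iexp (imul q Y))))
    (imul (imul (imul (imul l (isqr m)) (iexp (imul l J))) A) (imul C Y)).

(* [lnratio >= 0] for [rho] in [[s0, s]], from the two ends of a range of [k ^ 2]:
   [la], [ma] and [lb], [mb] are lower bounds of [lam] and [mills] there. *)
Definition cell (Ya la ma Yb lb mb : ivl) (s0 s : Z) : bool :=
  let T := isqr (idec s0) in
  let A := (iseries zodd 30 T).1 in
  let J := imul T (iseries zodd2 30 T).1 in
  let S := idec s in
  let p := imul S (iinv (iadd ione S)) in
  let q := imul S (iinv (isub ione S)) in
  let C := imul (imul itwo S) (isqrt (isub ione (isqr S))) in
  [&& (0 <=? s0)%Z, (s0 <=? s)%Z, (0 <? s)%Z, (s <? 100000)%Z,
      ilt (icst 0) A, cell_end Ya la ma J A p q C & cell_end Yb lb mb J A p q C].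

Fixpoint cells (Ya la ma Yb lb mb : ivl) (s0 : Z) (nodes : seq Z) : bool :=
  if nodes is s :: nodes'
  then cell Ya la ma Yb lb mb s0 s && cells Ya la ma Yb lb mb s nodes'
  else true.

(* [r] is a lower bound of [- ln P] at [k ^ 2 = y0]. *)
Definition check_row (ya yb y0 r : Z) (nodes : seq Z) : bool :=
  let Ya := idec ya in let Yb := idec yb in let Y := idec y0 in
  let: (Sm, Sn, M) := imills 24 Y in
  let D := imul (isub (iadd ione (imul Y Sm)) Sn) (iinv (imul itwo Y)) in
  let d := iinv (imul (imul itwo Y) M) in
  let la := imul (iadd (idec r) (imul (isub Y Ya) d)) (iinv iln2) in
  let lb := imul (isub (idec r) (imul (isub Yb Y) d)) (iinv iln2) in
  let ma := isub Sn (imul D (isub Y Ya)) in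
  let mb := iadd Sn (imul D (isub Yb Y)) in
  [&& (0 <? ya)%Z, (0 <? y0)%Z, (y0 <? 4900000)%Z,
      [&& ilt (icst 0) la, ilt (icst 0) lb, ilt (icst 0) ma & ilt (icst 0) mb],
      ilt (imul (iexp (imul itwo (idec r))) (imul (imul itwo Y) (isqr M)))
          (imul (idivz (icst 333) 106) (iexp Y)) &
      cells Ya la ma Yb lb mb 0 nodes].

Section certificate.
Variable R : realType.
Implicit Types (x y k rho : R).

Definition dec (a : Z) : R := zr R a / zr R 100000.

Lemma encl_dec a : encl (idec a) (dec a).
Proof. by apply: encl_divz; exact: encl_cst. Qed.

Lemma encl_sub I J x y : encl I x -> encl J y -> encl (isub I J) (x - y).
Proof. by move=> Ix Jy; apply: encl_add => //; exact: encl_opp. Qed.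

Lemma zr_nat n : zr R (Z.of_nat n) = n%:R.
Proof. by rewrite zrE -[Z.of_nat _]/(Z_of_int (Posz n)) Z_of_intK. Qed.

Lemma encl_nat n : encl (icst (Z.of_nat n)) (n%:R : R).
Proof. by rewrite -zr_nat; exact: encl_cst. Qed.

Lemma encl_one : encl ione (1 : R). Proof. exact: (encl_nat 1). Qed.

Lemma encl_two : encl itwo (2 : R). Proof. exact: (encl_nat 2). Qed.

Lemma encl_sqr I x : encl I x -> encl (isqr I) (x ^+ 2).
Proof. by move=> xI; rewrite expr2; exact: encl_mul. Qed.

Lemma dec_le a b : (a <=? b)%Z -> dec a <= dec b.
Proof. by move=> /Z.leb_le ab; rewrite ler_pM2r ?invr_gt0 ?zr_gt0// zr_le. Qed.

Lemma dec_lt a b : (a <? b)%Z -> dec a < dec b.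
Proof. by move=> /Z.ltb_lt ab; rewrite ltr_pM2r ?invr_gt0 ?zr_gt0// zr_lt. Qed.

Lemma dec0 : dec 0 = 0. Proof. by rewrite /dec mul0r. Qed.

Lemma dec1 : dec 100000 = 1.
Proof. by rewrite /dec divff// gt_eqF// zr_gt0. Qed.

Lemma dec_nat n : dec (Z.of_nat n * 100000) = n%:R.
Proof. by rewrite /dec zrM mulfK ?zr_nat// gt_eqF// zr_gt0. Qed.

Lemma encl_ln2_of a b : ilt (iexp (Some (a, a))) itwo ->
  ilt itwo (iexp (Some (b, b))) -> encl (Some (a, b)) (ln 2 : R).
Proof.
have e c : encl (iexp (Some (c, c))) (expR (fx R c)) by exact: encl_exp.
move=> lo hi; have p2 : 2 \is @Num.pos R by rewrite posrE.
split; apply: ltW; rewrite -ltr_expR lnK//.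
  exact: (ilt_sound (e a) encl_two lo).
exact: (ilt_sound encl_two (e b) hi).
Qed.

Lemma encl_ln2 : encl iln2 (ln 2 : R).
Proof. by apply: encl_ln2_of; vm_compute. Qed.

Lemma zdfactE n : zr R (zdfact n) = (dfact n)%:R.
Proof.
elim: n => [//|n IH].
have -> : zdfact n.+1 = Z.mul (2 * Z.of_nat n + 1) (zdfact n) by [].
rewrite zrM IH dfactSR zrD zrM zr_nat; congr ((_ * _ + _) * _).
by rewrite (zr_nat 2).
Qed.

Lemma encl_mills n k Y : 0 < k -> k ^+ 2 < 2 * n%:R + 1 -> encl Y (k ^+ 2) ->
  [/\ encl (imills n Y).1.1 (mills_sum n (k ^+ 2)),
      encl (imills n Y).1.2 (mills_sum n.+1 (k ^+ 2)) &
      encl (imills n Y).2 (mills k)].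
Proof.
move=> k0 kn yY; rewrite /imills.
have [] := encl_series (fun i => zdfact i.+1) n yY.
move: (iseries _ n Y) => [S Yn]; rewrite [fst _]/= [snd _]/= => SS YY.
have SE : \sum_(i < n) (k ^+ 2) ^+ i / zr R (zdfact i.+1) = mills_sum n (k ^+ 2).
  by apply: eq_bigr => i _; rewrite zdfactE.
rewrite SE in SS; split=> //.
  by rewrite mills_sumS -zdfactE; apply: encl_add => //; exact: encl_divz.
apply: (encl_hull SS); [exact: mills_ge| |exact: (mills_le k0 kn)].
apply: encl_add => //; rewrite invfM mulrA -zdfactE.
apply: encl_mul; first exact: encl_divz.
apply: encl_inv; apply: encl_sub => //.
have -> : 2 * n%:R + 1 = zr R (2 * Z.of_nat n + 1).
  by rewrite zrD zrM zr_nat (zr_nat 2).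
exact: encl_cst.
Qed.

Lemma zoddE n : zr R (2 * Z.of_nat n + 1) = n.*2.+1%:R.
Proof. by rewrite zrD zrM zr_nat (zr_nat 2) -natrM mul2n -[zr R 1]/1 natr1. Qed.

Lemma encl_artanh_sum n T x : encl T x -> encl (iseries zodd n T).1 (artanh_sum n x).
Proof.
move=> xT; have [+ _] := encl_series zodd n xT.
rewrite (_ : \sum_(i < n) _ = artanh_sum n x)//; apply: eq_bigr => i _.
by rewrite zoddE.
Qed.

Lemma encl_ent_sum n T x : encl T x -> encl (iseries zodd2 n T).1 (ent_sum n x).
Proof.
move=> xT; have [+ _] := encl_series zodd2 n xT.
rewrite (_ : \sum_(i < n) _ = ent_sum n x)//; apply: eq_bigr => i _.
by rewrite zrM zoddE natrM zrD zrM zr_nat (zr_nat 2) -natrM -natrD mul2n addn2.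
Qed.

Lemma cell_end_sound Y l m J A p q C y' l' m' J' A' p' q' C' :
  encl Y y' -> encl l l' -> encl m m' -> encl J J' -> encl A A' ->
  encl p p' -> encl q q' -> encl C C' -> cell_end Y l m J A p q C ->
  expR (p' * y') - expR (- (q' * y')) <= l' * m' ^+ 2 * expR (l' * J') * A' * (C' * y').
Proof.
move=> Yy ll mm JJ AA pp qq CC h; apply: ltW; rewrite expRN.
apply: ilt_sound h.
  apply: encl_sub; first by apply: encl_exp; exact: encl_mul.
  by apply: encl_inv; apply: encl_exp; exact: encl_mul.
apply: encl_mul; last exact: encl_mul.
apply: encl_mul => //; apply: encl_mul; last by apply: encl_exp; exact: encl_mul.
by apply: encl_mul => //; exact: encl_sqr.
Qed.

Lemma encl_gt0 I x : encl I x -> ilt (icst 0) I -> 0 < x.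
Proof. by move=> xI; apply: ilt_sound => //; exact: (encl_nat 0). Qed.

(** All ingredients increase with rho: [kernel] is therefore taken at the right end [s], whereas the
    series minorants of artanh rho / rho and of [ent] are taken at the left end [s0]. *)
Lemma cell_sound k rho (l0 l1 m0 m1 a b : R) Ya la ma Yb lb mb s0 s :
  0 < k -> 0 < a -> a <= k ^+ 2 <= b ->
  encl Ya a -> encl la (l0 + l1 * a) -> encl ma (m0 + m1 * a) ->
  encl Yb b -> encl lb (l0 + l1 * b) -> encl mb (m0 + m1 * b) ->
  0 < l0 + l1 * a -> 0 < l0 + l1 * b -> 0 < m0 + m1 * a -> 0 < m0 + m1 * b ->
  0 < l0 + l1 * k ^+ 2 -> 0 < m0 + m1 * k ^+ 2 ->
  l0 + l1 * k ^+ 2 <= lam k -> m0 + m1 * k ^+ 2 <= mills k ->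
  cell Ya la ma Yb lb mb s0 s ->
  0 < rho -> dec s0 <= rho <= dec s -> 0 <= lnratio k rho.
Proof.
move=> k0 a0 yab Ea Ela Ema Eb Elb Emb la0 lb0 ma0 mb0 ly0 my0 lamy millsy.
case/and5P => c1 c2 c3 c4; set c567 := [&& _, _ & _] => c r0 /andP[s0r rs].
have s00 : 0 <= dec s0 by rewrite -dec0 dec_le.
have s1 : dec s < 1 by rewrite -dec1 dec_lt.
have s0' : 0 < dec s by rewrite -dec0 dec_lt.
have r1 : rho < 1 := le_lt_trans rs s1.
have r01 : 0 < rho < 1 by rewrite r0.
have y0 : 0 < k ^+ 2 by rewrite exprn_gt0.
have Es := encl_dec s; have Es0 := encl_dec s0.
have Ep : encl (imul (idec s) (iinv (iadd ione (idec s)))) (dec s / (1 + dec s)).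
  apply: encl_mul => //; apply: encl_inv; apply: encl_add => //; exact: encl_one.
have Eq : encl (imul (idec s) (iinv (isub ione (idec s)))) (dec s / (1 - dec s)).
  apply: encl_mul => //; apply: encl_inv; apply: encl_sub => //; exact: encl_one.
have sg : 0 < Num.sqrt (1 - dec s ^+ 2) by apply: sigma_gt0; lra.
have C0 : 0 < 2 * dec s * Num.sqrt (1 - dec s ^+ 2).
  by apply: mulr_gt0 => //; exact: mulr_gt0.
have w0 : 0 < dec s / (1 + dec s) + dec s / (1 - dec s).
  by apply: addr_gt0; apply: divr_gt0 => //; lra.
have EC : encl (imul (imul itwo (idec s)) (isqrt (isub ione (isqr (idec s)))))
    (2 * dec s * Num.sqrt (1 - dec s ^+ 2)).
  apply: encl_mul; first by apply: encl_mul => //; exact: encl_two.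
  apply: encl_sqrt; apply: encl_sub; first exact: encl_one.
  exact: encl_sqr.
have EA := encl_artanh_sum 30 (encl_sqr Es0).
have EJ := encl_mul (encl_sqr Es0) (encl_ent_sum 30 (encl_sqr Es0)).
move: c; rewrite /c567 => /and3P[cA ca cb].
have A0 := encl_gt0 EA cA.
have ha := cell_end_sound Ea Ela Ema EJ EA Ep Eq EC ca.
have hb := cell_end_sound Eb Elb Emb EJ EA Ep Eq EC cb.
have := endpoints_suffice a0 yab A0 C0 w0 la0 lb0 ma0 mb0 ha hb.
move=> {ha hb EJ EA cA ca cb}.
set l := l0 + _ in ly0 lamy *; set m := m0 + _ in my0 millsy *.
set A' := artanh_sum 30 _ in A0 *; set J' := _ * ent_sum 30 _.
set C' := 2 * _ * _ => H.
apply: lnratio_kernel => //; apply: (le_trans (kernel_le k0 r0 rs s1)).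
have JJ : J' <= ent rho.
  apply: le_trans (ent_sum_le 30 _); last by rewrite (ltW r0).
  have sq : dec s0 ^+ 2 <= rho ^+ 2 by apply: lerXn2r; rewrite ?nnegrE// ltW.
  by apply: ler_pM; rewrite ?sqr_ge0 ?ent_sum_ge0 ?sqr_ge0// ent_sum_homo// sqr_ge0.
have AA : A' <= artanh rho / rho.
  rewrite ler_pdivlMr// mulrC; apply: le_trans (artanh_sum_le 30 _); last by rewrite (ltW r0).
  rewrite ler_pM2l// artanh_sum_homo ?sqr_ge0//.
  by apply: lerXn2r; rewrite ?nnegrE// ltW.
have J0 : 0 <= J' by rewrite mulr_ge0 ?sqr_ge0// ent_sum_ge0 ?sqr_ge0.
apply: (@le_trans _ _ (l * m ^+ 2 * expR (l * J') * A')).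
  have -> : kernel (k ^+ 2) (dec s) =
     (expR (dec s / (1 + dec s) * k ^+ 2) - expR (- (dec s / (1 - dec s) * k ^+ 2))) /
     (C' * k ^+ 2).
    rewrite /kernel /C' [k ^+ 2 * (dec s / (1 + _))]mulrC [k ^+ 2 * (dec s / _)]mulrC.
    by congr (_ / _); ring.
  by rewrite ler_pdivrMr// mulr_gt0.
have mm : m ^+ 2 <= mills k ^+ 2.
  by apply: lerXn2r; rewrite ?nnegrE//; [exact: ltW|exact: ltW (mills_gt0 k0)].
have l'0 := ltW (lam_gt0 k0).
have ee : expR (l * J') <= expR (lam k * ent rho).
  by rewrite ler_expR; apply: ler_pM => //; exact: ltW.
have ml : l * m ^+ 2 <= lam k * mills k ^+ 2.
  by apply: ler_pM => //; [exact: ltW|exact: sqr_ge0].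
have lm0 : 0 <= l * m ^+ 2 by rewrite mulr_ge0 ?sqr_ge0// ltW.
apply: ler_pM => //; [by rewrite mulr_ge0// expR_ge0|exact: ltW|].
by apply: ler_pM => //; exact: expR_ge0.
Qed.

End certificate.

Section rows.
Variable R : realType.
Implicit Types (x k rho : R).
Local Notation dec := (dec R).

Lemma encl_congr I x x1 : encl I x -> x = x1 -> encl I x1.
Proof. by move=> + <-. Qed.

Lemma pi_gt_zr : zr R 333 / zr R 106 < pi.
Proof.
have /andP[+ _] := pi_bounds R.
by rewrite (zr_nat R 333) (zr_nat R 106).
Qed.

Lemma cells_sound (k rho l0 l1 m0 m1 a b : R) Ya la ma Yb lb mb nodes s0 :
  0 < k -> 0 < a -> a <= k ^+ 2 <= b ->
  encl Ya a -> encl la (l0 + l1 * a) -> encl ma (m0 + m1 * a) ->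
  encl Yb b -> encl lb (l0 + l1 * b) -> encl mb (m0 + m1 * b) ->
  0 < l0 + l1 * a -> 0 < l0 + l1 * b -> 0 < m0 + m1 * a -> 0 < m0 + m1 * b ->
  0 < l0 + l1 * k ^+ 2 -> 0 < m0 + m1 * k ^+ 2 ->
  l0 + l1 * k ^+ 2 <= lam k -> m0 + m1 * k ^+ 2 <= mills k ->
  cells Ya la ma Yb lb mb s0 nodes ->
  0 < rho -> dec s0 < rho -> rho <= dec (last s0 nodes) -> 0 <= lnratio k rho.
Proof.
move=> k0 a0 yab Ea Ela Ema Eb Elb Emb la0 lb0 ma0 mb0 ly0 my0 lamy millsy + r0.
elim: nodes s0 => [|s nodes IH] s0; first by move=> _ /lt_geF->.
move=> /andP[c cs] s0r rl; have [rs|sr] := leP rho (dec s); last exact: IH sr rl.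
apply: (cell_sound k0 a0 yab Ea Ela Ema Eb Elb Emb la0 lb0 ma0 mb0 ly0 my0 lamy
  millsy c r0).
by rewrite (ltW s0r).
Qed.

Lemma linear_between_gt0 (c0 c1 a b x : R) : a <= x <= b ->
  0 < c0 + c1 * a -> 0 < c0 + c1 * b -> 0 < c0 + c1 * x.
Proof.
move=> /andP[ax xb] ca cb; have [c1p|c1n] := leP 0 c1.
  by apply: (lt_le_trans ca); rewrite lerD2l ler_wpM2l.
by apply: (lt_le_trans cb); rewrite lerD2l ler_wnM2l// ltW.
Qed.

Lemma row_sound_mills n Sm Sn M ya yb y0 r nodes k rho :
  let Ya := idec ya in let Yb := idec yb in let Y := idec y0 in
  let D := imul (isub (iadd ione (imul Y Sm)) Sn) (iinv (imul itwo Y)) in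
  let d := iinv (imul (imul itwo Y) M) in
  let la := imul (iadd (idec r) (imul (isub Y Ya) d)) (iinv iln2) in
  let lb := imul (isub (idec r) (imul (isub Yb Y) d)) (iinv iln2) in
  let ma := isub Sn (imul D (isub Y Ya)) in
  let mb := iadd Sn (imul D (isub Yb Y)) in
  (0 <? ya)%Z -> (0 <? y0)%Z ->
  encl Sm (mills_sum n (dec y0)) -> encl Sn (mills_sum n.+1 (dec y0)) ->
  encl M (mills (Num.sqrt (dec y0))) ->
  [&& ilt (icst 0) la, ilt (icst 0) lb, ilt (icst 0) ma & ilt (icst 0) mb] ->
  ilt (imul (iexp (imul itwo (idec r))) (imul (imul itwo Y) (isqr M)))
      (imul (idivz (icst 333) 106) (iexp Y)) ->
  cells Ya la ma Yb lb mb 0 nodes ->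
  0 < k -> dec ya <= k ^+ 2 <= dec yb -> 0 < rho -> rho <= dec (last 0%Z nodes) ->
  0 <= lnratio k rho.
Proof.
move=> Ya Yb Y D d la lb ma mb ya0 y00 ESm ESn EM /and4P[cla clb cma cmb] cr cc.
move=> k0 yab r0 rl.
have y0p : 0 < dec y0 by rewrite -(dec0 R) dec_lt.
have yap : 0 < dec ya by rewrite -(dec0 R) dec_lt.
set k1 := Num.sqrt (dec y0) in EM.
have k1p : 0 < k1 by rewrite sqrtr_gt0.
have k1E : k1 ^+ 2 = dec y0 by rewrite sqr_sqrtr// ltW.
have m1p := mills_gt0 k1p.
have EY : encl Y (dec y0) := encl_dec R y0.
have EYa : encl Ya (dec ya) := encl_dec R ya.
have EYb : encl Yb (dec yb) := encl_dec R yb.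
have Er : encl (idec r) (dec r) := encl_dec R r.
pose D' := (1 + dec y0 * mills_sum n (dec y0) - mills_sum n.+1 (dec y0)) / (2 * dec y0).
pose d' := (2 * dec y0 * mills k1)^-1.
have El2 : encl (iinv iln2) (ln 2 : R)^-1 := encl_inv (encl_ln2 R).
have ED : encl D D'.
  exact: (encl_mul (encl_sub (encl_add (encl_one R) (encl_mul EY ESm)) ESn)
    (encl_inv (encl_mul (encl_two R) EY))).
have Ed : encl d d'.
  exact: (encl_inv (encl_mul (encl_mul (encl_two R) EY) EM)).
(* The line of [lnP_tangent] divided by ln 2, with the value at y0 lowered to the certified [r].
   [m0] and [D'] are the coefficients of the tangent of [mills_sum n.+1]. *)
pose l0 := (dec r + dec y0 * d') / ln 2; pose l1 := - (d' / ln 2).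
pose m0 := mills_sum n.+1 (dec y0) - D' * dec y0.
have Ela : encl la (l0 + l1 * dec ya).
  apply: (encl_congr (encl_mul (encl_add Er (encl_mul (encl_sub EY EYa) Ed)) El2)).
  by rewrite /l0 /l1; ring.
have Elb : encl lb (l0 + l1 * dec yb).
  apply: (encl_congr (encl_mul (encl_sub Er (encl_mul (encl_sub EYb EY) Ed)) El2)).
  by rewrite /l0 /l1; ring.
have Ema : encl ma (m0 + D' * dec ya).
  apply: (encl_congr (encl_sub ESn (encl_mul ED (encl_sub EY EYa)))).
  by rewrite /m0; ring.
have Emb : encl mb (m0 + D' * dec yb).
  apply: (encl_congr (encl_add ESn (encl_mul ED (encl_sub EYb EY)))).
  by rewrite /m0; ring.
have la0 := encl_gt0 Ela cla; have lb0 := encl_gt0 Elb clb.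
have ma0 := encl_gt0 Ema cma; have mb0 := encl_gt0 Emb cmb.
have ly := linear_between_gt0 yab la0 lb0.
have my := linear_between_gt0 yab ma0 mb0.
have y_ge0 : 0 <= k ^+ 2 by exact: sqr_ge0.
have mle : m0 + D' * k ^+ 2 <= mills k.
  apply: le_trans (mills_ge n.+1 k0).
  apply: le_trans (mills_sum_tangent n y0p y_ge0).
  by rewrite le_eqVlt; apply/orP; left; apply/eqP; rewrite /m0 /D'; ring.
have rle : dec r <= - ln (Pkappa k1).
  apply: (lnP_ge k1p (lexx _)); rewrite k1E.
  have E1 := encl_mul (encl_exp (encl_mul (encl_two R) Er))
    (encl_mul (encl_mul (encl_two R) EY) (encl_sqr EM)).
  have E2 := encl_mul (encl_divz 106 (encl_cst R 333)) (encl_exp EY).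
  have := ilt_sound E1 E2 cr => /ltW /le_trans; apply.
  apply: ler_wpM2r (ltW pi_gt_zr); exact: expR_ge0.
have lle : l0 + l1 * k ^+ 2 <= lam k.
  have l2 := ln2_gt0 R.
  rewrite -(ler_pM2r l2) lam_ln2.
  apply: le_trans (lnP_tangent k1p k0); rewrite k1E.
  apply: (@le_trans _ _ (dec r + (dec y0 - k ^+ 2) / (2 * dec y0 * mills k1))).
    rewrite le_eqVlt; apply/orP; left; apply/eqP; rewrite /l0 /l1 /d'.
    by move: (mills k1) m1p => m m1p; field; rewrite !gt_eqF.
  by rewrite lerD2r.
by apply: (cells_sound k0 yap yab EYa Ela Ema EYb Elb Emb la0 lb0 ma0 mb0 ly my lle mle
  cc r0) => //; rewrite dec0.
Qed.

Lemma row_sound ya yb y0 r nodes k rho : check_row ya yb y0 r nodes ->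
  0 < k -> dec ya <= k ^+ 2 <= dec yb -> 0 < rho -> rho <= dec (last 0%Z nodes) ->
  0 <= lnratio k rho.
Proof.
rewrite /check_row.
have H : (0 <? y0)%Z -> (y0 <? 4900000)%Z ->
  [/\ encl (imills 24 (idec y0)).1.1 (mills_sum 24 (dec y0)),
      encl (imills 24 (idec y0)).1.2 (mills_sum 25 (dec y0)) &
      encl (imills 24 (idec y0)).2 (mills (Num.sqrt (dec y0)))].
  move=> y00 y49; have y0p : 0 < dec y0 by rewrite -(dec0 R) dec_lt.
  have sE : Num.sqrt (dec y0) ^+ 2 = dec y0 by rewrite sqr_sqrtr// ltW.
  have := @encl_mills R 24 (Num.sqrt (dec y0)) (idec y0); rewrite sE.
  apply; [by rewrite sqrtr_gt0| |exact: encl_dec].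
  (* 49 = 2 * 24 + 1 bounds the range of y in which the upper estimate [mills_le] of order 24
     applies. *)
  by have := dec_lt R y49; rewrite (dec_nat R 49) -natrM natr1.
case: (imills 24 (idec y0)) H => [[Sm Sn] M] H.
case/and5P => ya0 y00 y49 pos /andP[cr cc].
have [ESm ESn EM] := H y00 y49.
exact: (row_sound_mills ya0 y00 ESm ESn EM pos cr cc).
Qed.

End rows.

(* Consecutive rows [(yb, y0, r, nodes)] for [y = k ^ 2] from [ya] on, in units of
   10^-5: on [[ya, yb]] the bounds are tangents at [y0]. *)
Fixpoint row_table (ya rmax : Z) (t : seq (Z * Z * Z * seq Z)) : bool :=
  if t is (yb, y0, r, nodes) :: t' then
    [&& check_row ya yb y0 r nodes, (rmax <=? last 0%Z nodes)%Z & row_table yb rmax t']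
  else true.

(** For y between about 1 and 2.5 the first nodes are small: there [lam * mills ^ 2], the limit of
    the ratio as rho tends to 0, is close to 1. *)
Definition table : seq (Z * Z * Z * seq Z) :=
  [::
      (1806, 1253, 241767, [:: 73900; 89700]);
      (4659, 3232, 194718, [:: 69400; 85100; 90800]);
      (12020, 8339, 148171, [:: 62900; 78100; 84600; 87700; 89200; 90000]);
      (20910, 16465, 115488, [:: 58800; 73600; 80600; 84300; 86400; 87700; 88500; 89000;
     89300; 89500]);
      (33040, 26975, 92506, [:: 53900; 68300; 75800; 80300; 83100; 85000; 86300; 87300;
     88000; 88600; 89000; 89300; 89500]);
      (54850, 41764, 73004, [:: 44800; 58100; 65900; 71200; 75000; 77900; 80300; 82300;
     84000; 85500; 86600; 87400; 88000; 88500; 88900; 89200; 89400; 89600]);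
      (98730, 76790, 47942, [:: 24800; 34100; 40800; 46200; 50800; 55000; 59000; 62900;
     66900; 71000; 74200; 76700; 78700; 80300; 81700; 82900; 84000; 85000; 85900; 86700;
     87400; 88000; 88600; 89100; 89600]);
      (140200, 119465, 32073, [:: 4700; 7000; 9000; 11000; 13100; 15300; 17600; 20100;
     22900; 26000; 29600; 33700; 38500; 44200; 51100; 58300; 64900; 71300; 77600; 83300;
     87800; 90900]);
      (171040, 155620, 23852, [:: 7000; 11600; 16900; 23600; 32400; 42200; 52800; 64700;
     76500; 85200; 90200]);
      (205250, 188145, 18652, [:: 5400; 9000; 13100; 18200; 24900; 33800; 46000; 61800;
     76500; 85700; 90200]);
      (254510, 224954, 14345, [:: 6300; 12600; 22700; 39400; 61300; 77200; 85000; 88900;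
     90800]);
      (330860, 288868, 9342, [:: 25700; 53300; 72300; 80800; 85000; 87100; 88300; 88900;
     89300; 89500]);
      (397030, 363945, 5806, [:: 63300; 78700; 84600; 87300; 88600; 89200; 89600]);
      (444670, 420850, 4103, [:: 69000; 81500; 86100; 88100; 89100; 89600]);
      (480240, 462455, 3201, [:: 70900; 82300; 86400; 88200; 89000; 89400; 89600]);
      (500000, 499448, 2574, [:: 71400; 82400; 86400; 88200; 89000; 89400; 89600])]%Z.

Lemma table_ok : row_table 650 89500 table.
Proof. by vm_compute. Qed.

(** Fills the gap between the two elementary criteria: [criterion_large] holds from y = 5 on but
    only for rho >= 0.39, and [criterion_very_large] treats smaller rho only from y = 5.8 on. *)
Lemma last_row_ok : check_row 500000 580000 540000 2032 [:: 30100; 36400; 39000]%Z.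
Proof. by vm_compute. Qed.

Section table_sound.
Variable R : realType.
Implicit Types (k rho : R).
Local Notation dec := (dec R).

Lemma row_table_sound ya rmax t k rho : row_table ya rmax t -> 0 < k ->
  dec ya < k ^+ 2 -> k ^+ 2 <= dec (last ya [seq x.1.1.1 | x <- t]) ->
  0 < rho -> rho <= dec rmax -> 0 <= lnratio k rho.
Proof.
move=> + k0; elim: t ya => [|[[[yb y0] r] nodes] t IH] ya.
  by move=> _ /lt_geF->.
case/and3P => ok rl okt yay yl r0 rr.
have [yyb|yby] := leP (k ^+ 2) (dec yb); last exact: IH okt yby yl r0 rr.
apply: (row_sound ok k0 _ r0); first by rewrite (ltW yay).
by apply: (le_trans rr); exact: dec_le.
Qed.

End table_sound.

(** The lower bound of [drift_ge_bose] for rho up to [next]. Its second term is replaced by 0 unless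
    X < 64, the range of [iexp]; on the last cell the whole drift is replaced by 0. *)
Definition idrift (Ya Yb : ivl) (next : option Z) : ivl :=
  if next is Some s then
    let S := idec s in
    let X := imul (imul itwo (imul Yb S)) (iinv (isub ione (isqr S))) in
    iadd (imul Ya (imul (isub ione S) (iinv (iadd ione S))))
      (if ilt X (icst 64) then imul itwo (imul X (iinv (isub (iexp X) ione)))
       else icst 0)
  else icst 0.

(* The hypothesis of [comparison_right] for [rho] in [[s, next]], or [[s, 1[] if [next]
   is [None]; [a] is [artanh s] truncated to five decimals, [l] an upper bound of [lam]. *)
Definition tcell (Ya Yb l : ivl) (s a : Z) (next : option Z) : bool :=
  let S := idec s in
  let E := imul (iadd ione S) (iinv (isub ione S)) in
  [&& (0 <? a)%Z, (0 <? s)%Z, (s <? 100000)%Z, ilt ione (imul itwo (isqr S)),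
      (if next is Some s' then (s <=? s') && (s' <? 100000) else true)%Z,
      ilt (iexp (imul itwo (idec a))) E, ilt E (iexp (imul itwo (idec (a + 1)))) &
      ilt (iadd (iinv (idec a)) (imul l (imul (idec (a + 1)) (isub ione (isqr S)))))
        (iadd (idrift Ya Yb next) S)].

Fixpoint tcells (Ya Yb l : ivl) (t : seq (Z * Z)) : bool :=
  if t is (s, a) :: t' then
    tcell Ya Yb l s a (ohead [seq x.1 | x <- t']) && tcells Ya Yb l t'
  else true.

(* [r] is an upper bound of [- ln P] at [k ^ 2 = ya]. *)
Definition lnP_upper (ya r : Z) : bool :=
  let Y := idec ya in
  [&& (0 <? ya)%Z, (ya <? 4900000)%Z, ilt (icst 0) (imills 24 Y).1.1 &
      ilt (imul (idivz (icst 355) 113) (iexp Y))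
        (imul (iexp (imul itwo (idec r))) (imul (imul itwo Y) (isqr (imills 24 Y).1.1)))].

Definition trow (ya yb r : Z) (t : seq (Z * Z)) : bool :=
  lnP_upper ya r && tcells (idec ya) (idec yb) (imul (idec r) (iinv iln2)) t.

Fixpoint trow_table (ya smin : Z) (t : seq (Z * Z * seq (Z * Z))) : bool :=
  if t is (yb, r, nodes) :: t' then
    [&& trow ya yb r nodes,
        (if nodes is (s, _) :: _ then (s <=? smin)%Z else false) & trow_table yb smin t']
  else true.

Definition ttable : seq (Z * Z * seq (Z * Z)) :=
  [::
   (780, 393519, [:: (89500, 144650); (98760, 253849)]);
   (10120, 265391, [:: (89500, 144650); (93140, 166885); (95660, 190425); (97280,
     214199)]);
   (26720, 138788, [:: (89500, 144650); (90800, 151601); (91850, 157934); (92770,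
     164162); (93670, 171042); (94780, 180968)]);
   (40080, 92942, [:: (89500, 144650); (90050, 147485); (90630, 150641); (91300,
     154525); (92210, 160287); (94080, 174496)]);
   (50500, 74798, [:: (89500, 144650); (89770, 146024); (90160, 148070); (90800,
     151601); (92170, 160020)]);
   (61610, 64877, [:: (89500, 144650); (89630, 145307); (89930, 146854); (90720,
     151147); (97050, 210082)]);
   (123220, 56652, [:: (89500, 144650); (89550, 144902); (90190, 148231); (99530,
     302549)]);
   (500000, 31059, [:: (89500, 144650)])]%Z.

Lemma ttable_ok : trow_table 60 89500 ttable.
Proof. by vm_compute. Qed.

(** * Lower bounds on the drift for rho near 1 *)

Section drift_bounds.
Variable R : realType.
Implicit Types (s t u k rho : R).

Lemma bose_homo s t : 0 < s -> s <= t -> t / (expR t - 1) <= s / (expR s - 1).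
Proof.
move=> s0 st; have t0 := lt_le_trans s0 st.
have em u : 0 < u -> 0 < expR u - 1 by move=> u0; rewrite subr_gt0 -[ltLHS]expR0 ltr_expR.
rewrite ler_pdivrMr ?em// mulrAC ler_pdivlMr ?em//.
have : s * (expR s - 1) - s * (expR s - 1) <= s * (expR t - 1) - t * (expR s - 1).
  apply: (@derive_ge0_le _ (fun t => s * (expR t - 1) - t * (expR s - 1))
    (fun t => s * expR t - (expR s - 1)) _ _ st).
    by move=> u _; derive_fun; ring.
  move=> u /andP[/ltW su _]; rewrite subr_ge0.
  apply: (@le_trans _ _ (s * expR s)); last by rewrite ler_pM2l// ler_expR.
  have := expR_ge1Dx (- s); rewrite expRN => h.
  have e0 := expR_gt0 s.
  have : (1 - s) * expR s <= 1 by rewrite -ler_pdivlMr// div1r.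
  by lra.
by rewrite subrr subr_ge0.
Qed.

Lemma artanh_homo s t : 0 <= s -> s <= t -> t < 1 -> artanh s <= artanh t.
Proof.
move=> s0 st t1; apply: (derive_ge0_le st (f' := fun r => (1 - r ^+ 2)^-1)).
  by move=> u /andP[su ut]; apply: has_derive_artanh; lra.
move=> u /andP[su ut]; rewrite invr_ge0 subr_ge0 expr_le1//; lra.
Qed.

(** The derivative is 1 - 2 r artanh r, at most 1 - 2 r^2 because artanh r >= r. This is the source
    of the test 1 < 2 s^2 in [tcell]. *)
Lemma artanh_weight_antitone s t : 0 <= s -> 1 <= 2 * s ^+ 2 -> s <= t -> t < 1 ->
  artanh t * (1 - t ^+ 2) <= artanh s * (1 - s ^+ 2).
Proof.
move=> s0 s2 st t1; rewrite -lerN2.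
apply: (@derive_ge0_le _ (fun r => - (artanh r * (1 - r ^+ 2)))
  (fun r => 2 * r * artanh r - 1) _ _ st).
  move=> u /andP[su ut]; apply: has_derive_congr.
    apply: has_derive_N; apply: has_derive_M; last by repeat derive_rule.
    by apply: has_derive_artanh; lra.
  have : u ^+ 2 < 1 by rewrite expr_lt1//; lra.
  by rewrite -subr_gt0 => u1; rewrite /=; field; rewrite gt_eqF.
move=> u /andP[/ltW su /ltW ut]; have u01 : 0 <= u < 1 by lra.
have u0 : 0 <= u by case/andP: u01.
rewrite subr_ge0; apply: (le_trans s2).
apply: (@le_trans _ _ (2 * u ^+ 2)).
  by rewrite ler_pM2l// lerXn2r ?nnegrE.
by rewrite expr2 mulrA ler_wpM2l ?mulr_ge0// artanh_ge.
Qed.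

Lemma artanh_expR s : -1 < s < 1 -> expR (2 * artanh s) = (1 + s) / (1 - s).
Proof.
move=> /andP[s0 s1]; have p : 0 < 1 + s by lra.
have m : 0 < 1 - s by lra.
rewrite /artanh mulrC divfK//.
by rewrite expRD expRN !lnK.
Qed.

Lemma lam_antitone k1 k : 0 < k1 -> k1 <= k -> lam k <= lam k1.
Proof.
move=> k10 kk; have k0 := lt_le_trans k10 kk; have l2 := ln2_gt0 R.
rewrite -(ler_pM2r l2) !lam_ln2 lerN2 ler_ln ?posrE ?P_gt0//.
rewrite (PkappaE (ltW k10)) (PkappaE (ltW k0)).
apply: (@derive_ge0_le _ (fun t => gauss_cdf t - gauss_cdf (- t))
  (fun t => 2 * normal_pdf 0 1 t) _ _ kk).
  by move=> t _; exact: has_derive_P.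
by move=> t _; rewrite mulr_ge0// ltW// phi_gt0.
Qed.

(** In [drift_split], 1 + rho^2 >= 2 rho bounds the second term below by 2 z / (exp z - 1), with z =
    2 y rho / (1 - rho^2). This decreases in z, so y and rho are replaced by their upper bounds; the
    first term decreases in rho and increases in y. *)
Lemma drift_ge_bose k rho s ya yb : 0 < k -> 0 < ya -> ya <= k ^+ 2 <= yb ->
  0 < rho -> rho <= s -> s < 1 ->
  ya * ((1 - s) / (1 + s)) + 2 * (2 * (yb * s) / (1 - s ^+ 2) /
    (expR (2 * (yb * s) / (1 - s ^+ 2)) - 1)) <= drift k rho.
Proof.
move=> k0 ya0 /andP[yay yyb] r0 rs s1; set x := 2 * (yb * s) / _.
have r1 := le_lt_trans rs s1; have s0 := lt_le_trans r0 rs.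
have r01 : 0 < rho < 1 by rewrite r0.
have y0 : 0 < k ^+ 2 by rewrite exprn_gt0.
rewrite (drift_split k0 r01); apply: lerD.
  have q0 : 0 <= (1 - s) / (1 + s) by rewrite divr_ge0; lra.
  apply: ler_pM => //; first exact: ltW.
  have p : 0 < 1 + rho by lra.
  have p' : 0 < 1 + s by lra.
  by rewrite ler_pdivrMr// mulrAC ler_pdivlMr//; lra.
have tr : 0 < 1 - rho ^+ 2 by rewrite subr_gt0 expr_lt1// ltW.
have ts : 0 < 1 - s ^+ 2 by rewrite subr_gt0 expr_lt1// ltW.
set z := 2 * k ^+ 2 * rho / (1 - rho ^+ 2).
have z0 : 0 < z by rewrite divr_gt0// mulr_gt0// mulr_gt0.
have zx : z <= x.
  have sq : 1 - s ^+ 2 <= 1 - rho ^+ 2 by rewrite lerB// lerXn2r// nnegrE ltW.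
  have n1 : 2 * k ^+ 2 * rho <= 2 * (yb * s).
    rewrite -mulrA ler_pM2l//; apply: ler_pM => //; exact: ltW.
  apply: ler_pM => //; last by rewrite lef_pV2.
    by rewrite mulr_ge0 ?(ltW r0)// mulr_ge0// ltW.
  by rewrite invr_ge0 ltW.
apply: (@le_trans _ _ (2 * (z / (expR z - 1)))); first by rewrite ler_pM2l// bose_homo.
have ez : 0 < expR z - 1 by rewrite subr_gt0 -[ltLHS]expR0 ltr_expR.
rewrite mulrA ler_pM2r ?invr_gt0// /z mulrA ler_pM2r ?invr_gt0//.
rewrite [leLHS](_ : _ = 2 * k ^+ 2 * (2 * rho)); last by ring.
rewrite ler_pM2l; last by rewrite mulr_gt0.
by rewrite -subr_ge0 (_ : _ - _ = (1 - rho) ^+ 2) ?sqr_ge0//; ring.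
Qed.

(** On [s, 1[ both subtracted terms are largest at s: artanh increases, and artanh r (1 - r^2)
    decreases. *)
Lemma criterion_gt0 k rho s g l a1 a2 : 0 < k -> lam k <= l ->
  0 < s -> 1 <= 2 * s ^+ 2 -> s <= rho -> rho < 1 ->
  0 < a1 -> a1 <= artanh s <= a2 -> g <= drift k rho ->
  a1^-1 + l * (a2 * (1 - s ^+ 2)) < g + s ->
  0 < drift k rho + rho - (artanh rho)^-1 - lam k * artanh rho * (1 - rho ^+ 2).
Proof.
move=> k0 ll s0 s2 sr r1 a10 /andP[a1s sa2] gd H.
have l0 := lam_gt0 k0.
have as0 := lt_le_trans a10 a1s.
have ar := artanh_homo (ltW s0) sr r1; have ar0 := lt_le_trans as0 ar.
have i1 : (artanh rho)^-1 <= a1^-1 by rewrite lef_pV2// (le_trans a1s).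
have w := artanh_weight_antitone (ltW s0) s2 sr r1.
have s1 : 0 <= 1 - s ^+ 2.
  by rewrite subr_ge0 expr_le1// ltW// (le_lt_trans sr).
have w2 : artanh rho * (1 - rho ^+ 2) <= a2 * (1 - s ^+ 2).
  by apply: (le_trans w); rewrite ler_wpM2r.
have w0 : 0 <= artanh rho * (1 - rho ^+ 2).
  rewrite mulr_ge0 ?(ltW ar0)// subr_ge0 expr_le1 ?(ltW r1)//.
  by rewrite ltW// (lt_le_trans s0).
have : lam k * artanh rho * (1 - rho ^+ 2) <= l * (a2 * (1 - s ^+ 2)).
  by rewrite -mulrA; apply: ler_pM => //; exact: ltW.
by move: (lam k * _ * _) (l * _) (drift k rho) (artanh rho)^-1 H gd i1 => *; lra.
Qed.

End drift_bounds.

Section tcells_sound.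
Variable R : realType.
Implicit Types (k rho : R).
Local Notation dec := (dec R).

Lemma tcell_sound k rho l' Ya Yb l ya yb s a next : 0 < k -> lam k <= l' ->
  encl Ya ya -> encl Yb yb -> encl l l' ->
  0 < ya -> ya <= k ^+ 2 <= yb -> tcell Ya Yb l s a next ->
  dec s <= rho -> rho < 1 -> (if next is Some s' then rho <= dec s' else true) ->
  0 < drift k rho + rho - (artanh rho)^-1 - lam k * artanh rho * (1 - rho ^+ 2).
Proof.
move=> k0 ll Ea Eb El ya0 yab; rewrite /tcell.
case/and5P => ca cs cs1 cs2 /and4P[cn c1 c2 c3] sr r1 rn.
have s0 : 0 < dec s by rewrite -(dec0 R) dec_lt.
have s1 : dec s < 1 by rewrite -(dec1 R) dec_lt.
have r0 := lt_le_trans s0 sr; have r01 : 0 < rho < 1 by rewrite r0.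
have Es := encl_dec R s; have E1 := encl_one R; have E2 := encl_two R.
have EE := encl_mul (encl_add E1 Es) (encl_inv (encl_sub E1 Es)).
have sI : -1 < dec s < 1 by lra.
rewrite -(artanh_expR sI) in EE.
have a1 := ilt_sound (encl_exp (encl_mul E2 (encl_dec R a))) EE c1.
have a2 := ilt_sound EE (encl_exp (encl_mul E2 (encl_dec R (a + 1)))) c2.
rewrite ltr_expR ltr_pM2l// in a1; rewrite ltr_expR ltr_pM2l// in a2.
have a0 : 0 < dec a by rewrite -(dec0 R) dec_lt.
have ss := ilt_sound E1 (encl_mul E2 (encl_sqr Es)) cs2.
have [g Eg gd] : exists2 g, encl (idrift Ya Yb next) g & g <= drift k rho.
  rewrite /idrift {c3}; case: next cn rn => [s'|] cn rn; last first.
    exists 0; first exact: (encl_nat R 0).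
    apply: le_trans (drift_ge k0 r01); rewrite mulr_ge0 ?sqr_ge0// divr_ge0; lra.
  have [_ cs'] := andP cn; have s'1 : dec s' < 1 by rewrite -(dec1 R) dec_lt.
  have dg := drift_ge_bose k0 ya0 yab r0 rn s'1.
  set x := _ / (1 - _ ^+ 2) in dg.
  have Es' := encl_dec R s'.
  have EX := encl_mul (encl_mul E2 (encl_mul Eb Es')) (encl_inv (encl_sub E1 (encl_sqr Es'))).
  have Et := encl_mul Ea (encl_mul (encl_sub E1 Es') (encl_inv (encl_add E1 Es'))).
  case: ifP => _.
    exists (ya * ((1 - dec s') / (1 + dec s')) + 2 * (x / (expR x - 1))); last exact: dg.
    exact: (encl_add Et (encl_mul E2 (encl_mul EX (encl_inv (encl_sub (encl_exp EX) E1))))).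
  exists (ya * ((1 - dec s') / (1 + dec s')) + 0).
    by apply: (encl_add Et); exact: (encl_nat R 0).
  apply: le_trans dg; rewrite lerD2l mulr_ge0//.
  have s'0 := lt_le_trans r0 rn.
  have x0 : 0 < x.
    have [_ yb0] := andP yab; have := lt_le_trans ya0 (le_trans (proj1 (andP yab)) yb0).
    move=> {}yb0; rewrite divr_gt0//; first by rewrite mulr_gt0// mulr_gt0.
    by rewrite subr_gt0 expr_lt1// ltW.
  by rewrite divr_ge0 ?(ltW x0)// subr_ge0 -[leLHS]expR0 ler_expR ltW.
have H := ilt_sound (encl_add (encl_inv (encl_dec R a)) (encl_mul El
  (encl_mul (encl_dec R (a + 1)) (encl_sub E1 (encl_sqr Es))))) (encl_add Eg Es) c3.
apply: (criterion_gt0 k0 ll s0 (ltW ss) sr r1 a0 _ gd H).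
by rewrite (ltW a1) (ltW a2).
Qed.

Lemma tcells_sound k rho l' Ya Yb l ya yb t : 0 < k -> lam k <= l' ->
  encl Ya ya -> encl Yb yb -> encl l l' ->
  0 < ya -> ya <= k ^+ 2 <= yb -> tcells Ya Yb l t ->
  (if t is (s, _) :: _ then dec s <= rho else false) -> rho < 1 ->
  0 < drift k rho + rho - (artanh rho)^-1 - lam k * artanh rho * (1 - rho ^+ 2).
Proof.
move=> k0 ll Ea Eb El ya0 yab + + r1.
elim: t => [//|[s a] t IH] /andP[c ct] sr.
case: t IH c ct => [|[s' a'] t] IH c ct.
  exact: (tcell_sound k0 ll Ea Eb El ya0 yab c sr r1).
have [rs|/ltW sr'] := leP rho (dec s'); last exact: (IH ct sr').
exact: (tcell_sound k0 ll Ea Eb El ya0 yab c sr r1 rs).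
Qed.

Lemma pi_lt_zr : pi < zr R 355 / zr R 113.
Proof.
have /andP[_ +] := pi_bounds R.
by rewrite (zr_nat R 355) (zr_nat R 113).
Qed.

(** [lam] decreases in k, so one test at the left end of a row serves the whole row. *)
Lemma lnP_upper_sound ya r k : lnP_upper ya r -> 0 < k -> dec ya <= k ^+ 2 ->
  lam k <= dec r / ln 2.
Proof.
rewrite /lnP_upper => /and4P[ya0 ya49 m0 cr] k0 yk.
have yap : 0 < dec ya by rewrite -(dec0 R) dec_lt.
pose k1 := Num.sqrt (dec ya).
have k1p : 0 < k1 by rewrite sqrtr_gt0.
have k1E : k1 ^+ 2 = dec ya by rewrite sqr_sqrtr// ltW.
have EY := encl_dec R ya.
have [] := @encl_mills R 24 k1 (idec ya) k1p.
- by rewrite k1E; have := dec_lt R ya49; rewrite (dec_nat R 49) -natrM natr1.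
- by rewrite k1E.
move: (imills 24 (idec ya)).1.1 m0 cr => M m0 cr EM _ _.
rewrite k1E in EM; have m0p := encl_gt0 EM m0.
have E2 := encl_two R.
have H := ilt_sound (encl_mul (encl_divz 113 (encl_cst R 355)) (encl_exp EY))
  (encl_mul (encl_exp (encl_mul E2 (encl_dec R r)))
    (encl_mul (encl_mul E2 EY) (encl_sqr EM))) cr.
have rle : - ln (Pkappa k1) <= dec r.
  apply: (@lnP_le _ _ _ (mills_sum 24 (dec ya)) k1p (ltW m0p)).
    by rewrite -k1E; exact: mills_ge.
  rewrite k1E; apply: le_trans (ltW H).
  apply: ler_wpM2r (ltW pi_lt_zr); exact: expR_ge0.
have kk : k1 <= k.
  rewrite -k1E in yk.
  by rewrite -(@ler_pXn2r _ 2)// nnegrE ltW.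
have l2 := ln2_gt0 R.
by rewrite ler_pdivlMr//; apply: le_trans rle; rewrite -lam_ln2 ler_pM2r// lam_antitone.
Qed.

Lemma trow_sound ya yb r t k rho : trow ya yb r t -> 0 < k ->
  dec ya <= k ^+ 2 <= dec yb ->
  (if t is (s, _) :: _ then dec s <= rho else false) -> rho < 1 ->
  0 < drift k rho + rho - (artanh rho)^-1 - lam k * artanh rho * (1 - rho ^+ 2).
Proof.
move=> /andP[lu ct] k0 yab tr r1.
have yap : 0 < dec ya by case/and4P: lu => ya0 _ _ _; rewrite -(dec0 R) dec_lt.
have ll := lnP_upper_sound lu k0 (proj1 (andP yab)).
exact: (tcells_sound k0 ll (encl_dec R ya) (encl_dec R yb)
  (encl_mul (encl_dec R r) (encl_inv (encl_ln2 R))) yap yab ct tr r1).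
Qed.

Lemma trow_table_sound ya smin t k rho : trow_table ya smin t -> 0 < k ->
  dec ya < k ^+ 2 -> k ^+ 2 <= dec (last ya [seq x.1.1 | x <- t]) ->
  dec smin <= rho -> rho < 1 ->
  0 < drift k rho + rho - (artanh rho)^-1 - lam k * artanh rho * (1 - rho ^+ 2).
Proof.
move=> + k0; elim: t ya => [|[[yb r] nodes] t IH] ya.
  by move=> _ /lt_geF->.
case/and3P => ok rl okt yay yl sr r1.
have [yyb|yby] := leP (k ^+ 2) (dec yb); last exact: IH okt yby yl sr r1.
apply: (trow_sound ok k0 _ _ r1); first by rewrite (ltW yay).
case: nodes rl yl {ok} => [//|[s a] nodes] ss _.
by apply: (le_trans _ sr); exact: dec_le.
Qed.

End tcells_sound.

(** * Large and small [k] *)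

Section large_width.
Variable R : realType.
Implicit Types (k rho : R).

Lemma artanh_ge3 rho : 0 <= rho < 1 -> rho * (1 + rho ^+ 2 / 3) <= artanh rho.
Proof.
move=> r; apply: le_trans (artanh_sum_le 2 r).
by rewrite /artanh_sum !big_ord_recl big_ord0 /= expr0 expr1 divr1 addr0.
Qed.

Lemma artanh_le rho : 0 <= rho < 1 -> artanh rho * (1 - rho ^+ 2) <= rho.
Proof.
move=> /andP[r0 r1]; rewrite -subr_ge0.
rewrite [leLHS](_ : 0 = 0 - artanh 0 * (1 - 0 ^+ 2)); last first.
  by rewrite artanh0 mul0r subrr.
apply: (@derive_ge0_le _ (fun r => r - artanh r * (1 - r ^+ 2))
  (fun r => 2 * r * artanh r) _ _ r0).
  move=> t /andP[t0 tr]; apply: has_derive_congr.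
    apply: has_derive_B; first by repeat derive_rule.
    apply: has_derive_M; last by repeat derive_rule.
    by apply: has_derive_artanh; lra.
  have : t ^+ 2 < 1 by rewrite expr_lt1//; lra.
  by rewrite -subr_gt0 => t1; rewrite /=; field; rewrite gt_eqF.
move=> t /andP[t0 tr]; have t01 : 0 <= t < 1 by lra.
have := artanh_ge t01; have [? _] := andP t01.
move=> h; apply: mulr_ge0; first by rewrite mulr_ge0// ltW.
exact: le_trans h.
Qed.

Lemma lnP_upper5 : lnP_upper 500000 2568 && ilt (idec 2568) (idivz iln2 25).
Proof. by vm_compute. Qed.

Lemma lam_le_25 k : 0 < k -> 5 <= k ^+ 2 -> lam k <= 25^-1.
Proof.
move=> k0 k5; have /andP[lu i2] := lnP_upper5.
have k5' : dec R 500000 <= k ^+ 2 by rewrite (dec_nat R 5).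
apply: (le_trans (lnP_upper_sound lu k0 k5')).
have := ilt_sound (encl_dec R 2568) (encl_divz 25 (encl_ln2 R)) i2.
have e : zr R 25 = 25 := zr_nat R 25.
have l2 := ln2_gt0 R.
rewrite e {e}; move: (dec R 2568) {lu i2 k5'} => d h.
by rewrite ler_pdivrMr// mulrC ltW.
Qed.

(** The bounds artanh rho >= rho (1 + rho^2 / 3), artanh rho (1 - rho^2) <= rho and lam <= 1/25
    leave a rational inequality in rho. *)
Lemma criterion_lower k rho d : 0 < k -> 5 <= k ^+ 2 -> 0 < rho < 1 ->
  d <= drift k rho -> 3 / (rho * (3 + rho ^+ 2)) + rho / 25 < d + rho ->
  0 < drift k rho + rho - (artanh rho)^-1 - lam k * artanh rho * (1 - rho ^+ 2).
Proof.
move=> k0 k5 r01 dd H; have [r0 r1] := andP r01.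
have r01' : 0 <= rho < 1 by rewrite (ltW r0).
have a3 := artanh_ge3 r01'; have ale := artanh_le r01'.
have p0 : 0 < rho * (1 + rho ^+ 2 / 3).
  by rewrite mulr_gt0// ltr_wpDr// divr_ge0// sqr_ge0.
have i1 : (artanh rho)^-1 <= 3 / (rho * (3 + rho ^+ 2)).
  rewrite (_ : 3 / _ = (rho * (1 + rho ^+ 2 / 3))^-1); last first.
    have s0 : 0 < 3 + rho ^+ 2 by rewrite ltr_wpDr// sqr_ge0.
    by field; rewrite !gt_eqF.
  by rewrite lef_pV2// posrE (lt_le_trans p0).
have ll := lam_le_25 k0 k5; have l0 := lam_gt0 k0.
have w0 : 0 <= artanh rho * (1 - rho ^+ 2).
  rewrite mulr_ge0 ?(le_trans (ltW p0) a3)// subr_ge0 expr_le1 ?(ltW r1)//.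
  exact: ltW.
have : lam k * artanh rho * (1 - rho ^+ 2) <= 25^-1 * rho.
  by rewrite -mulrA; apply: ler_pM => //; exact: ltW.
move: (lam k * _ * _) (3 / _) (drift k rho) (artanh rho)^-1 H dd i1 => *; lra.
Qed.

Lemma criterion_large k rho : 0 < k -> 5 <= k ^+ 2 -> 39 / 100 <= rho < 1 ->
  0 < drift k rho + rho - (artanh rho)^-1 - lam k * artanh rho * (1 - rho ^+ 2).
Proof.
move=> k0 k5 /andP[r39 r1]; have r0 : 0 < rho by lra.
have r01 : 0 < rho < 1 by rewrite r0.
apply: (@criterion_lower k rho (5 * ((1 - rho) / (1 + rho)))) => //.
  apply: le_trans (drift_ge k0 r01); rewrite ler_wpM2r// divr_ge0; lra.
have s0 : 0 < 3 + rho ^+ 2 by rewrite ltr_wpDr// sqr_ge0.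
have p0 : 0 < 1 + rho by lra.
rewrite -subr_gt0 (_ : _ - _ =
  (- 3 + 12 * rho - 303 / 25 * rho ^+ 2 + 197 / 25 * rho ^+ 3 - 101 / 25 * rho ^+ 4
    + 24 / 25 * rho ^+ 5) / (rho * (3 + rho ^+ 2) * (1 + rho))); last first.
  by field; rewrite !gt_eqF.
apply: divr_gt0; last by rewrite !mulr_gt0.
(* Positivity certificate: the numerator is a combination of [h1], [h2], [h3], [h5] with nonnegative
   coefficients, plus a linear term that is positive for rho >= 39/100. *)
have h1 : 0 <= (rho - 39 / 100) * (1 - rho) by rewrite mulr_ge0; lra.
have h2 : 0 <= rho ^+ 2 * ((rho - 39 / 100) * (1 - rho)).
  by apply: mulr_ge0 => //; exact: sqr_ge0.
have h3 : 0 <= rho * (rho - 7 / 10) ^+ 2 by rewrite mulr_ge0 ?sqr_ge0 ?(ltW r0).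
have h5 : 0 <= rho ^+ 5 by rewrite exprn_ge0 ?(ltW r0).
move: h1 h2 h3 h5 {p0 s0 r01 k5 k0}; lra.
Qed.

(** Here [drift_ge] is too weak, since 1 / artanh rho is unbounded at 0. The bound drift >= (1 -
    rho^2) / rho has the right singularity. *)
Lemma criterion_very_large k rho : 0 < k -> 29 / 5 <= k ^+ 2 -> 0 < rho <= 39 / 100 ->
  0 < drift k rho + rho - (artanh rho)^-1 - lam k * artanh rho * (1 - rho ^+ 2).
Proof.
move=> k0 k5 /andP[r0 r39]; have r1 : rho < 1 by lra.
have r01 : 0 < rho < 1 by rewrite r0.
have k5' : 5 <= k ^+ 2 by lra.
have y0 : 0 < k ^+ 2 by rewrite exprn_gt0.
have tle : rho ^+ 2 <= 4 / 25.
  rewrite (_ : 4 / 25 = (2 / 5) ^+ 2); last by field.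
  by apply: lerXn2r; rewrite ?nnegrE; lra.
have t0 : 0 < rho ^+ 2 by rewrite exprn_gt0.
have tm : 0 < 1 - rho ^+ 2 by lra.
apply: (@criterion_lower k rho ((1 - rho ^+ 2) / rho)) => //.
  rewrite ler_pdivrMr// [leRHS]mulrC (drift_zcoth k0 r01).
  set z := k ^+ 2 * rho / (1 - rho ^+ 2).
  have z0 : 0 < z by rewrite divr_gt0// mulr_gt0.
  have := zcoth_quad z0; have := zcoth_ge0 z0.
  have zE : z * (1 - rho ^+ 2) = k ^+ 2 * rho by rewrite divfK// gt_eqF.
  move: (zcoth z) => c c0 q.
  (* If (1 + rho^2) c were below w, replacing c by w / (1 + rho^2) in [zcoth_quad] would keep that
     expression positive. With t = rho^2 this means (6 + 2 t + y^2) (1 - t) < 2 y (3 - t), which is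
     false for y >= 29/5 and t <= 4/25. *)
  rewrite lerBrDr leNgt; apply/negP => cw.
  set w := 1 - rho ^+ 2 + 2 * rho * z in cw.
  have w0 : 0 <= (1 + rho ^+ 2) * c by rewrite mulr_ge0 ?addr_ge0 ?sqr_ge0.
  have ww : ((1 + rho ^+ 2) * c) ^+ 2 < w ^+ 2 by rewrite ltrXn2r// nnegrE ltW// (le_lt_trans w0).
  have wl : (1 + rho ^+ 2) * ((1 + rho ^+ 2) * c) < (1 + rho ^+ 2) * w.
    by rewrite ltr_pM2l// addr_gt0.
  have qq : 0 <= (1 + rho ^+ 2) ^+ 2 * (c ^+ 2 + c - 2 - z ^+ 2).
    by rewrite mulr_ge0 ?sqr_ge0.
  have lo : (2 + z ^+ 2) * (1 + rho ^+ 2) ^+ 2 < w ^+ 2 + (1 + rho ^+ 2) * w by lra.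
  have E : (w ^+ 2 + (1 + rho ^+ 2) * w - (2 + z ^+ 2) * (1 + rho ^+ 2) ^+ 2) * (1 - rho ^+ 2)
    = - rho ^+ 2 * ((6 + 2 * rho ^+ 2 + (k ^+ 2) ^+ 2) * (1 - rho ^+ 2)
      - 2 * k ^+ 2 * (3 - rho ^+ 2)).
    rewrite (_ : _ - _ = - 6 * rho ^+ 2 - 2 * (rho ^+ 2) ^+ 2 + 2 * rho * z * (3 - rho ^+ 2)
      - z ^+ 2 * (1 - rho ^+ 2) ^+ 2); last by rewrite /w; ring.
    rewrite -exprMn zE.
    rewrite (_ : _ * (1 - rho ^+ 2) = (- 6 * rho ^+ 2 - 2 * (rho ^+ 2) ^+ 2 - (k ^+ 2 * rho) ^+ 2) *
       (1 - rho ^+ 2) + 2 * rho * (3 - rho ^+ 2) * (z * (1 - rho ^+ 2))); last by ring.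
    by rewrite zE; ring.
  have : 0 < (w ^+ 2 + (1 + rho ^+ 2) * w - (2 + z ^+ 2) * (1 + rho ^+ 2) ^+ 2) * (1 - rho ^+ 2).
    by rewrite mulr_gt0// subr_gt0.
  rewrite E mulNr oppr_gt0 pmulr_rlt0// => {E lo qq wl ww cw w0 zE}.
  move: (k ^+ 2) (rho ^+ 2) k5 tle t0 => y t y5 tl t0'.
  have a1 : 0 <= (4 / 25 - t) * (2 * y + 2 * t + 6) by rewrite mulr_ge0; lra.
  have a2 : 0 <= (y - 29 / 5) * (y - 29 / 5) by rewrite -expr2 sqr_ge0.
  have a3 : 0 <= (y - 29 / 5) * (4 / 25 - t) by rewrite mulr_ge0; lra.
  by nra.
have s0 : 0 < 3 + rho ^+ 2 by lra.
rewrite -subr_gt0 (_ : _ - _ = rho * (22 - rho ^+ 2) / (25 * (3 + rho ^+ 2))); last first.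
  by field; rewrite !gt_eqF.
by rewrite divr_gt0// mulr_gt0//; lra.
Qed.

End large_width.

(** * Small k: comparison with the ratio of densities at the origin *)

Section small_width.
Variable R : realType.
Implicit Types (k rho : R).
Local Notation dec := (dec R).
Local Notation sigma rho := (Num.sqrt (1 - rho ^+ 2)).

Lemma ent_ge_half_sqr rho : 0 <= rho < 1 -> rho ^+ 2 / 2 <= ent rho.
Proof.
move=> r; apply: le_trans (ent_sum_le 1 r).
by rewrite /ent_sum big_ord_recl big_ord0 expr0 addr0 mul1r.
Qed.

Lemma sigma0 : sigma 0 = 1 :> R.
Proof. by rewrite expr0n subr0 sqrtr1. Qed.

Lemma has_derive_ln_sigma rho : 0 <= rho < 1 ->
  has_derive (fun r => ln (sigma r)) rho (- rho / (1 - rho ^+ 2)).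
Proof.
move=> r01; have s0 : 0 < sigma rho by apply: sigma_gt0; lra.
have t0 : 0 < 1 - rho ^+ 2 by rewrite -sqrtr_gt0.
apply: has_derive_congr.
  apply: has_derive_ln; last exact: s0.
  by apply: has_derive_sqrt; [repeat derive_rule|exact: t0].
have ss : sigma rho * sigma rho = 1 - rho ^+ 2 by rewrite -expr2 sqr_sqrtr// ltW.
by rewrite -[in RHS]ss /=; field; rewrite gt_eqF.
Qed.

(** With artanh t >= t and ent t >= t^2 / 2, the derivative of the difference times 1 - t^2 is at
    least t^2 (1 - t) (3 + 2 t). *)
Lemma ln_sigma_le rho : 0 <= rho < 1 -> - ln (sigma rho) <= (1 + 2 * artanh rho) * ent rho.
Proof.
move=> /andP[r0 r1]; rewrite -subr_ge0 opprK.
rewrite [leLHS](_ : 0 = (1 + 2 * artanh 0) * ent 0 + ln (sigma 0)); last first.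
  by rewrite ent0 mulr0 sigma0 ln1 addr0.
apply: (@derive_ge0_le _ (fun r => (1 + 2 * artanh r) * ent r + ln (sigma r))
  (fun r => (2 * ent r + (1 + 2 * artanh r) * artanh r * (1 - r ^+ 2) - r) /
     (1 - r ^+ 2)) _ _ r0).
  move=> t /andP[t0 tr]; have t01 : 0 <= t < 1 by lra.
  apply: has_derive_congr.
    apply: has_derive_D; last exact: has_derive_ln_sigma.
    apply: has_derive_M; last by apply: has_derive_ent; lra.
    apply: has_derive_D; first exact: has_derive_cst.
    by apply: has_derive_M; [exact: has_derive_cst|apply: has_derive_artanh; lra].
  have : t ^+ 2 < 1 by rewrite expr_lt1//; lra.
  by rewrite -subr_gt0 => u0; rewrite /=; field; rewrite gt_eqF.
move=> t /andP[/ltW t0 tr]; have t01 : 0 <= t < 1 by lra.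
have t1 : t <= 1 by lra.
have u0 : 0 <= 1 - t ^+ 2 by rewrite subr_ge0 expr_le1.
apply: divr_ge0 => //.
have e := ent_ge_half_sqr t01; have a := artanh_ge t01.
have aa : (1 + 2 * t) * t <= (1 + 2 * artanh t) * artanh t.
  by apply: ler_pM => //; lra.
have : (1 + 2 * t) * t * (1 - t ^+ 2) <= (1 + 2 * artanh t) * artanh t * (1 - t ^+ 2).
  by rewrite ler_wpM2r.
have : 0 <= t ^+ 2 * ((1 - t) * (3 + 2 * t)).
  by apply: mulr_ge0; [exact: sqr_ge0|apply: mulr_ge0; lra].
by move: (ent t) (_ * artanh t * _) e => *; lra.
Qed.

(** 1 / sigma is the ratio at the origin of the densities of the correlated and the independent
    pair, hence the limit of q / P^2 as k tends to 0. The comparison of derivatives reduces to exp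
    (y / 4) <= mills. *)
Lemma qcorr_le_inv_sigma k rho : 0 < k -> k ^+ 2 <= 1 -> 0 <= rho < 1 ->
  qcorr k rho <= Pkappa k ^+ 2 / sigma rho.
Proof.
move=> k0 k1 /andP[r0 r1]; have y0 : 0 < k ^+ 2 by rewrite exprn_gt0.
rewrite -subr_ge0.
rewrite [leLHS](_ : 0 = Pkappa k ^+ 2 * (sigma 0)^-1 - qcorr k 0); last first.
  by rewrite sigma0 invr1 mulr1 /qcorr square_event0 ?subrr// ltW.
apply: (@derive_ge0_le _ (fun r => Pkappa k ^+ 2 * (sigma r)^-1 - qcorr k r)
  (fun r => (Pkappa k ^+ 2 * r / (1 - r ^+ 2) - ediff k r / pi) / sigma r) _ _ r0).
  move=> t /andP[t0 tr]; have t01 : 0 <= t < 1 by lra.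
  have s0 : 0 < sigma t by apply: sigma_gt0; lra.
  have tt0 : 0 < 1 - t ^+ 2 by rewrite -sqrtr_gt0.
  apply: has_derive_congr.
    apply: has_derive_B; last exact: has_derive_qcorr.
    apply: has_derive_M; first exact: has_derive_cst.
    apply: has_derive_V; last by rewrite gt_eqF.
    by apply: has_derive_sqrt; [repeat derive_rule|exact: tt0].
  have ss : 1 - t ^+ 2 = sigma t ^+ 2 by rewrite sqr_sqrtr// ltW.
  move: (ediff k t) (Pkappa k) (sigma t) ss s0 => e P s ss s0; rewrite ss.
  have := pi_gt0 R; move: (pi : R) => p p0.
  by rewrite /=; field; rewrite !gt_eqF.
move=> t /andP[t0 tr]; have t01 : 0 < t < 1 by lra.
have s0 : 0 < sigma t by apply: sigma_gt0; lra.
have u0 : 0 < 1 - t ^+ 2 by rewrite -sqrtr_gt0.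
apply: divr_ge0; last exact: ltW.
rewrite subr_ge0 ler_pdivrMr ?pi_gt0//.
rewrite (_ : _ * pi = Pkappa k ^+ 2 * pi * (t / (1 - t ^+ 2))); last by ring.
rewrite Pkappa_sqr// /ediff.
have -> : - k ^+ 2 / (1 - t) = - k ^+ 2 / (1 + t) - 2 * k ^+ 2 * (t / (1 - t ^+ 2)).
  rewrite (_ : 1 - t ^+ 2 = (1 + t) * (1 - t)); last by ring.
  by field; rewrite !gt_eqF//; lra.
set u := t / _; have u0' : 0 <= u by apply: divr_ge0; exact: ltW.
rewrite expRD -[X in X - _]mulr1 -mulrBr.
have h1 : 1 - expR (- (2 * k ^+ 2 * u)) <= 2 * k ^+ 2 * u.
  by have := expR_ge1Dx (- (2 * k ^+ 2 * u)); lra.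
have h0 : 0 <= 1 - expR (- (2 * k ^+ 2 * u)).
  rewrite subr_ge0 -[leRHS]expR0 ler_expR oppr_le0; apply: mulr_ge0 => //.
  by apply: mulr_ge0 => //; exact: ltW.
have h2 : expR (- k ^+ 2 / (1 + t)) <= expR (- k ^+ 2 / 2).
  rewrite ler_expR !mulNr lerN2 ler_pM2l// lef_pV2 ?posrE; lra.
apply: (@le_trans _ _ (expR (- k ^+ 2 / 2) * (2 * k ^+ 2 * u))).
  by apply: ler_pM => //; exact: expR_ge0.
rewrite (_ : 2 * k ^+ 2 * mills k ^+ 2 * expR (- k ^+ 2) * u =
  (mills k ^+ 2 * expR (- k ^+ 2)) * (2 * k ^+ 2 * u)); last by ring.
apply: ler_wpM2r.
  by apply: mulr_ge0 => //; apply: mulr_ge0 => //; exact: ltW.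
have h3 : expR (k ^+ 2 / 4) <= mills k.
  apply: le_trans (mills_ge 2 k0).
  have -> : mills_sum 2 (k ^+ 2) = 1 + k ^+ 2 / 3.
    by rewrite /mills_sum !big_ord_recl big_ord0 /= expr0 expr1 !mul1r invr1 addr0.
  have := expR_ge1Dx (- (k ^+ 2 / 4)); rewrite expRN => h.
  have e0 := expR_gt0 (k ^+ 2 / 4).
  have c0 : 0 < 1 - k ^+ 2 / 4 by lra.
  have h4 : expR (k ^+ 2 / 4) <= (1 - k ^+ 2 / 4)^-1.
    by rewrite -[leLHS]invrK lef_pV2 ?posrE ?invr_gt0.
  apply: (le_trans h4); rewrite -[leLHS]mul1r ler_pdivrMr//.
  have : 0 <= k ^+ 2 * (1 - k ^+ 2) by rewrite mulr_ge0 ?(ltW y0)// subr_ge0.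
  by move: (k ^+ 2) => y; lra.
have -> : expR (- k ^+ 2 / 2) = expR (k ^+ 2 / 4) ^+ 2 * expR (- k ^+ 2).
  by rewrite -expRM_natl -expRD; congr expR; field.
rewrite ler_pM2r ?expR_gt0//; apply: lerXn2r; rewrite ?nnegrE ?expR_ge0//.
exact: ltW (mills_gt0 k0).
Qed.

(** It suffices that 1 / sigma <= exp (lam ent), which [ln_sigma_le] gives once lam >= 1 + 2 artanh
    r1. *)
Lemma qcorr_le_rbound_left k rho r1 : 0 < k -> k ^+ 2 <= 1 -> 0 <= rho <= r1 -> r1 < 1 ->
  1 + 2 * artanh r1 <= lam k -> qcorr k rho <= rbound k rho.
Proof.
move=> k0 k1 /andP[r0 rr] r11 hl; have r1' := le_lt_trans rr r11.
have r01 : 0 <= rho < 1 by rewrite r0.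
apply: (le_trans (qcorr_le_inv_sigma k0 k1 r01)).
have s0 : 0 < sigma rho by apply: sigma_gt0; lra.
have P0 := P_gt0 k0; rewrite /rbound ler_pM2l ?exprn_gt0//.
rewrite -[leLHS]lnK ?posrE ?invr_gt0// ler_expR lnV ?posrE//.
apply: (le_trans (ln_sigma_le r01)); rewrite ler_wpM2r//.
  by apply: le_trans (ent_ge_half_sqr r01); rewrite divr_ge0// sqr_ge0.
by apply: le_trans hl; rewrite lerD2l ler_pM2l// artanh_homo.
Qed.

(** The test of [lnP_ge] with mills <= 1 / (1 - y) and exp y >= 1. Its left side increases in y, so
    one test covers all smaller k. *)
Definition small_lnP (ya r : Z) : bool :=
  let Y := idec ya in
  [&& (0 <? ya)%Z, (ya <? 100000)%Z &
   ilt (imul (iexp (imul itwo (idec r))) (imul (imul itwo Y) (isqr (iinv (isub ione Y)))))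
       (idivz (icst 333) 106)].

Lemma small_lnP_sound ya r k : small_lnP ya r -> 0 < k -> k ^+ 2 <= dec ya ->
  dec r <= - ln (Pkappa k).
Proof.
rewrite /small_lnP => /and3P[ya0 ya1 c] k0 yy.
have y1 : dec ya < 1 by rewrite -(dec1 R) dec_lt.
have y0 : 0 < k ^+ 2 by rewrite exprn_gt0.
have EY := encl_dec R ya; have E1 := encl_one R; have E2 := encl_two R.
have := ilt_sound (encl_mul (encl_exp (encl_mul E2 (encl_dec R r)))
  (encl_mul (encl_mul E2 EY) (encl_sqr (encl_inv (encl_sub E1 EY)))))
  (encl_divz 106 (encl_cst R 333)) c => {c EY E1 E2} H.
have p0 := pi_gt_zr R; move: H p0; move: (_ / zr R 106) => z H p0.
have c1 : 0 < 1 - k ^+ 2 by rewrite subr_gt0 (le_lt_trans yy).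
have c2 : 0 < 1 - dec ya by rewrite subr_gt0.
have mle : mills k <= (1 - k ^+ 2)^-1.
  have := @mills_le R 0 k k0; rewrite mulr0 add0r /mills_sum big_ord0 add0r.
  by rewrite expr0 !mul1r; apply; rewrite -subr_gt0.
apply: (lnP_ge k0 mle).
apply: (@le_trans _ _ pi); last first.
  by rewrite ler_peMr ?pi_ge0// -[leLHS]expR0 ler_expR ltW.
apply: le_trans (ltW p0); apply: le_trans (ltW H).
rewrite ler_pM2l ?expR_gt0//; apply: ler_pM.
- by rewrite mulr_ge0// ltW.
- exact: sqr_ge0.
- by rewrite ler_pM2l.
apply: lerXn2r; rewrite ?nnegrE ?invr_ge0 ?(ltW c1) ?(ltW c2)//.
by rewrite lef_pV2// lerB.
Qed.

End small_width.

(** * Conclusion *)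

Section comparison_all.
Variable R : realType.
Implicit Types (k rho : R).
Local Notation dec := (dec R).

(** The drift is dropped and [lam] replaced by 1 + 2 A with A = artanh rho. Since 1 - rho = (1 +
    rho) exp (- 2 A), the remaining loss is a polynomial in A against exp (2 A). *)
Lemma criterion_tiny k rho : 0 < k -> 0 < rho < 1 ->
  28 / 5 <= lam k -> lam k <= 1 + 2 * artanh rho ->
  0 < drift k rho + rho - (artanh rho)^-1 - lam k * artanh rho * (1 - rho ^+ 2).
Proof.
move=> k0 r01 l5 la; have [r0 r1] := andP r01.
have d0 : 0 <= drift k rho.
  apply: le_trans (drift_ge k0 r01); rewrite mulr_ge0 ?sqr_ge0// divr_ge0; lra.
have e46 : 497 / 5 <= expR (23 / 5) :> R.
  have c : ilt (idivz (icst 497) 5) (iexp (idivz (icst 23) 5)) by vm_compute.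
  have := ilt_sound (encl_divz 5 (encl_cst R 497))
    (encl_exp (encl_divz 5 (encl_cst R 23))) c => {c}.
  have -> : zr R 497 = 497 := zr_nat R 497.
  have -> : zr R 23 = 23 := zr_nat R 23.
  have -> : zr R 5 = 5 := zr_nat R 5.
  exact: ltW.
have Ea : expR (2 * artanh rho) * (1 - rho) = 1 + rho.
  have rI : -1 < rho < 1 by lra.
  by rewrite (artanh_expR rI) divfK// gt_eqF// subr_gt0.
have l0 := lam_gt0 k0.
move: (artanh rho) la Ea => A la Ea.
have [w wE] : exists w, w = 2 * A - 23 / 5 by exists (2 * A - 23 / 5).
have w0 : 0 <= w by rewrite wE; lra.
have Ew : 497 / 5 * (1 + w + w ^+ 2 / 4) <= expR (2 * A).
  rewrite (_ : 2 * A = 23 / 5 + (w / 2 + w / 2)); last by rewrite wE; field.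
  have q0 : 0 <= 1 + w + w ^+ 2 / 4 by rewrite !addr_ge0// divr_ge0// sqr_ge0.
  rewrite expRD; apply: (le_trans (ler_wpM2r q0 e46)).
  apply: ler_wpM2l (expR_ge0 _) _ _ _.
  rewrite expRD (_ : 1 + _ + _ = (1 + w / 2) * (1 + w / 2)); last by field.
  have w2 : 0 <= 1 + w / 2 by rewrite addr_ge0// divr_ge0.
  by apply: ler_pM (expR_ge1Dx _) (expR_ge1Dx _).
move: (expR _) (drift k rho) d0 Ea Ew => E d d0 Ea Ew.
have AE : A = 23 / 10 + w / 2 by rewrite wE; field.
have A0 : 0 < A by lra.
have A1 : 0 <= A - 1 by lra.
have ws : 0 <= w ^+ 2 by rewrite sqr_ge0.
have E0 : 0 < E by lra.
have rE : (1 - rho) * E <= 2 by lra.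
have tE : (1 - rho ^+ 2) * E <= 4.
  rewrite (_ : _ * E = (1 + rho) * ((1 - rho) * E)); last by ring.
  rewrite (_ : 4 = 2 * 2); last by ring.
  apply: ler_pM => //; [lra|by rewrite mulr_ge0 ?(ltW E0)// subr_ge0 ltW|lra].
have w3 : 0 <= w ^+ 3 by rewrite exprn_ge0.
(* At A = 23/10, the least value allowed by lam >= 28/5, the sides are about 123 and 129, so the
   constant 28/5 has little room. *)
have main : 2 * A + 4 * A ^+ 2 + 8 * A ^+ 3 < E * (A - 1).
  have : 497 / 5 * (1 + w + w ^+ 2 / 4) * (A - 1) <= E * (A - 1) by rewrite ler_wpM2r.
  apply: lt_le_trans; rewrite AE; lra.
have t0 : 0 <= 1 - rho ^+ 2 by rewrite subr_ge0 expr_le1 ?(ltW r0) ?(ltW r1).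
apply: (@lt_le_trans _ _ (rho - A^-1 - (1 + 2 * A) * A * (1 - rho ^+ 2))); last first.
  have : lam k * A * (1 - rho ^+ 2) <= (1 + 2 * A) * A * (1 - rho ^+ 2).
    by rewrite ler_wpM2r// ler_wpM2r// ltW.
  by move: (_ * A * _) (_ * A * _) => *; lra.
rewrite -(pmulr_rgt0 _ (mulr_gt0 A0 E0)).
rewrite [ltRHS](_ : _ = A * (E - (1 - rho) * E) - E -
  (1 + 2 * A) * A ^+ 2 * ((1 - rho ^+ 2) * E)); last by field; rewrite gt_eqF.
have b1 : A * ((1 - rho) * E) <= A * 2 by rewrite ler_pM2l.
have b2 : (1 + 2 * A) * A ^+ 2 * ((1 - rho ^+ 2) * E) <= (1 + 2 * A) * A ^+ 2 * 4.
  by rewrite ler_wpM2l// mulr_ge0 ?sqr_ge0//; lra.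
move: ((1 - rho) * E) ((1 - rho ^+ 2) * E) b1 b2 => u v b1 b2; lra.
Qed.

(** They give lam >= 3.9 for y <= 0.0065, lam >= 5.6 for y <= 0.0006, and 2 artanh 0.895 < 2.9,
    since 379/21 = 1.895 / 0.105. The first and the last meet in 1 + 2 artanh 0.895 < 3.9. *)
Lemma small_checks :
  [/\ small_lnP 650 270340, small_lnP 60 388170,
      ilt (idivz (imul (icst 39) iln2) 10) (idec 270340),
      ilt (idivz (imul (icst 28) iln2) 5) (idec 388170) &
      ilt (idivz (icst 379) 21) (iexp (idivz (icst 29) 10))].
Proof. by vm_compute. Qed.

Lemma lam_ge_of_lnP k a b r : 0 < k -> dec r <= - ln (Pkappa k) ->
  ilt (idivz (imul (icst (Z.of_nat a)) iln2) (Z.of_nat b)) (idec r) ->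
  a%:R / b%:R <= lam k.
Proof.
move=> k0 rl c.
have := ilt_sound (encl_divz (Z.of_nat b) (encl_mul (encl_nat R a) (encl_ln2 R)))
  (encl_dec R r) c => {c}.
rewrite zr_nat mulrAC => /ltW H.
by rewrite -(ler_pM2r (ln2_gt0 R)) lam_ln2 (le_trans H).
Qed.

Lemma dec_ratio a b (c : Z) : (0 < c)%Z -> (Z.of_nat b * c = 100000)%Z ->
  dec (Z.of_nat a * c) = a%:R / b%:R.
Proof.
move=> c0 bc; rewrite /dec -bc !zrM !zr_nat -mulf_div divff ?mulr1//.
by rewrite gt_eqF// zr_gt0.
Qed.

Lemma dec895 : dec 89500 = 179 / 200.
Proof. exact: (@dec_ratio 179 200 500). Qed.

Lemma dec39 : dec 39000 = 39 / 100.
Proof. exact: (@dec_ratio 39 100 1000). Qed.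

Lemma dec58 : dec 580000 = 29 / 5.
Proof. exact: (@dec_ratio 29 5 20000). Qed.

Lemma qcorr_split k rho r1 : 0 < k -> 0 < r1 < 1 ->
  (forall rho, 0 < rho <= r1 -> qcorr k rho <= rbound k rho) ->
  (forall rho, r1 <= rho < 1 -> 0 < drift k rho + rho - (artanh rho)^-1
     - lam k * artanh rho * (1 - rho ^+ 2)) ->
  0 < rho < 1 -> qcorr k rho <= rbound k rho.
Proof.
move=> k0 /andP[r10 r11] left right /andP[r0 rlt1].
have [rr|rr] := leP rho r1; first by apply: left; rewrite r0.
apply: (@comparison_right R k k0 r1) => //.
- by rewrite (ltW r10).
- by apply: left; rewrite r10 lexx.
- by move=> x /andP[/ltW rx x1]; apply: right; rewrite rx.
- by rewrite rr.
Qed.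

Lemma qcorr0_le k : 0 < k -> qcorr k 0 <= rbound k 0.
Proof.
move=> k0; rewrite /qcorr square_event0 ?(ltW k0)// /rbound ent0 mulr0 expR0 mulr1.
exact: lexx.
Qed.

Lemma lam_ge_tiny k : 0 < k -> k ^+ 2 <= dec 60 -> 28 / 5 <= lam k.
Proof.
move=> k0 y1; have [_ s2 _ l2 _] := small_checks.
exact: (@lam_ge_of_lnP k 28 5 388170 k0 (small_lnP_sound s2 k0 y1) l2).
Qed.

Lemma lam_ge_small k : 0 < k -> k ^+ 2 <= dec 650 -> 39 / 10 <= lam k.
Proof.
move=> k0 y1; have [s1 _ l1 _ _] := small_checks.
exact: (@lam_ge_of_lnP k 39 10 270340 k0 (small_lnP_sound s1 k0 y1) l1).
Qed.

Lemma artanh_895 : artanh (dec 89500) < 29 / 20.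
Proof.
have [_ _ _ _ a1] := small_checks.
have := ilt_sound (encl_divz 21 (encl_cst R 379))
  (encl_exp (encl_divz 10 (encl_cst R 29))) a1 => {a1}.
have -> : zr R 379 = 379 := zr_nat R 379.
have -> : zr R 21 = 21 := zr_nat R 21.
have -> : zr R 29 = 29 := zr_nat R 29.
have -> : zr R 10 = 10 := zr_nat R 10.
have -> : 379 / 21 = (1 + dec 89500) / (1 - dec 89500).
  have -> : 1 + dec 89500 = 379 / 200 by rewrite dec895; lra.
  have -> : 1 - dec 89500 = 21 / 200 by rewrite dec895; lra.
  by field.
rewrite -artanh_expR; last by rewrite dec895; lra.
by rewrite ltr_expR; move: (artanh _) => A; lra.
Qed.

Lemma qcorr_le_rbound_small k rho : 0 < k -> k ^+ 2 <= dec 650 ->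
  0 <= rho <= dec 89500 -> qcorr k rho <= rbound k rho.
Proof.
move=> k0 y1 r01.
have yle1 : k ^+ 2 <= 1 by apply: (le_trans y1); rewrite -(dec1 R) dec_le.
have r1 : dec 89500 < 1 by rewrite dec895; lra.
apply: (qcorr_le_rbound_left k0 yle1 r01 r1).
apply: le_trans (lam_ge_small k0 y1).
by have := artanh_895; move: (artanh _) => A; lra.
Qed.

Lemma qcorr_le_rbound_tiny k rho : 0 < k -> k ^+ 2 <= dec 60 ->
  0 < rho < 1 -> qcorr k rho <= rbound k rho.
Proof.
move=> k0 y1 r01.
have yle1 : k ^+ 2 <= 1 by apply: (le_trans y1); rewrite -(dec1 R) dec_le.
have l5 := lam_ge_tiny k0 y1.
set e := expR (lam k - 1).
have e1 : 1 < e by rewrite /e -[ltLHS]expR0 ltr_expR; lra.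
have ep : 0 < e + 1 by lra.
(* t = tanh ((lam - 1) / 2) solves 1 + 2 artanh t = lam: to its left [qcorr_le_rbound_left] applies,
   to its right [criterion_tiny]. *)
pose t := (e - 1) / (e + 1).
have t0 : 0 < t by rewrite divr_gt0// subr_gt0.
have t1 : t < 1 by rewrite ltr_pdivrMr//; lra.
have tA : 1 + 2 * artanh t = lam k.
  suff e2 : 2 * artanh t = lam k - 1 by rewrite e2 addrC subrK.
  apply: expR_inj; rewrite -/e artanh_expR; last by lra.
  by rewrite /t; field; lra.
apply: (@qcorr_split k rho t) => //; first by rewrite t0.
  move=> x /andP[/ltW x0 xt]; apply: (@qcorr_le_rbound_left _ k x t) => //.
    by rewrite x0.
  by rewrite tA.
move=> x /andP[tx x1]; apply: criterion_tiny => //; first by rewrite (lt_le_trans t0).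
by rewrite -tA lerD2l ler_pM2l// artanh_homo// ltW.
Qed.

Lemma qcorr_le_rbound k rho : 0 < k -> 0 <= rho < 1 -> qcorr k rho <= rbound k rho.
Proof.
move=> k0 /andP[]; rewrite le_eqVlt => /predU1P[<- _|r0 r1]; first exact: qcorr0_le.
have r01 : 0 < rho < 1 by rewrite r0.
have [y1|y1] := leP (k ^+ 2) (dec 60).
  exact: qcorr_le_rbound_tiny.
have r895 : 0 < dec 89500 < 1 by rewrite dec895; lra.
have [y2|y2] := leP (k ^+ 2) (dec 500000).
  have right x : dec 89500 <= x < 1 -> 0 < drift k x + x - (artanh x)^-1
     - lam k * artanh x * (1 - x ^+ 2).
    by move=> /andP[? ?]; apply: (trow_table_sound ttable_ok k0 y1 y2).
  apply: (qcorr_split k0 r895 _ right r01).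
  have [y3|y3] := leP (k ^+ 2) (dec 650).
    by move=> x /andP[/ltW x0 xr]; apply: qcorr_le_rbound_small; rewrite ?x0.
  move=> x /andP[x0 xr]; have [_ r895'] := andP r895.
  apply: (@comparison_left R k k0 (dec 89500)) => //; last by rewrite (ltW x0).
  move=> z /andP[z0 zr]; exact: (row_table_sound table_ok k0 y3 y2 z0 zr).
have y5 : 5 <= k ^+ 2 by rewrite -(dec_nat R 5) ltW.
have [y4|y4] := leP (k ^+ 2) (dec 580000).
  have r39 : 0 < dec 39000 < 1 by rewrite dec39; lra.
  apply: (qcorr_split k0 r39 _ _ r01).
    move=> x /andP[x0 xr]; have [_ r39'] := andP r39.
    apply: (@comparison_left R k k0 (dec 39000)) => //; last by rewrite (ltW x0).
    move=> z /andP[z0 zr]; apply: (row_sound last_row_ok k0 _ z0) => //.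
    by rewrite (ltW y2).
  by move=> x xr; apply: criterion_large => //; rewrite -dec39.
(* For y > 5.8 the ratio decreases on all of ]0, 1[, so r = 0 and the left part is the equality at
   0. *)
apply: (comparison_right k0 _ (qcorr0_le k0) _ r01); first by rewrite lexx ltr01.
move=> x /andP[x0 x1].
have [x39|x39] := leP x (39 / 100).
  by apply: criterion_very_large; rewrite ?x0// -dec58 ltW.
by apply: criterion_large; rewrite // (ltW x39).
Qed.

End comparison_all.

Lemma qcorr1 (R : realType) (k : R) : 0 < k -> qcorr k 1 = Pkappa k.
Proof.
move=> k0; rewrite /qcorr /Pkappa; set A := [set z | _].
have mA : measurable (A : set (measurableTypeR R)) by rewrite /A itv_norm.
rewrite (_ : square_event k 1 = A `*` setT).
  have -> : @std_gaussian2 R (A `*` setT) =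
      (normal_prob 0 1 A * normal_prob 0 1 setT)%E.
    exact: (product_measure1E _ _ mA measurableT).
  by rewrite probability_setT mule1.
apply/seteqP; split=> w; rewrite /square_event /A /= /N1 /N2.
  by case.
rewrite expr1n subrr sqrtr0 mul0r addr0 mul1r => -[? _]; split=> //.
Qed.

Lemma ln_qcorr_le (R : realType) (k rho : R) : 0 < k -> 0 <= rho <= 1 ->
  ln (qcorr k rho) <= 2 * ln (Pkappa k) + lam k * ent rho.
Proof.
move=> k0 /andP[r0]; rewrite le_eqVlt => /predU1P[->|r1].
  rewrite qcorr1// ent1 /lam mulNr divfK ?gt_eqF ?ln2_gt0//.
  by rewrite mulr_natl mulr2n addrK.
have P0 := P_gt0 k0.
have r01 : 0 <= rho < 1 by rewrite r0.
have q0 : 0 < qcorr k rho.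
  by apply: (lt_le_trans _ (qcorr_ge k0 r01)); rewrite exprn_gt0.
have -> : 2 * ln (Pkappa k) + lam k * ent rho = ln (rbound k rho).
  rewrite /rbound lnM ?posrE ?expR_gt0 ?exprn_gt0// expRK lnXn//.
  by rewrite mulr_natl.
by rewrite ler_ln ?posrE ?rbound_gt0// qcorr_le_rbound.
Qed.

(** The source of strictness: the bound on q is not strict, but a l < 1 and e > 0 make a l e < e. *)
Lemma exponent_lt (R : realFieldType) (a l e x p c : R) : 0 < a -> 0 < e ->
  x <= 2 * p + l * e -> a * l < 1 -> a * x + (c - e) < a * (p *+ 2) + c.
Proof.
move=> a0 e0 xle al1.
have : a * x <= a * (2 * p + l * e) by rewrite ler_pM2l.
have : a * l * e < e by rewrite gtr_pMl.
by rewrite -mulr_natl; lra.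
Qed.

Theorem lemma3p4 (R : realType) (kappa alpha : R)
    (kappa_gt0 : 0 < kappa)
    (alpha_gt0 : 0 < alpha) (alpha_lt : alpha < alpha_c kappa)
    (x : R) (x01 : 0 <= x <= 1) (x_neq : x <> 2^-1) :
  F kappa alpha x < F kappa alpha 2^-1.
Proof.
(* Both q and the entropy are even in the correlation, and r > 0 expresses x <> 1/2. *)
pose r := `|2 * x - 1|.
have [x0 x1] := andP x01.
have r0 : 0 < r.
  by rewrite normr_gt0 subr_eq0; apply/eqP => xE; apply: x_neq; lra.
have r1 : r <= 1 by rewrite ler_norml; apply/andP; split; lra.
have r01 : 0 <= r <= 1 by rewrite (ltW r0).
have half01 : 0 <= (2^-1 : R) <= 1 by apply/andP; split; lra.
have half : 2 * 2^-1 - 1 = 0 :> R by field.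
have rE : r = 2 * x - 1 \/ r = - (2 * x - 1).
  rewrite /r; have [h|h] := leP 0 (2 * x - 1); first by left; rewrite ger0_norm.
  by right; rewrite ltr0_norm.
have qE : q kappa x = qcorr kappa r.
  have qE0 : q kappa x = qcorr kappa (2 * x - 1) := erefl.
  case: rE => ->; rewrite qE0; first exact: erefl.
  apply/esym; apply: std_gaussian2_squareN; first exact: ltW.
  by apply/andP; split; lra.
have entE : ent (2 * x - 1) = ent r.
  by case: rE => ->; rewrite ?entN.
have qhalf : q kappa 2^-1 = Pkappa kappa ^+ 2.
  have -> : q kappa 2^-1 = qcorr kappa (2 * 2^-1 - 1) := erefl.
  by rewrite half; exact: square_event0 (ltW kappa_gt0).
have e0 : 0 < ent r.
  move: r1; rewrite le_eqVlt => /predU1P[->|r1]; first by rewrite ent1 ln2_gt0.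
  by apply: ent_gt0; rewrite r0.
have HE z : 0 <= z <= 1 ->
    F kappa alpha z = alpha * ln (q kappa z) + (ln 2 - ent (2 * z - 1)).
  by move=> /entropyE <-; rewrite /F; ring.
rewrite (HE x x01) (HE _ half01) qhalf half ent0 subr0 qE entE.
have P0 := P_gt0 kappa_gt0.
have l0 := lam_gt0 kappa_gt0.
rewrite (lnXn 2 P0).
apply: (exponent_lt _ alpha_gt0 e0 (ln_qcorr_le kappa_gt0 r01)).
rewrite -(ltr_pdivlMr _ _ l0) div1r; apply: (lt_le_trans alpha_lt).
by rewrite /alpha_c /lam invrN invf_div.
Qed.
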